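(* Fix $\alpha>0$. For every positive integer $d$ (large enough that $\lfloor \alpha d^2\rfloor\geq 1$), let $W_d$ be a $(d^2,\lfloor \alpha d^2 \rfloor)$-Wishart matrix (real or complex), and let $Y_d=W_d^\Gamma$ be the partial transposition of $W_d$. Then for every interval $I \subset \mathbb{R}$ and every $\varepsilon >0$, \[ \lim_{d \to \infty} \mathbf{P} \left( \left| N_{Y_d}(I) - \mu_{SC(1,1/\alpha)}(I) \right| > \varepsilon \right) = 0 .\]
   Context: A $(n,p)$-Wishart matrix is a random $n\times n$ matrix $W=\frac1p GG^\dagger$, where $G$ is an $n\times p$ matrix with independent $N(0,1)$ entries, either all real or all complex. A complex $N(0,1)$ variable has independent real and imaginary parts, each real $N(0,\frac12)$. The result is asserted in both the real and the complex case. For $n=d^2$, an $n\times n$ matrix $A$ is viewed as a $d\times d$ block matrix with $d\times d$ blocks, with entries $A_{i,j}^{k,l}$ ($i,j,k,l\in\{1,\dots,d\}$): $i$ is the block row index, $j$ the block column index, $k$ the row index and $l$ the column index inside block $(i,j)$. The partial transposition $A^\Gamma$ is obtained by transposing each block: $(A^\Gamma)_{i,j}^{k,l}=A_{i,j}^{l,k}$. For a Hermitian $n\times n$ matrix $A$ with eigenvalues $\lambda_1,\dots,\lambda_n$ (with multiplicity), $N_A=\frac1n\sum_{i=1}^n\delta_{\lambda_i}$, so $N_A(I)$ is the proportion of eigenvalues in $I$. For $m\in\mathbb{R}$, $\sigma>0$, $\mu_{SC(m,\sigma^2)}$ is the semicircular distribution with support $[m-2\sigma,m+2\sigma]$ and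 density $\frac{1}{2\pi\sigma^2}\sqrt{4\sigma^2-(x-m)^2}$ there. *)

(* Defs.v *)
From HB Require Import structures.
From mathcomp Require Import all_boot all_order all_algebra.
From mathcomp Require Import all_classical all_reals all_analysis.
From mathcomp Require Import complex mxtens.

Set Implicit Arguments.
Unset Strict Implicit.
Unset Printing Implicit Defensive.

Import Order.TTheory GRing.Theory Num.Theory.
Import numFieldNormedType.Exports.

Local Open Scope classical_set_scope.
Local Open Scope ring_scope.
Local Open Scope complex_scope.
Local Open Scope sesquilinear_scope.

Section probability.
Context (disp : measure_display) (T : measurableType disp) (R : realType)
  (P : probability T R).

Definition mutually_independent (disp' : measure_display)
    (T' : measurableType disp') (I : finType) (X : I -> T -> T') : Prop :=
  forall (J : {set I}) (A : I -> set T'), (forall i, measurable (A i)) ->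
    P (\bigcap_(i in [set` J]) (X i @^-1` A i)) =
    (\prod_(i in J) P (X i @^-1` A i))%E.

Definition independent2 (X Y : T -> R) : Prop :=
  forall A B : set R, measurable A -> measurable B ->
    P (X @^-1` A `&` Y @^-1` B) = (P (X @^-1` A) * P (Y @^-1` B))%E.

(* [v] is the variance, whereas [normal_prob] takes the standard deviation. *)
Definition is_normal (m v : R) (X : T -> R) : Prop :=
  measurable_fun setT X /\
  forall A : set R, measurable A ->
    P (X @^-1` A) = normal_prob m (Num.sqrt v) A.

Definition is_real_std_normal (X : T -> R[i]) : Prop :=
  (forall t, complex.Im (X t) = 0) /\
  is_normal 0 1 (fun t => complex.Re (X t)).

Definition is_complex_std_normal (X : T -> R[i]) : Prop :=
  [/\ is_normal 0 2^-1 (fun t => complex.Re (X t)),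
      is_normal 0 2^-1 (fun t => complex.Im (X t)) &
      independent2 (fun t => complex.Re (X t)) (fun t => complex.Im (X t))].

Variant entry_kind := real_entries | complex_entries.

Definition is_std_normal (k : entry_kind) (X : T -> R[i]) : Prop :=
  match k with
  | real_entries => is_real_std_normal X
  | complex_entries => is_complex_std_normal X
  end.

(* [R[i]] carries no measurable structure in the library; its Borel sigma-algebra
   is that of [R * R]. *)
Definition is_gaussian_matrix (k : entry_kind) (n p : nat)
    (G : T -> 'M[R[i]]_(n, p)) : Prop :=
  (forall i j, is_std_normal k (fun t => G t i j)) /\
  mutually_independent (fun (ij : 'I_n * 'I_p) (t : T) =>
    (complex.Re (G t ij.1 ij.2), complex.Im (G t ij.1 ij.2))).

(* Real Wishart matrices are viewed inside ['M[R[i]]_n]. *)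
Definition is_wishart (k : entry_kind) (n p : nat) (W : T -> 'M[R[i]]_n) : Prop :=
  exists2 G : T -> 'M[R[i]]_(n, p), is_gaussian_matrix k G &
    forall t, W t = p%:R^-1 *: (G t *m (G t)^t*).

End probability.

(* The row (resp. column) with index [k] inside block row (resp. column) [i] has
   global index [mxtens_index (i, k) = i * d + k]. *)
Definition partial_transpose (K : Type) (d : nat) (A : 'M[K]_(d ^ 2)) :
    'M[K]_(d ^ 2) :=
  \matrix_(a < d * d, b < d * d)
    let: (i, k) := mxtens_unindex a in
    let: (j, l) := mxtens_unindex b in
    A (mxtens_index (i, l)) (mxtens_index (j, k)).

Lemma partial_transposeE (K : Type) (d : nat) (A : 'M[K]_(d ^ 2))
    (i j k l : 'I_d) :
  partial_transpose A (mxtens_index (i, k)) (mxtens_index (j, l)) =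
  A (mxtens_index (i, l)) (mxtens_index (j, k)).
Proof. by rewrite mxE !mxtens_indexK. Qed.

(* For Hermitian [A] the entries of [spectral_diag A] are the eigenvalues of [A]
   with multiplicity, and they are real. *)
Definition empirical_spectral_measure (R : realType) (n : nat) (A : 'M[R[i]]_n)
    (I : set R) : R :=
  n%:R^-1 * \sum_(i < n) \1_I (complex.Re (spectral_diag A 0 i)).

(* [v] is the variance, i.e. the squared half radius of the support. *)
Definition semicircle_pdf (R : realType) (m v x : R) : R :=
  if x \in `[m - 2 * Num.sqrt v, m + 2 * Num.sqrt v]
  then (2 * pi * v)^-1 * Num.sqrt (4 * v - (x - m) ^+ 2)
  else 0.

Definition semicircle (R : realType) (m v : R) (I : set R) : \bar R :=
  (\int[lebesgue_measure]_(x in I) (semicircle_pdf m v x)%:E)%E.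

(* Main.v *)
(** Let [n = d ^ 2], [c = n / p], and let [H = Y - 1] be the average of the [p] centered
    partial transposes [Z_s] of the rank one matrices built from the columns of the
    Gaussian matrix. Up to a diagonal correction the entries of [Z_s] have the
    covariance of a GUE (GOE in the real case) matrix. Hence, with [m] the normalized
    trace of the resolvent of [H] at [z], comparing that resolvent with the one where
    [Z_s], which is independent of the rest, has been removed shows that the defect
    [D = 1 + z m + c m ^ 2] satisfies [E |D| ^ 2 = O (d ^ (-1/2))]; Frobenius norms
    suffice to control the remainders. By Chebyshev's inequality [D] is small at
    finitely many points [z = E + i eta] simultaneously.

    With [v = 1 / alpha], [w = 2 v m + z] solves [w ^ 2 = z ^ 2 - 4 v + 4 v D], so
    [Im w >= sqrt (4 v - E ^ 2)] as soon as [4 v |D| <= eta ^ 2]: the spectral measure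
    smoothed by the Poisson kernel dominates the semicircle density up to [O (eta)].
    Riemann sums over a grid turn this into [N(I) >= mu(I) - eps] for every interval
    [I], and applying it to both components of the complement of [I] gives the upper
    bound. The spectral counts are random variables because they are limits of traces
    of rational functions of [Y]. *)

From HB Require Import structures.
From mathcomp Require Import all_boot all_order all_algebra.
From mathcomp Require Import all_classical all_reals all_analysis.
From mathcomp Require Import measurable_realfun complex mxtens.
From mathcomp Require Import ring lra.
Require Import Defs.

Import Order.TTheory GRing.Theory Num.Theory.
Import numFieldNormedType.Exports.

Local Open Scope classical_set_scope.
Local Open Scope ring_scope.
Local Open Scope complex_scope.
Local Open Scope sesquilinear_scope.

Set Implicit Arguments.
Unset Strict Implicit.
Unset Printing Implicit Defensive.

Local Notation normc := Normc.normc.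

(** * Frobenius norms and resolvents *)

Section complex_modulus.
Variable R : realType.
Implicit Types x y : R[i].

(** The size of [Z_s] is the obstacle. Its Frobenius norm is of order [d ^ 2], so the third-order
    term of the resolvent expanded in powers of [Z_s / p] would be of order one if it were estimated
    by Frobenius norms of [Z_s] alone. What saves a factor [d ^ (1/2)] is the tensor structure: on
    vectors of length [d ^ 2] read as matrices [V], the partial transpose of a rank one matrix acts
    as [M V^T conj(M)], where [M] is the column reshaped into a [d] by [d] matrix. Hence its
    operator norm is at most the Frobenius norm of [M] times its adjoint, of order [d ^ (3/2)], and
    this fixes the rate. The second moment of [D] is estimated without separating mean and
    fluctuations of [m]: [D] is an average over the columns, so [|D| ^ 2] is the average of the
    summands weighted by the conjugate of [D]. Replacing this weight by its value without column [s]
    makes it independent of [Z_s], and the covariance of [Z_s] then turns the second-order term into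
    [- c m ^ 2] up to a small error, which is what [D] cancels. *)

Lemma Re_add x y : complex.Re (x + y) = complex.Re x + complex.Re y.
Proof. by case: x y => [? ?] [? ?]. Qed.

Lemma Im_add x y : complex.Im (x + y) = complex.Im x + complex.Im y.
Proof. by case: x y => [? ?] [? ?]. Qed.

Lemma Re_opp x : complex.Re (- x) = - complex.Re x.
Proof. by case: x. Qed.

Lemma Im_opp x : complex.Im (- x) = - complex.Im x.
Proof. by case: x. Qed.

Lemma Re_mul x y : complex.Re (x * y) =
  complex.Re x * complex.Re y - complex.Im x * complex.Im y.
Proof. by case: x y => [? ?] [? ?]. Qed.

Lemma Im_mul x y : complex.Im (x * y) =
  complex.Re x * complex.Im y + complex.Im x * complex.Re y.
Proof. by case: x y => [? ?] [? ?]. Qed.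

Lemma Re_conjc x : complex.Re (Num.conj x) = complex.Re x.
Proof. by case: x. Qed.

Lemma Im_conjc x : complex.Im (Num.conj x) = - complex.Im x.
Proof. by case: x. Qed.

Lemma Re_sum (I : Type) (r : seq I) (Q : pred I) (F : I -> R[i]) :
  complex.Re (\sum_(i <- r | Q i) F i) = \sum_(i <- r | Q i) complex.Re (F i).
Proof. by elim/big_rec2: _ => // i a b _ <-; rewrite Re_add. Qed.

Lemma Im_sum (I : Type) (r : seq I) (Q : pred I) (F : I -> R[i]) :
  complex.Im (\sum_(i <- r | Q i) F i) = \sum_(i <- r | Q i) complex.Im (F i).
Proof. by elim/big_rec2: _ => // i a b _ <-; rewrite Im_add. Qed.

Lemma complexP x y :
  complex.Re x = complex.Re y -> complex.Im x = complex.Im y -> x = y.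
Proof. by case: x y => [? ?] [? ?] /= -> ->. Qed.

Lemma sqr_normc x : normc x ^+ 2 = complex.Re x ^+ 2 + complex.Im x ^+ 2.
Proof. by case: x => a b /=; rewrite sqr_sqrtr // addr_ge0 ?sqr_ge0. Qed.

Lemma normc_ge0 x : 0 <= normc x.
Proof. by case: x => a b /=; rewrite sqrtr_ge0. Qed.

Lemma normc_conj x : normc (Num.conj x) = normc x.
Proof. by case: x => a b /=; rewrite sqrrN. Qed.

Lemma normc_real (a : R) : normc a%:C = `|a|.
Proof. by rewrite /= expr0n addr0 sqrtr_sqr. Qed.

Lemma normr_Re_le x : `|complex.Re x| <= normc x.
Proof.
by rewrite -[leLHS]sqrtr_sqr; case: x => a b /=; rewrite ler_wsqrtr // lerDl sqr_ge0.
Qed.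

Lemma normr_Im_le x : `|complex.Im x| <= normc x.
Proof.
by rewrite -[leLHS]sqrtr_sqr; case: x => a b /=; rewrite ler_wsqrtr // lerDr sqr_ge0.
Qed.

Lemma Re_le_normc x : complex.Re x <= normc x.
Proof. exact: le_trans (ler_norm _) (normr_Re_le _). Qed.

Lemma normcD_le x y : normc (x + y) <= normc x + normc y.
Proof. exact: le_normcD. Qed.

Lemma normcN x : normc (- x) = normc x.
Proof. exact: normcN. Qed.

Lemma normcM x y : normc (x * y) = normc x * normc y.
Proof. exact: Normc.normcM. Qed.

Lemma normc_sum_le (I : Type) (r : seq I) (Q : pred I) (F : I -> R[i]) :
  normc (\sum_(i <- r | Q i) F i) <= \sum_(i <- r | Q i) normc (F i).
Proof.
elim/big_rec2: _ => [|i a b _ ab]; first by rewrite Normc.normc0.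
by apply: le_trans (normcD_le _ _) _; rewrite lerD2l.
Qed.

Lemma mul_conjc x : x * Num.conj x = (normc x ^+ 2)%:C.
Proof.
apply: complexP; rewrite ?Re_mul ?Im_mul Re_conjc Im_conjc sqr_normc /=; ring.
Qed.

End complex_modulus.

Section frobenius.
Variable R : realType.

(** Lagrange's identity: twice the gap is a sum of squares of two by two minors. *)
Lemma cauchy_schwarz_sum (I : finType) (a b : I -> R) :
  (\sum_i a i * b i) ^+ 2 <= (\sum_i a i ^+ 2) * (\sum_i b i ^+ 2).
Proof.
rewrite -subr_ge0 -(pmulr_lge0 _ (ltr0Sn R 1)).
have -> : ((\sum_i a i ^+ 2) * (\sum_i b i ^+ 2) - (\sum_i a i * b i) ^+ 2) * 2
  = \sum_i \sum_j (a i * b j - a j * b i) ^+ 2.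
  rewrite [in LHS]expr2 !big_distrlr /= mulrBl !(mulr_natr _ 2) !mulr2n.
  rewrite [X in _ + X - _]exchange_big -!big_split -sumrB /=.
  apply: eq_bigr => i _; rewrite -!big_split -sumrB /=.
  by apply: eq_bigr => j _; ring.
by apply: sumr_ge0 => i _; apply: sumr_ge0 => j _; apply: sqr_ge0.
Qed.

Definition frob (m n : nat) (A : 'M[R[i]]_(m, n)) : R :=
  Num.sqrt (\sum_i \sum_j normc (A i j) ^+ 2).

Lemma frob_ge0 m n (A : 'M[R[i]]_(m, n)) : 0 <= frob A.
Proof. exact: sqrtr_ge0. Qed.

Lemma sqr_frob m n (A : 'M[R[i]]_(m, n)) :
  frob A ^+ 2 = \sum_i \sum_j normc (A i j) ^+ 2.
Proof.
by rewrite sqr_sqrtr //; do 2!(apply: sumr_ge0 => ? _); apply: sqr_ge0.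
Qed.

Lemma sqr_frob_pair m n (A : 'M[R[i]]_(m, n)) :
  frob A ^+ 2 = \sum_(ij : 'I_m * 'I_n) normc (A ij.1 ij.2) ^+ 2.
Proof. by rewrite sqr_frob pair_bigA. Qed.

Lemma ler_of_sqr (a b : R) : 0 <= b -> a ^+ 2 <= b ^+ 2 -> a <= b.
Proof.
move=> b0; have [a0|/ltW a0 _] := leP 0 a; last exact: le_trans b0.
by rewrite ler_sqr ?nnegrE.
Qed.

Lemma frob_eq0 m n (A : 'M[R[i]]_(m, n)) : frob A = 0 -> A = 0.
Proof.
move=> /(congr1 (fun x => x ^+ 2)); rewrite sqr_frob_pair expr0n /= => /eqP.
rewrite psumr_eq0 => [/allP H|ij _]; last exact: sqr_ge0.
apply/matrixP => i j; rewrite mxE; apply: Normc.eq0_normc.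
by have := H (i, j); rewrite mem_index_enum => /(_ isT) /=; rewrite sqrf_eq0 => /eqP.
Qed.

Lemma sum_normcM_le m n (A B : 'M[R[i]]_(m, n)) :
  \sum_i \sum_j normc (A i j) * normc (B i j) <= frob A * frob B.
Proof.
apply: ler_of_sqr; first by rewrite mulr_ge0 ?frob_ge0.
rewrite exprMn !sqr_frob_pair pair_bigA.
exact: (@cauchy_schwarz_sum _ (fun ij => normc (A ij.1 ij.2))
                              (fun ij => normc (B ij.1 ij.2))).
Qed.

Lemma frobD m n (A B : 'M[R[i]]_(m, n)) : frob (A + B) <= frob A + frob B.
Proof.
apply: ler_of_sqr; first by rewrite addr_ge0 ?frob_ge0.
pose a (ij : 'I_m * 'I_n) := normc (A ij.1 ij.2).
pose b (ij : 'I_m * 'I_n) := normc (B ij.1 ij.2).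
apply: (@le_trans _ _ (\sum_ij (a ij + b ij) ^+ 2)).
  rewrite sqr_frob_pair; apply: ler_sum => ij _.
  by rewrite mxE ler_sqr ?nnegrE ?addr_ge0 ?normc_ge0 ?normcD_le.
under eq_bigr => ij _ do rewrite sqrrD.
rewrite !big_split /= -mulr2n -!sqr_frob_pair sqrrD lerD2r lerD2l lerMn2r /=.
by rewrite -(pair_bigA _ (fun i j => a (i, j) * b (i, j))) sum_normcM_le.
Qed.

Lemma frob_trC m n (A : 'M[R[i]]_(m, n)) : frob (A ^t*) = frob A.
Proof.
rewrite /frob exchange_big; congr Num.sqrt.
by do 2!(apply: eq_bigr => ? _); rewrite !mxE normc_conj.
Qed.

Lemma frob_tr m n (A : 'M[R[i]]_(m, n)) : frob (A ^T) = frob A.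
Proof.
rewrite /frob exchange_big; congr Num.sqrt.
by do 2!(apply: eq_bigr => ? _); rewrite !mxE.
Qed.

Lemma frobZ m n (a : R[i]) (A : 'M[R[i]]_(m, n)) :
  frob (a *: A) = normc a * frob A.
Proof.
apply: (@pexpIrn _ 2); rewrite ?nnegrE ?mulr_ge0 ?normc_ge0 ?frob_ge0 //.
rewrite exprMn !sqr_frob mulr_sumr; apply: eq_bigr => i _.
by rewrite mulr_sumr; apply: eq_bigr => j _; rewrite mxE normcM exprMn.
Qed.

Lemma frob_scalar1 n : frob (1%:M : 'M[R[i]]_n) = Num.sqrt n%:R.
Proof.
congr Num.sqrt; rewrite (eq_bigr (fun=> 1)); last first.
  move=> i _; rewrite (bigD1 i) //= big1 => [|j ji]; rewrite mxE ?eqxx.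
    by rewrite Normc.normc1 expr1n addr0.
  by rewrite eq_sym (negPf ji) Normc.normc0 expr0n.
by rewrite sumr_const card_ord.
Qed.

Lemma normc_mxtraceM_le m n (A : 'M[R[i]]_(m, n)) (B : 'M[R[i]]_(n, m)) :
  normc (\tr (A *m B)) <= frob A * frob B.
Proof.
rewrite -(frob_tr B); apply: le_trans (sum_normcM_le _ _).
apply: le_trans (normc_sum_le _ _ _) _; apply: ler_sum => i _.
rewrite mxE; apply: le_trans (normc_sum_le _ _ _) _.
by apply: ler_sum => j _; rewrite normcM !mxE.
Qed.

Lemma frobM m n p (A : 'M[R[i]]_(m, n)) (B : 'M[R[i]]_(n, p)) :
  frob (A *m B) <= frob A * frob B.
Proof.
apply: ler_of_sqr; first by rewrite mulr_ge0 ?frob_ge0.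
rewrite exprMn (sqr_frob A) -(frob_tr B) (sqr_frob B^T) sqr_frob mulr_suml.
apply: ler_sum => i _; rewrite mulr_sumr; apply: ler_sum => k _.
under [X in _ <= _ * X]eq_bigr => j _ do rewrite mxE.
apply: le_trans (@cauchy_schwarz_sum _ (fun j => normc (A i j)) _).
rewrite ler_sqr ?nnegrE ?normc_ge0 ?sumr_ge0 // => [|j _].
  rewrite mxE; apply: le_trans (normc_sum_le _ _ _) _.
  by apply: ler_sum => j _; rewrite normcM.
by rewrite mulr_ge0 ?normc_ge0.
Qed.

Lemma mxtrace_trCM m n (A : 'M[R[i]]_(m, n)) :
  \tr (A ^t* *m A) = (frob A ^+ 2)%:C.
Proof.
rewrite sqr_frob exchange_big /= rmorph_sum /=; apply: eq_bigr => i _.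
rewrite mxE rmorph_sum /=; apply: eq_bigr => j _.
by rewrite !mxE mulrC mul_conjc.
Qed.

(* Bounds the operator norm of [A] by [frob (A^* A)], which is much smaller
   than [frob A ^+ 2] for a Gaussian matrix. *)
Lemma sqr_frobM_le m n p (A : 'M[R[i]]_(m, n)) (B : 'M[R[i]]_(n, p)) :
  frob (A *m B) ^+ 2 <= frob (A ^t* *m A) * frob B ^+ 2.
Proof.
rewrite -(ger0_norm (sqr_ge0 (frob (A *m B)))) -normc_real -mxtrace_trCM.
rewrite trmx_mul map_mxM -mulmxA mxtrace_mulC -!mulmxA mulmxA.
apply: le_trans (normc_mxtraceM_le _ _) _.
rewrite ler_wpM2l ?frob_ge0 // expr2 -{2}(frob_trC B); exact: frobM.
Qed.

End frobenius.

Section resolvent.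
Variables (R : realType) (n : nat).
Implicit Types (H B : 'M[R[i]]_n) (z : R[i]).

Definition resolvent H z : 'M[R[i]]_n := invmx (H - z%:M).

(** For Hermitian [H] the cross terms cancel: [(H - conj z) (H - z) = (H - Re z) ^ 2 + (Im z) ^ 2],
    tested on [B]. This single identity yields both the invertibility of [H - z] and the bound
    [1 / |Im z|] on its inverse, with no diagonalization. *)
Lemma frob_shift m (H : 'M[R[i]]_n) z (B : 'M[R[i]]_(n, m)) : H ^t* = H ->
  frob ((H - z%:M) *m B) ^+ 2 =
  frob ((H - (complex.Re z)%:C%:M) *m B) ^+ 2 + complex.Im z ^+ 2 * frob B ^+ 2.
Proof.
move=> hH; apply: (@complexI R); rewrite rmorphD (rmorphM _ (_ ^+ 2)) /= -!mxtrace_trCM.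
rewrite -mxtraceZ -mxtraceD; congr (\tr _).
rewrite !trmx_mul !map_mxM -!mulmxA scalemxAr -mulmxDr; congr (_ *m _).
rewrite !mulmxA -mul_scalar_mx -mulmxDl; congr (_ *m _).
have -> : (H - z%:M) ^t* = H - (Num.conj z)%:M.
  by rewrite linearB /= map_mxB hH tr_scalar_mx map_scalar_mx.
have -> : (H - (complex.Re z)%:C%:M) ^t* = H - (complex.Re z)%:C%:M.
  rewrite linearB /= map_mxB hH tr_scalar_mx map_scalar_mx; congr (_ - _%:M).
  by apply: complexP; rewrite ?Re_conjc ?Im_conjc //= oppr0.
rewrite !mulmxBl !mulmxBr !mul_scalar_mx !mul_mx_scalar !scale_scalar_mx.
apply/matrixP => i j; rewrite !mxE.
have conjE : Num.conj z = 2 * (complex.Re z)%:C - z.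
  apply: complexP; rewrite ?Re_conjc ?Im_conjc ?Re_add ?Im_add ?Re_opp ?Im_opp ?Re_mul ?Im_mul /=; ring.
have conjM : Num.conj z * z =
    (complex.Re z)%:C * (complex.Re z)%:C + (complex.Im z ^+ 2)%:C.
  rewrite mulrC mul_conjc sqr_normc rmorphD /= expr2.
  by apply: complexP; rewrite ?Re_add ?Im_add ?Re_mul ?Im_mul /=; ring.
rewrite conjM conjE; case: (i == j); rewrite ?mulr1n ?mulr0n; ring.
Qed.

Lemma hermitian_shift_unit H z : H ^t* = H -> complex.Im z != 0 ->
  H - z%:M \in unitmx.
Proof.
move=> hH z0; rewrite -row_full_unit -cokermx_eq0; apply/eqP/frob_eq0.
(* The columns of [B] span the kernel of [H - z]; the shift identity then forces
   [(Im z) ^ 2 * frob B ^ 2 = 0]. *)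
set B := cokermx _.
have := frob_shift z B hH; rewrite mulmx_coker.
have -> : frob (0 : 'M[R[i]]_n) = 0.
  by rewrite -[0](scale0r (1%:M)) frobZ Normc.normc0 mul0r.
rewrite expr0n /= => /esym/eqP; rewrite -exprMn paddr_eq0 ?sqr_ge0 // => /andP[_].
by rewrite sqrf_eq0 mulf_eq0 (negPf z0) => /eqP.
Qed.

Lemma frob_resolventMl m H z (B : 'M[R[i]]_(n, m)) :
  H ^t* = H -> complex.Im z != 0 ->
  frob (resolvent H z *m B) <= `|complex.Im z|^-1 * frob B.
Proof.
move=> hH z0; rewrite mulrC ler_pdivlMr ?normr_gt0 //.
apply: ler_of_sqr (frob_ge0 _) _.
rewrite -{2}(mulKVmx (hermitian_shift_unit hH z0) B) frob_shift //.
by rewrite exprMn real_normK ?num_real // mulrC lerDr sqr_ge0.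
Qed.

Lemma resolvent_trC H z : H ^t* = H -> (resolvent H z) ^t* = resolvent H (Num.conj z).
Proof.
by move=> hH; rewrite /resolvent trmx_inv map_invmx linearB /= map_mxB hH
  tr_scalar_mx map_scalar_mx.
Qed.

Lemma frob_resolventMr m H z (B : 'M[R[i]]_(m, n)) :
  H ^t* = H -> complex.Im z != 0 ->
  frob (B *m resolvent H z) <= `|complex.Im z|^-1 * frob B.
Proof.
move=> hH z0; rewrite -frob_trC -(frob_trC B) trmx_mul map_mxM resolvent_trC //.
by apply: le_trans (frob_resolventMl _ hH _) _; rewrite Im_conjc ?oppr_eq0 // normrN.
Qed.

Lemma frob_resolvent H z : H ^t* = H -> complex.Im z != 0 ->
  frob (resolvent H z) <= `|complex.Im z|^-1 * Num.sqrt n%:R.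
Proof.
by move=> hH z0; rewrite -[resolvent H z]mulmx1 -frob_scalar1 frob_resolventMl.
Qed.

Lemma resolvent_sub H1 H2 z : H1 ^t* = H1 -> H2 ^t* = H2 -> complex.Im z != 0 ->
  resolvent H1 z = resolvent H2 z - resolvent H2 z *m (H1 - H2) *m resolvent H1 z.
Proof.
move=> h1 h2 z0.
have -> : H1 - H2 = (H1 - z%:M) - (H2 - z%:M) by rewrite opprB addrA addrNK.
rewrite mulmxBr mulmxBl mulVmx ?hermitian_shift_unit // mul1mx.
by rewrite -mulmxA mulmxV ?hermitian_shift_unit // mulmx1 opprB addrC subrK.
Qed.

Lemma mulmx_resolvent H z : H ^t* = H -> complex.Im z != 0 ->
  H *m resolvent H z = 1%:M + z *: resolvent H z.
Proof.
move=> hH z0; rewrite -mul_scalar_mx -[1%:M](mulmxV (hermitian_shift_unit hH z0)).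
by rewrite -mulmxDl subrK.
Qed.

Lemma normc_mxtrace_resolvent H z : H ^t* = H -> complex.Im z != 0 ->
  normc (\tr (resolvent H z)) <= `|complex.Im z|^-1 * n%:R.
Proof.
move=> hH z0; rewrite -[resolvent H z]mulmx1.
apply: le_trans (normc_mxtraceM_le _ _) _; rewrite frob_scalar1.
rewrite -[X in _ <= _ * X]sqr_sqrtr ?ler0n // expr2 mulrA.
by rewrite ler_wpM2r ?sqrtr_ge0 ?frob_resolvent.
Qed.

End resolvent.

(** * Independence and expectation of complex random variables *)

Section independence.
Context (disp : measure_display) (T : measurableType disp) (R : realType)
  (P : probability T R).
Local Open Scope ereal_scope.

(** Uniqueness of measures: restricting [P] to [C] and scaling [P] by [P C] give two finite measures
    that agree on a generating pi-system. *)
Lemma independent_g_sigma (G : set (set T)) (C : set T) :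
  setI_closed G -> G setT -> G `<=` measurable -> measurable C ->
  (forall B, G B -> P (B `&` C) = P B * P C) ->
  forall B, <<s G >> B -> P (B `&` C) = P B * P C.
Proof.
move=> GI GT Gm mC GC B GB.
have PC : P C = (fine (P C))%:E by rewrite fineK // fin_num_measure.
have r0 : (0 <= fine (P C))%R by rewrite fine_ge0.
have := @g_sigma_algebra_measure_unique _ R T G Gm (fun=> setT) (fun=> GT) _
  (mrestr P mC) (mscale (NngNum r0) P) GI _ _ _ GB.
rewrite /= /mrestr /mscale /= => ->; first by rewrite muleC -PC.
- by apply/seteqP; split => // t _; exists 0%N.
- by move=> A GA; rewrite GC // muleC -PC.
- by move=> _; rewrite setTI PC ltry.
Qed.

Lemma expectation_mul_indep (X Y : T -> R) :
  measurable_fun setT X -> measurable_fun setT Y ->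
  (forall A B : set R, measurable A -> measurable B ->
    P (X @^-1` A `&` Y @^-1` B) = P (X @^-1` A) * P (Y @^-1` B)) ->
  P.-integrable setT (EFin \o X) -> P.-integrable setT (EFin \o Y) ->
  P.-integrable setT (EFin \o (fun t => X t * Y t)%R) /\
  (\int[P]_t (X t * Y t) = (\int[P]_t X t) * (\int[P]_t Y t))%R.
Proof.
move=> mX mY indep iX iY.
pose X' : {mfun T >-> R} := HB.pack X (isMeasurableFun.Build _ _ _ _ _ mX).
pose Y' : {mfun T >-> R} := HB.pack Y (isMeasurableFun.Build _ _ _ _ _ mY).
have mZ : measurable_fun setT (fun t => (X t, Y t)).
  by apply/measurable_fun_pairP; split.
pose Z' : {mfun T >-> (R * R)%type} :=
  HB.pack (fun t => (X t, Y t)) (isMeasurableFun.Build _ _ _ _ _ mZ).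
pose m1 : probability R R := distribution P X'.
pose m2 : probability R R := distribution P Y'.
(* Independence is a statement about rectangles, which determine the product measure; hence the
   joint law is the product of the laws and Fubini applies. *)
have lawZ (A : set (R * R)%type) : measurable A -> (m1 \x m2) A = distribution P Z' A.
  by apply: product_measure_unique => A' B' mA' mB'; rewrite -indep.
pose f (z : (R * R)%type) : \bar R := (z.1 * z.2)%:E.
have mf : measurable_fun setT f.
  by apply/measurable_EFinP/measurable_funM.
have intX : m1.-integrable setT (EFin \o id).
  by apply: (integrable_pushforward mX) => //; apply/measurable_EFinP.
have intY : m2.-integrable setT (EFin \o id).
  by apply: (integrable_pushforward mY) => //; apply/measurable_EFinP.
have if12 : (m1 \x m2).-integrable setT f.
  apply/(integrable12ltyP _ _ mf).
  under eq_integral => x _.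
    under eq_integral => y _ do rewrite /f /= normrM EFinM.
    rewrite ge0_integralZl //; last first.
      by apply: measurableT_comp => //; apply: measurableT_comp.
    over.
  have [_ Xfin] := integrableP _ _ _ intX.
  have [_ Yfin] := integrableP _ _ _ intY.
  rewrite /= ge0_integralZr //; last first.
  - exact: integral_ge0.
  - by apply: measurableT_comp => //; apply: measurableT_comp.
  by apply: lte_mul_pinfty => //; [exact: integral_ge0|rewrite ge0_fin_numE //; exact: integral_ge0].
have ifZ : P.-integrable setT (EFin \o (fun t => X t * Y t)%R).
  apply/integrableP; split; first by apply/measurable_EFinP/measurable_funM.
  have [_] := integrableP _ _ _ if12.
  rewrite (eq_measure_integral (distribution P Z')) => [|A mA _]; last exact: lawZ.
  rewrite ge0_integral_distribution //.
  by apply: measurableT_comp.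
split=> //.
rewrite /Rintegral.
have -> : \int[P]_x (X x * Y x)%:E = \int[m1 \x m2]_z f z.
  rewrite (eq_measure_integral (distribution P Z')) => [|A mA _]; last exact: lawZ.
  by rewrite integral_distribution.
rewrite -integral12_prod_meas1 //.
have EY : \int[P]_x (Y x)%:E = \int[m2]_y y%:E.
  by rewrite integral_distribution //; apply/measurable_EFinP.
have EX : \int[P]_x (X x)%:E = \int[m1]_y y%:E.
  by rewrite integral_distribution //; apply/measurable_EFinP.
rewrite EX EY -fineM; last 2 first.
- exact: integrable_fin_num intX.
- exact: integrable_fin_num intY.
congr fine.
have fY : \int[m2]_y y%:E \is a fin_num by exact: integrable_fin_num intY.
rewrite -[X in _ = _ * X](fineK fY) -integralZr //; apply: eq_integral => x _.
rewrite fineK //.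
rewrite /fubini_F /f /=.
under eq_integral do rewrite EFinM.
by rewrite integralZl.
Qed.

End independence.

Section cylinders.
Context (disp : measure_display) (T : measurableType disp) (R : realType)
  (P : probability T R).
Context (disp' : measure_display) (T' : measurableType disp') (I : finType)
  (X : I -> T -> T').

Definition cylinders (J : {set I}) : set (set T) :=
  [set B | exists2 A : I -> set T', (forall i, measurable (A i)) &
     B = \bigcap_(i in [set` J]) (X i @^-1` A i)].

(** A copy of [T] with the sigma-algebra generated by the [X i], [i \in J]. That a function depends
    on these variables only is then its measurability as a function on [sub_sigma J]. *)
Definition sub_sigma (J : {set I}) : measurableType _ :=
  g_sigma_algebraType (cylinders J).

Lemma cylinders_setI (J : {set I}) : setI_closed (cylinders J).
Proof.
move=> _ _ [A mA ->] [B mB ->]; exists (fun i => A i `&` B i).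
  by move=> i; apply: measurableI.
by rewrite -bigcapI; apply: eq_bigcapr => i _; rewrite preimage_setI.
Qed.

Lemma cylinders_setT (J : {set I}) : cylinders J setT.
Proof.
exists (fun=> setT) => //.
by apply/esym/seteqP; split => // t _ i _.
Qed.

Lemma measurable_sub_sigma (J : {set I}) i : i \in J ->
  measurable_fun setT (X i : sub_sigma J -> T').
Proof.
move=> iJ _ A mA; rewrite setTI; apply: sub_sigma_algebra.
exists (fun j => if j == i then A else setT).
  by move=> j; case: ifP.
apply/seteqP; split => t /=.
  by move=> At j _ /=; case: eqP => [->|].
by move=> /(_ i iJ) /=; rewrite eqxx.
Qed.

Hypothesis mX : forall i, measurable_fun setT (X i).

Lemma cylinders_measurable (J : {set I}) : cylinders J `<=` measurable.
Proof.
move=> _ [A mA ->]; apply: fin_bigcap_measurable => [|i _].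
  exact: finite_finset.
by rewrite -[_ @^-1` _]setTI; apply: mX.
Qed.

Lemma sub_sigma_sub (J : {set I}) (A : set T) :
  measurable (A : set (sub_sigma J)) -> measurable A.
Proof.
by move=> mA; apply: (smallest_sub (@sigma_algebra_measurable _ T)
  (@cylinders_measurable J)).
Qed.

Lemma measurable_sub_sigma_fun d2 (U : measurableType d2) (J : {set I})
  (f : T -> U) : measurable_fun setT (f : sub_sigma J -> U) -> measurable_fun setT f.
Proof. by move=> mf _ A mA; apply: (@sub_sigma_sub J); apply: mf. Qed.

Hypothesis indepX : mutually_independent P X.

(** The extension from cylinders to the generated sigma-algebra is done twice: on the side of [J]
    against the fixed event [B], then on the side of [K] against a fixed cylinder over [J]. *)
Lemma sub_sigma_independent (J K : {set I}) (A B : set T) : (forall i, i \in J -> i \notin K) ->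
  measurable (A : set (sub_sigma J)) -> measurable (B : set (sub_sigma K)) ->
  P (A `&` B) = (P A * P B)%E.
Proof.
move=> JK mA mB; apply: (independent_g_sigma (@cylinders_setI J)
  (cylinders_setT J) (@cylinders_measurable J) (sub_sigma_sub mB)) mA => C HC.
rewrite setIC muleC.
apply: (independent_g_sigma (@cylinders_setI K)
  (cylinders_setT K) (@cylinders_measurable K) (cylinders_measurable HC)) mB.
move=> D [V mV ->]; rewrite muleC setIC; case: HC => U mU ->.
(* Since [J] and [K] are disjoint, both cylinders come from one family of sets, and mutual
   independence is applied over [J], over [K] and over their union. *)
pose W i := if i \in J then U i else V i.
have mW i : measurable (W i) by rewrite /W; case: ifP.
have UE : \bigcap_(i in [set` J]) X i @^-1` U i =
          \bigcap_(i in [set` J]) X i @^-1` W i.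
  by apply: eq_bigcapr => i /= iJ; rewrite /W iJ.
have VE : \bigcap_(i in [set` K]) X i @^-1` V i =
          \bigcap_(i in [set` K]) X i @^-1` W i.
  apply: eq_bigcapr => i /= iK; rewrite /W; case: ifP => // iJ.
  by have := JK _ iJ; rewrite iK.
rewrite UE VE -bigcap_setU.
have -> : [set` J] `|` [set` K] = [set` J :|: K].
  by apply/seteqP; split => i /=; rewrite inE => /orP.
rewrite !indepX // (eq_bigl [in [predU J & K]]); last by move=> i; rewrite !inE.
rewrite bigU //; apply/pred0P => i /=.
by apply/negP => /andP[/JK/negPf->].
Qed.

Lemma expectation_mul_sub_sigma (J K : {set I}) (f g : T -> R) : (forall i, i \in J -> i \notin K) ->
  measurable_fun setT (f : sub_sigma J -> R) ->
  measurable_fun setT (g : sub_sigma K -> R) ->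
  P.-integrable setT (EFin \o f) -> P.-integrable setT (EFin \o g) ->
  P.-integrable setT (EFin \o (fun t => f t * g t)) /\
  \int[P]_t (f t * g t) = (\int[P]_t f t) * (\int[P]_t g t).
Proof.
move=> JK mf mg; apply: expectation_mul_indep.
- exact: measurable_sub_sigma_fun mf.
- exact: measurable_sub_sigma_fun mg.
- move=> A B mA mB; apply: sub_sigma_independent JK _ _.
    by have := mf measurableT A mA; rewrite setTI.
  by have := mg measurableT B mB; rewrite setTI.
Qed.

End cylinders.

(** * Measurability of complex-valued functions and random matrices *)

Section complex_measurable.
Context (R : realType).

Definition cmeasurable (d : measure_display) (D : measurableType d)
    (f : D -> R[i]) : Prop :=
  measurable_fun setT (fun t => complex.Re (f t)) /\
  measurable_fun setT (fun t => complex.Im (f t)).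

Context (d : measure_display) (D : measurableType d).
Implicit Types f g : D -> R[i].

Lemma cmeasurable_cst (c : R[i]) : cmeasurable (fun _ : D => c).
Proof. by split; apply: measurable_cst. Qed.

Lemma cmeasurableD f g : cmeasurable f -> cmeasurable g ->
  cmeasurable (fun t => f t + g t).
Proof.
move=> [rf jf] [rg jg]; split.
  by under eq_fun do rewrite Re_add; apply: measurable_funD.
by under eq_fun do rewrite Im_add; apply: measurable_funD.
Qed.

Lemma cmeasurableM f g : cmeasurable f -> cmeasurable g ->
  cmeasurable (fun t => f t * g t).
Proof.
move=> [rf jf] [rg jg]; split.
  by under eq_fun do rewrite Re_mul; apply: measurable_funB; apply: measurable_funM.
by under eq_fun do rewrite Im_mul; apply: measurable_funD; apply: measurable_funM.
Qed.

Lemma cmeasurable_conj f : cmeasurable f -> cmeasurable (fun t => Num.conj (f t)).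
Proof.
move=> [rf jf]; split; first by under eq_fun do rewrite Re_conjc.
by under eq_fun do rewrite Im_conjc; apply: measurableT_comp.
Qed.

(* The factor [expR (- 2 ln g)] is finite at [g = 0], so the product is the junk
   value [0^-1 = 0] there. *)
Lemma measurable_inv_ge0 (g : D -> R) : (forall t, 0 <= g t) ->
  measurable_fun setT g -> measurable_fun setT (fun t => (g t)^-1).
Proof.
move=> g0 mg; rewrite (_ : (fun t => _) = (fun t => g t * expR (- (2 * ln (g t))))).
  apply: measurable_funM => //; apply: measurableT_comp => //.
  apply: measurableT_comp => //; apply: measurable_funM => //.
  exact: measurableT_comp.
apply/funext => t; have [->|gt0] := eqVneq (g t) 0; first by rewrite invr0 mul0r.
have gpos : 0 < g t by rewrite lt_neqAle eq_sym gt0 g0.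
by rewrite expRN expRM_natl lnK ?posrE //; field.
Qed.

Lemma cmeasurable_inv f : cmeasurable f -> cmeasurable (fun t => (f t)^-1).
Proof.
move=> [rf jf].
have mn : measurable_fun setT
    (fun t => (complex.Re (f t) ^+ 2 + complex.Im (f t) ^+ 2)^-1).
  apply: measurable_inv_ge0 => [t|]; first by rewrite addr_ge0 ?sqr_ge0.
  by apply: measurable_funD; apply: measurable_funX.
split.
  rewrite (_ : (fun t => _) = (fun t => complex.Re (f t) *
    (complex.Re (f t) ^+ 2 + complex.Im (f t) ^+ 2)^-1)).
    exact: measurable_funM.
  by apply/funext => t; case: (f t).
rewrite (_ : (fun t => _) = (fun t => - (complex.Im (f t) *
    (complex.Re (f t) ^+ 2 + complex.Im (f t) ^+ 2)^-1))).
  by apply: measurableT_comp => //; apply: measurable_funM.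
by apply/funext => t; case: (f t).
Qed.

Lemma cmeasurable_sum (I : Type) (r : seq I) (Q : pred I) (F : I -> D -> R[i]) :
  (forall i, cmeasurable (F i)) -> cmeasurable (fun t => \sum_(i <- r | Q i) F i t).
Proof.
move=> mF; elim: r => [|i r IH].
  by under eq_fun do rewrite big_nil; apply: cmeasurable_cst.
under eq_fun do rewrite big_cons; case: (Q i) => //.
exact: cmeasurableD.
Qed.

Lemma cmeasurable_prod (I : Type) (r : seq I) (Q : pred I) (F : I -> D -> R[i]) :
  (forall i, cmeasurable (F i)) -> cmeasurable (fun t => \prod_(i <- r | Q i) F i t).
Proof.
move=> mF; elim: r => [|i r IH].
  by under eq_fun do rewrite big_nil; apply: cmeasurable_cst.
under eq_fun do rewrite big_cons; case: (Q i) => //.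
exact: cmeasurableM.
Qed.

Lemma measurable_normc f : cmeasurable f -> measurable_fun setT (fun t => normc (f t)).
Proof.
move=> [rf jf]; rewrite (_ : (fun t => _) = (fun t =>
    Num.sqrt (complex.Re (f t) ^+ 2 + complex.Im (f t) ^+ 2))).
  apply: measurableT_comp.
    by apply: continuous_measurable_fun; exact: sqrt_continuous.
  by apply: measurable_funD; apply: measurable_funX.
by apply/funext => t; case: (f t).
Qed.

Definition mxmeasurable (m n : nat) (A : D -> 'M[R[i]]_(m, n)) : Prop :=
  forall i j, cmeasurable (fun t => A t i j).

Lemma mxmeasurable_cst m n (A : 'M[R[i]]_(m, n)) : mxmeasurable (fun=> A).
Proof. by move=> i j; apply: cmeasurable_cst. Qed.

Lemma mxmeasurableD m n (A B : D -> 'M[R[i]]_(m, n)) :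
  mxmeasurable A -> mxmeasurable B -> mxmeasurable (fun t => A t + B t).
Proof.
by move=> mA mB i j; under eq_fun do rewrite mxE; apply: cmeasurableD.
Qed.

Lemma mxmeasurableZ m n (c : R[i]) (A : D -> 'M[R[i]]_(m, n)) :
  mxmeasurable A -> mxmeasurable (fun t => c *: A t).
Proof.
move=> mA i j; under eq_fun do rewrite mxE; apply: cmeasurableM => //.
Qed.

Lemma mxmeasurable_sum m n (I : Type) (r : seq I) (Q : pred I)
  (F : I -> D -> 'M[R[i]]_(m, n)) :
  (forall i, mxmeasurable (F i)) -> mxmeasurable (fun t => \sum_(i <- r | Q i) F i t).
Proof.
move=> mF i j; under eq_fun do rewrite summxE.
by apply: cmeasurable_sum => k; apply: mF.
Qed.

Lemma mxmeasurableM m n p (A : D -> 'M[R[i]]_(m, n)) (B : D -> 'M[R[i]]_(n, p)) :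
  mxmeasurable A -> mxmeasurable B -> mxmeasurable (fun t => A t *m B t).
Proof.
move=> mA mB i j; under eq_fun do rewrite mxE.
by apply: cmeasurable_sum => k; apply: cmeasurableM.
Qed.

Lemma cmeasurable_mxtrace n (A : D -> 'M[R[i]]_n) :
  mxmeasurable A -> cmeasurable (fun t => \tr (A t)).
Proof. by move=> mA; apply: cmeasurable_sum => i; apply: mA. Qed.

Lemma cmeasurable_det n (A : D -> 'M[R[i]]_n) :
  mxmeasurable A -> cmeasurable (fun t => \det (A t)).
Proof.
move=> mA; apply: cmeasurable_sum => s; apply: cmeasurableM.
  exact: cmeasurable_cst.
by apply: cmeasurable_prod => i; apply: mA.
Qed.

(** Cramer's formula makes every entry of the inverse a quotient of determinants. *)
Lemma mxmeasurable_inv n (A : D -> 'M[R[i]]_n) : (forall t, A t \in unitmx) ->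
  mxmeasurable A -> mxmeasurable (fun t => invmx (A t)).
Proof.
move=> uA mA i j.
under eq_fun do rewrite /invmx uA !mxE.
apply: cmeasurableM; first exact/cmeasurable_inv/cmeasurable_det.
apply: cmeasurableM; first exact: cmeasurable_cst.
apply: cmeasurable_det => k l.
under eq_fun do rewrite !mxE.
exact: mA.
Qed.

End complex_measurable.

(** * Expectation of complex random variables *)

Section complex_expectation.
Context (disp : measure_display) (T : measurableType disp) (R : realType)
  (P : probability T R).

Definition rintegrable (X : T -> R) : Prop := P.-integrable setT (EFin \o X).

Implicit Types (X Y : T -> R) (F G : T -> R[i]).

Lemma rintegrable_cst (c : R) : rintegrable (fun=> c).
Proof. exact: finite_measure_integrable_cst. Qed.

Lemma rintegrableD X Y : rintegrable X -> rintegrable Y ->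
  rintegrable (fun t => X t + Y t).
Proof. by move=> iX iY; apply: (integrableD measurableT iX iY). Qed.

Lemma rintegrableZ (c : R) X : rintegrable X -> rintegrable (fun t => c * X t).
Proof. by move=> iX; apply: (integrableZl measurableT _ iX). Qed.

Lemma rintegrable_sum (I : Type) (r : seq I) (Q : pred I) (F : I -> T -> R) :
  (forall i, rintegrable (F i)) -> rintegrable (fun t => \sum_(i <- r | Q i) F i t).
Proof.
move=> mF; elim: r => [|i r IH].
  by under eq_fun do rewrite big_nil; apply: rintegrable_cst.
under eq_fun do rewrite big_cons; case: (Q i) => //.
exact: rintegrableD.
Qed.

Lemma rintegrable_le X Y : measurable_fun setT X -> rintegrable Y ->
  (forall t, `|X t| <= Y t) -> rintegrable X.
Proof.
move=> mX iY XY; apply: le_integrable iY => //; first exact/measurable_EFinP.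
move=> t _ /=; rewrite lee_fin; apply: le_trans (XY t) _; exact: ler_norm.
Qed.

Lemma Rintegral_sum (I : Type) (r : seq I) (Q : pred I) (F : I -> T -> R) :
  (forall i, rintegrable (F i)) ->
  \int[P]_t (\sum_(i <- r | Q i) F i t) = \sum_(i <- r | Q i) \int[P]_t F i t.
Proof.
move=> mF; elim: r => [|i r IH].
  under eq_Rintegral do rewrite big_nil.
  by rewrite big_nil Rintegral_cst // mul0r.
under eq_Rintegral do rewrite big_cons; rewrite big_cons -IH; case: (Q i) => //.
by rewrite RintegralD //; [exact: mF|exact: rintegrable_sum].
Qed.

Lemma Rintegral_prob_cst (c : R) : \int[P]_t c = c.
Proof.
rewrite Rintegral_cst // -[RHS]mulr1; congr (_ * _).
by rewrite (_ : _ [set: _] = 1%E) //; exact: (probability_setT P).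
Qed.

Definition cintegrable F : Prop :=
  rintegrable (fun t => complex.Re (F t)) /\ rintegrable (fun t => complex.Im (F t)).

Definition cexpectation F : R[i] :=
  (\int[P]_t complex.Re (F t)) +i* (\int[P]_t complex.Im (F t)).

Lemma cintegrable_le F Y : cmeasurable F -> rintegrable Y ->
  (forall t, normc (F t) <= Y t) -> cintegrable F.
Proof.
move=> [mr mi] iY FY; split; apply: rintegrable_le iY _ => // t.
  exact: le_trans (normr_Re_le _) (FY t).
exact: le_trans (normr_Im_le _) (FY t).
Qed.

Lemma cintegrable_cst c : cintegrable (fun=> c).
Proof. by split; apply: rintegrable_cst. Qed.

Lemma cexpectation_cst c : cexpectation (fun=> c) = c.
Proof. by case: c => a b; rewrite /cexpectation /= !Rintegral_prob_cst. Qed.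

Lemma eq_cexpectation F G : F =1 G -> cexpectation F = cexpectation G.
Proof. by move=> /funext ->. Qed.

Lemma cintegrable_sum (I : Type) (r : seq I) (Q : pred I) (F : I -> T -> R[i]) :
  (forall i, cintegrable (F i)) -> cintegrable (fun t => \sum_(i <- r | Q i) F i t).
Proof.
move=> iF; split; [under eq_fun do rewrite Re_sum|under eq_fun do rewrite Im_sum];
  by apply: rintegrable_sum => i; have [] := iF i.
Qed.

Lemma cexpectation_sum (I : Type) (r : seq I) (Q : pred I) (F : I -> T -> R[i]) :
  (forall i, cintegrable (F i)) ->
  cexpectation (fun t => \sum_(i <- r | Q i) F i t) =
  \sum_(i <- r | Q i) cexpectation (F i).
Proof.
move=> iF; apply: complexP.
  rewrite Re_sum /cexpectation /=; under eq_Rintegral do rewrite Re_sum.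
  by rewrite Rintegral_sum // => i; have [] := iF i.
rewrite Im_sum /cexpectation /=; under eq_Rintegral do rewrite Im_sum.
by rewrite Rintegral_sum // => i; have [] := iF i.
Qed.

Lemma cexpectationD F G : cintegrable F -> cintegrable G ->
  cexpectation (fun t => F t + G t) = cexpectation F + cexpectation G.
Proof.
move=> [rF jF] [rG jG]; apply: complexP; rewrite ?Re_add ?Im_add /cexpectation /=.
  by under eq_Rintegral do rewrite Re_add; rewrite RintegralD.
by under eq_Rintegral do rewrite Im_add; rewrite RintegralD.
Qed.

Lemma cintegrableD F G : cintegrable F -> cintegrable G ->
  cintegrable (fun t => F t + G t).
Proof.
move=> [rF jF] [rG jG]; split.
  by under eq_fun do rewrite Re_add; apply: rintegrableD.
by under eq_fun do rewrite Im_add; apply: rintegrableD.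
Qed.

Lemma cintegrableN F : cintegrable F -> cintegrable (fun t => - F t).
Proof.
move=> [rF jF]; split.
  by under eq_fun do rewrite Re_opp -mulN1r; apply: rintegrableZ.
by under eq_fun do rewrite Im_opp -mulN1r; apply: rintegrableZ.
Qed.

Lemma cexpectationN F : cintegrable F ->
  cexpectation (fun t => - F t) = - cexpectation F.
Proof.
move=> [rF jF]; apply: complexP; rewrite ?Re_opp ?Im_opp /cexpectation /=.
  under eq_Rintegral do rewrite Re_opp -mulN1r.
  by rewrite RintegralZl // mulN1r.
under eq_Rintegral do rewrite Im_opp -mulN1r.
by rewrite RintegralZl // mulN1r.
Qed.

Lemma cexpectation_conj F : cintegrable F ->
  cexpectation (fun t => Num.conj (F t)) = Num.conj (cexpectation F).
Proof.
move=> [rF jF]; apply: complexP; rewrite ?Re_conjc ?Im_conjc /cexpectation /=.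
  by under eq_Rintegral do rewrite Re_conjc.
under eq_Rintegral do rewrite Im_conjc -mulN1r.
by rewrite RintegralZl // mulN1r.
Qed.

Lemma Re_cexpectation_le F Y : cintegrable F -> rintegrable Y ->
  (forall t, complex.Re (F t) <= Y t) ->
  complex.Re (cexpectation F) <= \int[P]_t Y t.
Proof. by move=> [rF _] iY FY; apply: le_Rintegral. Qed.

Context (disp' : measure_display) (T' : measurableType disp') (I : finType)
  (X : I -> T -> T').
Hypotheses (mX : forall i, measurable_fun setT (X i))
  (indepX : mutually_independent P X).

Lemma cexpectation_mul (J K : {set I}) F G : (forall i, i \in J -> i \notin K) ->
  cmeasurable (F : sub_sigma X J -> R[i]) -> cmeasurable (G : sub_sigma X K -> R[i]) ->
  cintegrable F -> cintegrable G ->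
  cintegrable (fun t => F t * G t) /\
  cexpectation (fun t => F t * G t) = cexpectation F * cexpectation G.
Proof.
move=> JK [mF1 mF2] [mG1 mG2] [iF1 iF2] [iG1 iG2].
have [i11 e11] := expectation_mul_sub_sigma mX indepX JK mF1 mG1 iF1 iG1.
have [i12 e12] := expectation_mul_sub_sigma mX indepX JK mF1 mG2 iF1 iG2.
have [i21 e21] := expectation_mul_sub_sigma mX indepX JK mF2 mG1 iF2 iG1.
have [i22 e22] := expectation_mul_sub_sigma mX indepX JK mF2 mG2 iF2 iG2.
have ReE t : complex.Re (F t * G t) = complex.Re (F t) * complex.Re (G t)
   + -1 * (complex.Im (F t) * complex.Im (G t)) by rewrite Re_mul mulN1r.
have ImE t : complex.Im (F t * G t) = complex.Re (F t) * complex.Im (G t)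
   + complex.Im (F t) * complex.Re (G t) by rewrite Im_mul.
split.
  split; first by under eq_fun do rewrite ReE; apply/rintegrableD/rintegrableZ.
  by under eq_fun do rewrite ImE; apply/rintegrableD.
apply: complexP; rewrite ?Re_mul ?Im_mul /cexpectation /=.
  under eq_Rintegral do rewrite ReE.
  rewrite RintegralD //; last exact: rintegrableZ.
  by rewrite RintegralZl // e11 e22 mulN1r.
under eq_Rintegral do rewrite ImE.
by rewrite RintegralD // e12 e21.
Qed.

Lemma cmeasurable_sub_sigma (J : {set I}) F :
  cmeasurable (F : sub_sigma X J -> R[i]) -> cmeasurable F.
Proof.
by move=> [m1 m2]; split; apply: (measurable_sub_sigma_fun mX (J := J)).
Qed.

End complex_expectation.

(** * Gaussian moments *)

Section gaussian_moments.
Context (R : realType).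
Notation mu := (@lebesgue_measure R).

Lemma integral_normal_prob (m s : R) (f : R -> \bar R) :
  measurable_fun setT f -> (\int[normal_prob m s]_x `|f x| < +oo)%E ->
  (\int[normal_prob m s]_x f x = \int[mu]_x (f x * (normal_pdf m s x)%:E))%E.
Proof.
move=> mf finf.
rewrite -(Radon_Nikodym_change_of_variables (normal_prob_dominates m s)) //=; last first.
  by apply/integrableP; split.
apply: ae_eq_integral => //.
- apply: emeasurable_funM => //; apply: (measurable_int mu).
  by apply: Radon_Nikodym_integrable; exact: normal_prob_dominates.
- apply: emeasurable_funM => //=; apply/measurableT_comp => //=.
  exact: measurable_normal_pdf.
- apply: ae_eqe_mul2l => /=.
  rewrite Radon_NikodymE//=; first exact: normal_prob_dominates.
  move=> dom; case: cid => /= h [h1 h2 h3].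
  apply: integral_ae_eq => //=.
  + by apply/measurableT_comp => //; exact: measurable_normal_pdf.
  + by move=> E _ mE; rewrite -h3.
Qed.

(** The density formula for integrable functions applies to the truncations [min f n]; monotone
    convergence on both sides removes the truncation, so finiteness of the integral can later be
    read off from the density. *)
Lemma ge0_integral_normal_prob (m s : R) (f : R -> R) :
  measurable_fun setT f -> (forall x, 0 <= f x) ->
  (\int[normal_prob m s]_x (f x)%:E =
   \int[mu]_x (f x * normal_pdf m s x)%:E)%E.
Proof.
move=> mf f0; pose g n x := (Num.min (f x) n%:R)%:E : \bar R.
have mg n : measurable_fun setT (g n).
  by apply/measurable_EFinP; apply: measurable_minr.
have g0 n x : (0 <= g n x)%E by rewrite lee_fin le_min f0 ler0n.
have ndg x : nondecreasing_seq (g ^~ x).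
  by move=> a b ab; rewrite lee_fin le_min2 // ler_nat.
have cvgg x : g n x @[n --> \oo] --> (f x)%:E.
  apply: cvg_near_cst.
  near=> n; rewrite /g min_l //; near: n; exact: nbhs_infty_ger.
have gE n : (\int[normal_prob m s]_x g n x =
             \int[mu]_x (g n x * (normal_pdf m s x)%:E))%E.
  apply: integral_normal_prob => //.
  apply: (@le_lt_trans _ _ (\int[normal_prob m s]_x (n%:R)%:E)%E).
    apply: ge0_le_integral => //.
      by apply: measurableT_comp => //; exact: mg.
    by move=> x _; rewrite gee0_abs // lee_fin ge_min lexx orbT.
  by rewrite integral_cst //= probability_setT mule1 ltry.
have p0 x : 0 <= normal_pdf m s x by exact: normal_pdf_ge0.
transitivity (limn (fun n => \int[normal_prob m s]_x g n x)%E).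
  rewrite -monotone_convergence //.
  by apply: eq_integral => x _; apply/esym/cvg_lim => //; apply: cvgg.
rewrite (_ : (fun n => _) = (fun n => \int[mu]_x (g n x * (normal_pdf m s x)%:E))%E);
  last exact/funext.
rewrite -monotone_convergence //.
- apply: eq_integral => x _; apply/cvg_lim => //.
  rewrite EFinM; apply: cvgeZr => //; exact: cvgg.
- move=> n; apply: emeasurable_funM; first exact: mg.
  apply/measurableT_comp => //=.
  exact: measurable_normal_pdf.
- by move=> n x _; rewrite mule_ge0 // lee_fin.
- by move=> x _ a b ab; rewrite lee_wpmul2r // ?lee_fin //; exact: ndg.
Unshelve. all: by end_near. Qed.


Lemma normal_pdf0E (s x : R) : s != 0 ->
  normal_pdf 0 s x = normal_peak s * expR (- x ^+ 2 / (s ^+ 2 *+ 2)).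
Proof. by move=> s0; rewrite normal_pdfE //= /normal_fun subr0. Qed.

Lemma normal_pdf0_even (s x : R) : s != 0 -> normal_pdf 0 s (- x) = normal_pdf 0 s x.
Proof. by move=> s0; rewrite !normal_pdf0E // sqrrN. Qed.

Lemma normal_pow8_lty (s : R) : 0 < s ->
  (\int[normal_prob 0 s]_x (x ^+ 8)%:E < +oo)%E.
Proof.
move=> s0; have sn0 : s != 0 by rewrite gt_eqF.
have s20 : 2 * s != 0 by rewrite mulf_neq0.
have x80 (x : R) : 0 <= x ^+ 8 by rewrite exprn_even_ge0.
rewrite ge0_integral_normal_prob //.
(* The eighth power is absorbed by doubling the standard deviation:
   [u = 1 / (2 s ^ 2) - 1 / (2 (2 s) ^ 2)] is the gap between the exponents, and [24 = 4!] comes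
   from [(u x ^ 2) ^ 4 / 4! <= exp (u x ^ 2)]. *)
pose u := 3 / (8 * s ^+ 2).
have u0 : 0 < u by rewrite divr_gt0 // mulr_gt0 // exprn_gt0.
pose C := 24%:R * u ^- 4 * normal_peak s / normal_peak (2 * s).
have C0 : 0 <= C.
  by rewrite divr_ge0 ?normal_peak_ge0 // mulr_ge0 ?normal_peak_ge0 //
    mulr_ge0 // invr_ge0 exprn_ge0 // ltW.
have le8 x : x ^+ 8 * normal_pdf 0 s x <= C * normal_pdf 0 (2 * s) x.
  rewrite !normal_pdf0E //.
  have e1 : expR (- x ^+ 2 / ((2 * s) ^+ 2 *+ 2)) =
            expR (- x ^+ 2 / (s ^+ 2 *+ 2)) * expR (u * x ^+ 2).
    rewrite -expRD; congr expR.
    rewrite /u -(mulr_natl (s ^+ 2)) -(mulr_natl ((2 * s) ^+ 2)).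
    by field; rewrite ?sn0.
  have e2 : x ^+ 8 <= 24%:R * u ^- 4 * expR (u * x ^+ 2).
    have := @expR_ge1Dxn _ (u * x ^+ 2) 3.
    rewrite mulr_ge0 ?sqr_ge0 ?(ltW u0) // => /(_ isT).
    move=> H; have {}H : (u * x ^+ 2) ^+ 4 / 4`!%:R <= expR (u * x ^+ 2).
      by apply: le_trans H; rewrite lerDr.
    rewrite mulrAC ler_pdivlMr ?exprn_gt0 // (_ : x ^+ 8 * u ^+ 4 = (u * x ^+ 2) ^+ 4).
      by move: H; rewrite (_ : 4`! = 24%N) // ler_pdivrMr ?ltr0n // [leRHS]mulrC.
    ring.
  rewrite e1 /C.
  have pk : normal_peak (2 * s) != 0 by rewrite gt_eqF // normal_peak_gt0.
  set E := expR _; set G := expR (u * _) in e2 *.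
  rewrite (_ : _ / normal_peak (2 * s) * _ =
    (24%:R * u ^- 4 * G) * (normal_peak s * E)); last first.
    by field; rewrite pk /= gt_eqF.
  by rewrite ler_wpM2r // mulr_ge0 ?expR_ge0 ?normal_peak_ge0.
apply: (@le_lt_trans _ _ (\int[mu]_x (C%:E * (normal_pdf 0 (2 * s) x)%:E))%E).
  apply: ge0_le_integral => //.
  - by move=> x _; rewrite lee_fin mulr_ge0 ?normal_pdf_ge0.
  - apply/measurable_EFinP; apply: measurable_funM => //; exact: measurable_normal_pdf.
  - apply/measurable_EFinP; apply: measurable_funM => //; exact: measurable_normal_pdf.
  - by move=> x _; rewrite -EFinM lee_fin.
rewrite ge0_integralZl //.
- by rewrite integral_normal_pdf mule1 ltry.
- by apply/measurable_EFinP; exact: measurable_normal_pdf.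
- by move=> x _; rewrite lee_fin normal_pdf_ge0.
Qed.

Lemma cvg_mul_gauss0 (a : R) : 0 < a ->
  - (x * expR (- x ^+ 2 / a)) @[x --> +oo%R] --> (0 : R).
Proof.
move=> a0; rewrite -oppr0; apply: cvgN.
apply: (@squeeze_cvgr _ _ _ _ (fun=> 0) (fun x => a * x^-1)); last 2 first.
- exact: cvg_cst.
- rewrite -(mulr0 a); apply: cvgMr; apply/(@gtr0_cvgV0 _ _ _ _ id) => //; exact: nbhs_pinfty_gt.
near=> x.
have x0 : 0 < x by near: x; exact: nbhs_pinfty_gt.
rewrite mulr_ge0 ?expR_ge0 ?(ltW x0) //= mulNr expRN ler_pdivrMr ?expR_gt0 //.
have := @expR_ge1Dx R (x ^+ 2 / a).
move=> /(ler_wpM2l (_ : 0 <= a * x^-1)) => /(_ _) H.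
apply: le_trans (H _); last by rewrite mulr_ge0 ?invr_ge0 ?(ltW a0) ?(ltW x0).
rewrite mulrDr mulr1 (_ : _ * (_ / a) = x); last by field; rewrite ?gt_eqF.
by rewrite lerDr mulr_ge0 ?invr_ge0 ?(ltW a0) ?(ltW x0).
Unshelve. all: by end_near. Qed.

End gaussian_moments.

Section gaussian_variance.
Context (R : realType).
Notation mu := (@lebesgue_measure R).
Variables (s : R) (s_gt0 : 0 < s).
Let sn0 : s != 0. Proof. by rewrite gt_eqF. Qed.

(** [F] is [- x] times the density and [h] is its derivative. As [F] vanishes at [0] and at
    infinity, [h] integrates to [0] over the half line, which says that the second moment is [s ^ 2]
    times the total mass. *)
Let F (x : R) : R := - (x * (normal_peak s * expR (- x ^+ 2 / (s ^+ 2 *+ 2)))).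
Let h (x : R) : R := (x ^+ 2 / s ^+ 2 - 1) * normal_pdf 0 s x.

Let dF (x : R) : is_derive x 1 F (h x).
Proof.
rewrite /F /h normal_pdf0E //; apply: is_derive_eq.
rewrite /GRing.scale /= -(mulr_natl (s ^+ 2)).
by field.
Qed.

Let ch : continuous h.
Proof.
move=> x; apply: cvgM; last exact: continuous_normal_pdf.
apply: cvgB; last exact: cvg_cst.
by apply: cvgMl; exact: exprn_continuous.
Qed.

Let mpdf : measurable_fun setT (normal_pdf 0 s).
Proof. exact: measurable_normal_pdf. Qed.

Let integrable_poly_pdf (p : R -> R) : measurable_fun setT p ->
  (forall x, `|p x| <= 1 + x ^+ 8) ->
  mu.-integrable setT (EFin \o (fun x => p x * normal_pdf 0 s x)).
Proof.
move=> mp ple; have x80 (x : R) : 0 <= x ^+ 8 by rewrite exprn_even_ge0.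
apply/integrableP; split; first by apply/measurable_EFinP/measurable_funM.
apply: (@le_lt_trans _ _ (\int[mu]_x ((1 + x ^+ 8) * normal_pdf 0 s x)%:E)%E).
  apply: ge0_le_integral => //.
  - by apply: measurableT_comp => //; apply/measurable_EFinP/measurable_funM.
  - apply/measurable_EFinP/measurable_funM => //; apply: measurable_funD => //.
  - move=> x _ /=; rewrite lee_fin normrM (ger0_norm (normal_pdf_ge0 _ _ _)).
    by rewrite ler_wpM2r ?normal_pdf_ge0.
rewrite -ge0_integral_normal_prob; last 2 first.
- by apply: measurable_funD.
- by move=> x; rewrite addr_ge0.
under eq_integral do rewrite EFinD.
rewrite ge0_integralD //=; last 2 first.
- by move=> x _; rewrite lee_fin.
- by apply/measurable_EFinP.
rewrite lte_add_pinfty //; last exact: normal_pow8_lty.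
by rewrite integral_cst //= probability_setT mule1 ltry.
Qed.

Let sqr_le_pow8 (x : R) : x ^+ 2 <= 1 + x ^+ 8.
Proof.
have -> : x ^+ 8 = (x ^+ 2) ^+ 4 by ring.
have := sqr_ge0 x; set y := x ^+ 2 => y0.
have [y1|/ltW y1] := leP y 1; first by rewrite (le_trans y1) // lerDl exprn_ge0.
by rewrite (@le_trans _ _ (y ^+ 4)) ?lerDr // ler_eXnr.
Qed.

Let sqr_pdf_int : mu.-integrable setT (EFin \o (fun x => x ^+ 2 * normal_pdf 0 s x)).
Proof.
apply: integrable_poly_pdf => [|x]; first exact: measurable_funX.
by rewrite ger0_norm ?sqr_ge0.
Qed.

Let pdf_int : mu.-integrable setT (EFin \o normal_pdf 0 s).
Proof. exact: integrable_normal_pdf. Qed.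

Let h_int : mu.-integrable setT (EFin \o h).
Proof.
rewrite (_ : _ \o _ = (fun x => ((s ^+ 2)^-1)%:E * (x ^+ 2 * normal_pdf 0 s x)%:E)
   \- (EFin \o normal_pdf 0 s))%E; last first.
  apply/funext => x /=; rewrite /h -EFinM -EFinB; congr EFin; ring.
by apply: integrableB => //; apply: (integrableZl measurableT).
Qed.

Let cvgF (x : R) : F y @[y --> x] --> F x.
Proof.
by apply: differentiable_continuous; apply/derivable1_diffP; case: (dF x).
Qed.

Let integral_h : \int[mu]_(x in `[0, +oo[) h x = 0.
Proof.
have dhE (x : R) : F^`()%classic x = h x by rewrite derive1E; have [_ ->] := dF x.
have derF (x : R) : derivable F x 1 by case: (dF x).
(* The half line is cut at [s], where [h] changes sign: beyond [s] it is nonnegative, as the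
   fundamental theorem on an unbounded interval requires. *)
have e1 : (\int[mu]_(x in `[0%R, s]) (h x)%:E = (F s)%:E - (F 0)%:E)%E.
  apply: continuous_FTC2 => //.
  - by apply: continuous_subspaceT => x; exact: ch.
  - by split => // ; [exact: cvg_at_right_filter|exact: cvg_at_left_filter].
have e2 : (\int[mu]_(x in `[s, +oo[) (h x)%:E = 0%:E - (F s)%:E)%E.
  apply: ge0_continuous_FTC2y => //.
  - move=> x sx; rewrite mulr_ge0 ?normal_pdf_ge0 // subr_ge0.
    by rewrite ler_pdivlMr ?exprn_gt0 // mul1r ler_sqr ?nnegrE ?(ltW s_gt0) // (le_trans _ sx) // ltW.
  - by apply: continuous_subspaceT => x; exact: ch.
  - rewrite /F; under eq_fun do rewrite mulrCA -mulrN.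
    rewrite -(mulr0 (normal_peak s)); apply: cvgMr.
    by apply: cvg_mul_gauss0; rewrite -mulr_natl mulr_gt0 // exprn_gt0.
  - exact: cvg_at_right_filter.
have U : `[0%R, +oo[%classic = `[0%R, s]%classic `|` `]s, +oo[%classic :> set R.
  by rewrite -itv_bndbnd_setU // bnd_simp ltW.
rewrite U Rintegral_setU //.
- rewrite Rintegral_itv_obnd_cbnd; last exact: integrableS h_int.
  rewrite /Rintegral e1 e2 /= {2}/F !mul0r; ring.
- by apply: integrableS h_int => //; apply: measurableU.
- apply/disj_setPS => x /= []; rewrite !in_itv /= andbT => /andP[_ xs] sx.
  by move: (le_lt_trans xs sx); rewrite ltxx.
Qed.

Lemma normal_sqr : (\int[normal_prob 0 s]_x (x ^+ 2)%:E = (s ^+ 2)%:E)%E.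
Proof.
rewrite ge0_integral_normal_prob //; last by move=> x; exact: sqr_ge0.
have even_pdf x : normal_pdf 0 s x = normal_pdf 0 s (- x) by rewrite normal_pdf0_even.
have := @integral_normal_pdf R 0 s.
rewrite (ge0_symfun_integralT (normal_pdf_ge0 0 s)) //; last exact: continuous_normal_pdf.
rewrite (@ge0_symfun_integralT _ (fun x => x ^+ 2 * normal_pdf 0 s x)); last first.
- by move=> x /=; rewrite sqrrN -even_pdf.
- move=> x; apply: cvgM; last exact: continuous_normal_pdf.
  exact: exprn_continuous.
- by move=> x; rewrite mulr_ge0 ?sqr_ge0 ?normal_pdf_ge0.
rewrite -set_itvcy.
have i1 : mu.-integrable `[0, +oo[ (EFin \o normal_pdf 0 s) by exact: integrableS pdf_int.
have i2 : mu.-integrable `[0, +oo[ (EFin \o (fun x => x ^+ 2 * normal_pdf 0 s x)).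
  exact: integrableS sqr_pdf_int.
have := integral_h; rewrite (_ : h = (fun x => (s ^+ 2)^-1 * (x ^+ 2 * normal_pdf 0 s x)
  - normal_pdf 0 s x)); last by apply/funext => x; rewrite /h; ring.
rewrite RintegralB //; last by apply: (integrableZl _ _ i2).
rewrite RintegralZl // /Rintegral => /eqP; rewrite subr_eq0 => /eqP.
rewrite -(fineK (integrable_fin_num _ i1)) // -(fineK (integrable_fin_num _ i2)) //=.
set a := fine _; set b := fine _ => ab; rewrite -!EFinM => -[b1]; congr EFin.
have -> : 2 * a = s ^+ 2 * (2 * ((s ^+ 2)^-1 * a)) by field.
by rewrite ab b1 mulr1.
Qed.

(** The mean is zero because the density is even. Positive and negative parts are compared, since
    the passage to the density is made for nonnegative functions. *)
Lemma normal_pos_neg :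
  (\int[normal_prob 0 s]_x (Num.max x 0)%:E =
   \int[normal_prob 0 s]_x (Num.max (- x) 0)%:E)%E.
Proof.
have mm : measurable_fun setT (fun x : R => Num.max x 0) by apply: measurable_maxr.
have mn : measurable_fun setT (fun x : R => Num.max (- x) 0).
  by apply: measurable_maxr => //; apply: measurableT_comp.
rewrite !ge0_integral_normal_prob //; try by move=> x; rewrite le_max lexx orbT.
pose f (x : R) : R := Num.max x 0 * normal_pdf 0 s x.
have f0 x : 0 <= f x by rewrite mulr_ge0 ?normal_pdf_ge0 // le_max lexx orbT.
have mf : measurable_fun setT f by apply: measurable_funM.
have mfN : measurable_fun setT (f \o -%R) by apply: measurableT_comp.
have restr (g : R -> R) (A : set R) : measurable A -> (forall x, ~ A x -> g x = 0) ->
    (\int[mu]_x (g x)%:E = \int[mu]_(x in A) (g x)%:E)%E.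
  move=> mA g0; rewrite [RHS]integral_mkcond; apply: eq_integral => x _.
  by rewrite patchE; case: ifPn => //; rewrite notin_setE => /g0 ->.
transitivity (\int[mu]_(x in `[0%R, +oo[) (f x)%:E)%E.
  apply: restr => // x /=; rewrite in_itv /= andbT => /negP; rewrite -ltNge => x0.
  by rewrite /f max_r ?mul0r // ltW.
have fN0 x : ~ `]-oo, 0%R]%classic x -> (f \o -%R) x = 0.
  rewrite /= in_itv /= => /negP; rewrite -ltNge => x0.
  by rewrite /f max_r ?mul0r // oppr_le0 ltW.
have cfN : {within `]-oo, (- 0)%R], continuous (f \o -%R)}.
  apply: continuous_subspaceT => x; apply: continuous_comp; first exact: opp_continuous.
  apply: cvgM; last exact: continuous_normal_pdf.
  have : continuous (fun x : R => Num.max x 0); last exact.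
  by apply: (@max_fun_continuous _ _ R id (fun=> 0)) => [y|];
    [exact: cvg_id|exact: cst_continuous].
have fN_ge0 : {in `]-oo, (- 0)%R[, forall x, 0 <= (f \o -%R) x} by move=> x _; exact: f0.
have := ge0_integration_by_substitutionNy cfN fN_ge0; rewrite oppr0.
rewrite -(restr _ _ (measurable_itv _) fN0) => fNE.
transitivity (\int[mu]_(x in `[0%R, +oo[) (((f \o -%R) \o -%R) x)%:E)%E.
  by apply: eq_integral => x _ /=; rewrite opprK.
by rewrite -fNE; apply: eq_integral => x _; rewrite /f /= normal_pdf0_even.
Qed.

End gaussian_variance.

Section standard_normal.
Context (disp : measure_display) (T : measurableType disp) (R : realType)
  (P : probability T R).

Definition normal_eighth_moment (v : R) : R :=
  fine (\int[normal_prob 0 (Num.sqrt v)]_x (x ^+ 8)%:E)%E.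

Lemma ge0_integral_is_normal (m v : R) (X : T -> R) (f : R -> R) :
  is_normal P m v X -> measurable_fun setT f -> (forall x, 0 <= f x) ->
  (\int[P]_t (f (X t))%:E = \int[normal_prob m (Num.sqrt v)]_x (f x)%:E)%E.
Proof.
move=> [mX lawX] mf f0.
have mX' : measurable_fun setT (X : T -> measurableTypeR R) by exact: mX.
pose X' : {mfun T >-> measurableTypeR R} :=
  HB.pack (X : T -> measurableTypeR R) (isMeasurableFun.Build _ _ _ _ _ mX').
have mf' : measurable_fun setT (EFin \o f : measurableTypeR R -> \bar R).
  exact/measurable_EFinP.
transitivity (\int[distribution P X']_y (EFin \o f) y)%E.
  by rewrite ge0_integral_distribution // => x; rewrite lee_fin.
rewrite [LHS](eq_measure_integral (normal_prob m (Num.sqrt v))) // => A mA _.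
exact: lawX.
Qed.

Lemma normal_moments (v : R) (X : T -> R) : 0 < v -> is_normal P 0 v X ->
  [/\ rintegrable P (fun t => X t ^+ 8), \int[P]_t X t = 0,
      \int[P]_t (X t ^+ 2) = v & \int[P]_t (X t ^+ 8) = normal_eighth_moment v].
Proof.
move=> v0 nX; have [mX _] := nX.
have s0 : 0 < Num.sqrt v by rewrite sqrtr_gt0.
have x80 (x : R) : 0 <= x ^+ 8 by rewrite exprn_even_ge0.
have m8 : measurable_fun setT (fun x : R => x ^+ 8) by exact: measurable_funX.
have E8 := ge0_integral_is_normal nX m8 x80.
have E2 : (\int[P]_t (X t ^+ 2)%:E = v%:E)%E.
  rewrite (ge0_integral_is_normal (f := fun x => x ^+ 2) nX) //.
  - by rewrite normal_sqr // sqr_sqrtr // ltW.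
  - exact: sqr_ge0.
have i8 : rintegrable P (fun t => X t ^+ 8).
  apply/integrableP; split; first by apply/measurable_EFinP; exact: measurable_funX.
  under eq_integral => x _ do rewrite gee0_abs ?lee_fin //.
  by rewrite E8 normal_pow8_lty.
have i2 : rintegrable P (fun t => X t ^+ 2).
  apply/integrableP; split; first by apply/measurable_EFinP; exact: measurable_funX.
  under eq_integral => x _ do rewrite gee0_abs ?lee_fin ?sqr_ge0 //.
  by rewrite E2 ltry.
have i1 : rintegrable P X.
  apply: (@rintegrable_le _ _ _ _ _ (fun t => 1 + X t ^+ 2)) => // [|t].
    by apply: rintegrableD => //; exact: rintegrable_cst.
  rewrite -(real_normK (num_real _)); have := normr_ge0 (X t).
  set y := `|X t| => y0; nra.
split=> //; last 2 first.
- by rewrite /Rintegral E2.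
- by rewrite /Rintegral E8.
have mmax : measurable_fun setT (fun x : R => Num.max x 0) by apply: measurable_maxr.
have mmaxN : measurable_fun setT (fun x : R => Num.max (- x) 0).
  by apply: measurable_maxr => //; apply: measurableT_comp.
have max0 (x : R) : 0 <= Num.max x 0 by rewrite le_max lexx orbT.
have ip : rintegrable P (fun t => Num.max (X t) 0).
  apply: (@rintegrable_le _ _ _ _ _ (fun t => `|X t|)) => // [||t].
  - exact: (measurableT_comp mmax).
  - exact: integrable_norm.
  - by rewrite ger0_norm // ge_max ler_norm normr_ge0.
have iN : rintegrable P (fun t => Num.max (- X t) 0).
  apply: (@rintegrable_le _ _ _ _ _ (fun t => `|X t|)) => // [||t].
  - exact: (measurableT_comp mmaxN).
  - exact: integrable_norm.
  - by rewrite ger0_norm // ge_max -normrN ler_norm normr_ge0.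
transitivity (\int[P]_t (Num.max (X t) 0 - Num.max (- X t) 0)).
  apply: eq_Rintegral => t _; have [x0|/ltW x0] := leP 0 (X t).
    by rewrite max_r ?subr0 // oppr_le0.
  by rewrite max_l ?oppr_ge0 // sub0r opprK.
rewrite RintegralB // /Rintegral.
rewrite (ge0_integral_is_normal nX mmax max0).
rewrite (ge0_integral_is_normal (f := fun x => Num.max (- x) 0) nX mmaxN) //.
by rewrite normal_pos_neg // subrr.
Qed.

(** The expectation of [g ^ 2], without conjugation. After this section the real and the complex
    case differ only through this number and the eighth moment bound. *)
Definition second_moment (k : entry_kind) : R :=
  match k with real_entries => 1 | complex_entries => 0 end.

(** In the complex case [(a ^ 2 + b ^ 2) ^ 4 <= 8 (a ^ 8 + b ^ 8)] is applied to two parts of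
    variance [1/2], hence the factor [16]. *)
Definition eighth_moment_bound (k : entry_kind) : R :=
  match k with
  | real_entries => normal_eighth_moment 1
  | complex_entries => 16 * normal_eighth_moment 2^-1
  end.

Lemma std_normal_moments (k : entry_kind) (X : T -> R[i]) : is_std_normal P k X ->
  [/\ cmeasurable X, rintegrable P (fun t => normc (X t) ^+ 8),
      cexpectation P X = 0,
      cexpectation P (fun t => X t * Num.conj (X t)) = 1 &
      cexpectation P (fun t => X t * X t) = (second_moment k)%:C /\
      \int[P]_t (normc (X t) ^+ 8) <= eighth_moment_bound k].
Proof.
have n8 t : normc (X t) ^+ 8 = (complex.Re (X t) ^+ 2 + complex.Im (X t) ^+ 2) ^+ 4.
  by rewrite -sqr_normc -exprM.
case: k => /= [[im0 nX]|[nX nY indep]].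
  have [i8 E1 E2 E8] := normal_moments ltr01 nX.
  have mim : measurable_fun setT (fun t => complex.Im (X t)).
    by rewrite (_ : (fun t => _) = cst 0) //; exact/funext.
  have n8E t : normc (X t) ^+ 8 = complex.Re (X t) ^+ 8.
    by rewrite n8 im0 expr0n addr0 -exprM.
  split=> //.
  - by split=> //; case: nX.
  - by under eq_fun do rewrite n8E.
  - by apply: complexP; rewrite /cexpectation /= ?E1 //;
      under eq_Rintegral do rewrite im0; rewrite Rintegral_prob_cst.
  - apply: complexP; rewrite /cexpectation /=.
      under eq_Rintegral do rewrite Re_mul Re_conjc Im_conjc im0 oppr0 mulr0 subr0 -expr2.
      exact: E2.
    under eq_Rintegral do rewrite Im_mul Re_conjc Im_conjc im0 oppr0 mulr0 mul0r addr0.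
    exact: Rintegral_prob_cst.
  split; last by under eq_Rintegral do rewrite n8E; rewrite E8.
  apply: complexP; rewrite /cexpectation /=.
    under eq_Rintegral do rewrite Re_mul im0 mulr0 subr0 -expr2.
    exact: E2.
  under eq_Rintegral do rewrite Im_mul im0 mulr0 mul0r addr0.
  exact: Rintegral_prob_cst.
have h0 : 0 < 2^-1 :> R by rewrite invr_gt0.
have [i8 E1 E2 E8] := normal_moments h0 nX.
have [j8 F1 F2 F8] := normal_moments h0 nY.
have [mX _] := nX; have [mY _] := nY.
have le8 (Z : T -> R) : measurable_fun setT Z -> rintegrable P (fun t => Z t ^+ 8) ->
    rintegrable P (fun t => Z t ^+ 2) /\ rintegrable P Z.
  move=> mZ iZ; have i2 : rintegrable P (fun t => Z t ^+ 2).
    apply: (@rintegrable_le _ _ _ _ _ (fun t => 1 + Z t ^+ 8)) => [||t].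
    - exact: measurable_funX.
    - by apply: rintegrableD => //; exact: rintegrable_cst.
    have -> : Z t ^+ 8 = (Z t ^+ 2) ^+ 4 by ring.
    rewrite ger0_norm ?sqr_ge0 //; have := sqr_ge0 (Z t); set y := Z t ^+ 2 => y0.
    have [y1|/ltW y1] := leP y 1; first by rewrite (le_trans y1) // lerDl exprn_ge0.
    by rewrite (@le_trans _ _ (y ^+ 4)) ?lerDr // ler_eXnr.
  split=> //; apply: (@rintegrable_le _ _ _ _ _ (fun t => 1 + Z t ^+ 2)) => // [|t].
    by apply: rintegrableD => //; exact: rintegrable_cst.
  rewrite -(real_normK (num_real _)); have := normr_ge0 (Z t).
  set y := `|Z t| => y0; nra.
have [i2 i1] := le8 _ mX i8; have [j2 j1] := le8 _ mY j8.
have [i12 E12] := expectation_mul_indep mX mY indep i1 j1.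
have le8' t : normc (X t) ^+ 8 <= 8 * (complex.Re (X t) ^+ 8 + complex.Im (X t) ^+ 8).
  rewrite n8; have := sqr_ge0 (complex.Re (X t)); have := sqr_ge0 (complex.Im (X t)).
  rewrite -[8%N]/(2 * 4)%N !exprM.
  set a := _ ^+ 2; set b := _ ^+ 2 => a0 b0.
  have h2 (x y : R) : (x + y) ^+ 2 <= 2 * (x ^+ 2 + y ^+ 2).
    by rewrite -subr_ge0 (_ : _ - _ = (x - y) ^+ 2) ?sqr_ge0 //; ring.
  rewrite -[4%N]/(2 * 2)%N !exprM.
  apply: (@le_trans _ _ ((2 * (b ^+ 2 + a ^+ 2)) ^+ 2)).
    by rewrite ler_sqr ?nnegrE ?mulr_ge0 ?addr_ge0 ?sqr_ge0.
  rewrite exprMn (_ : 8 = 2 ^+ 2 * 2); last by ring.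
  by rewrite -mulrA ler_wpM2l.
have m8 : measurable_fun setT (fun t => normc (X t) ^+ 8).
  by apply: measurable_funX; apply: measurable_normc.
have d8 : rintegrable P (fun t => 8 * (complex.Re (X t) ^+ 8 + complex.Im (X t) ^+ 8)).
  by apply: rintegrableZ; apply: rintegrableD.
have k8 : rintegrable P (fun t => normc (X t) ^+ 8).
  apply: rintegrable_le d8 _ => // t.
  by rewrite ger0_norm ?exprn_ge0 ?normc_ge0.
split=> //.
- by apply: complexP; rewrite /cexpectation /= ?E1 ?F1.
- apply: complexP; rewrite /cexpectation /=.
    under eq_Rintegral do rewrite Re_mul Re_conjc Im_conjc mulrN opprK -!expr2.
    by rewrite RintegralD // E2 F2; field.
  under eq_Rintegral do rewrite Im_mul Re_conjc Im_conjc mulrN mulrC addNr.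
  exact: Rintegral_prob_cst.
split.
- apply: complexP; rewrite /cexpectation /=.
    under eq_Rintegral do rewrite Re_mul -!expr2.
    by rewrite RintegralB // E2 F2 subrr.
  under eq_Rintegral do rewrite Im_mul [X in _ + X]mulrC -mulr2n -mulr_natl.
  by rewrite RintegralZl // E12 E1 mul0r mulr0.
apply: le_trans (le_Rintegral measurableT k8 d8 _) _ => //.
rewrite RintegralZl //; last exact: rintegrableD.
by rewrite RintegralD // E8 F8; lra.
Qed.

End standard_normal.

(** * Mixed moments of independent entries *)

Section independent_entries.
Context (disp : measure_display) (T : measurableType disp) (R : realType)
  (P : probability T R) (I : finType) (g : I -> T -> R[i]) (rho C8 : R).

Definition re_im (i : I) (t : T) : R * R := (complex.Re (g i t), complex.Im (g i t)).

Hypotheses (g_meas : forall i, cmeasurable (g i))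
  (g_indep : mutually_independent P re_im)
  (g_int8 : forall i, rintegrable P (fun t => normc (g i t) ^+ 8))
  (g_mean : forall i, cexpectation P (g i) = 0)
  (g_var : forall i, cexpectation P (fun t => g i t * Num.conj (g i t)) = 1)
  (g_sqr : forall i, cexpectation P (fun t => g i t * g i t) = rho%:C)
  (g_E8 : forall i, \int[P]_t (normc (g i t) ^+ 8) <= C8).

Lemma measurable_re_im i : measurable_fun setT (re_im i).
Proof. by have [? ?] := g_meas i; apply: measurable_fun_pair. Qed.

Lemma cmeasurable_entry (J : {set I}) i : i \in J ->
  cmeasurable (g i : sub_sigma re_im J -> R[i]).
Proof.
by move=> iJ; have /measurable_fun_pairP[m1 m2] := measurable_sub_sigma (X := re_im) iJ.
Qed.

Definition sqnorm (J : {set I}) (t : T) : R := \sum_(i in J) normc (g i t) ^+ 2.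

Lemma sqnorm_ge0 J t : 0 <= sqnorm J t.
Proof. by apply: sumr_ge0 => i _; apply: sqr_ge0. Qed.

Lemma sqr_sum_le (J : {set I}) (x : I -> R) :
  (\sum_(i in J) x i) ^+ 2 <= #|J|%:R * \sum_(i in J) x i ^+ 2.
Proof.
have := @cauchy_schwarz_sum R I (fun i => (i \in J)%:R) (fun i => (i \in J)%:R * x i).
have e1 : \sum_i (i \in J)%:R * ((i \in J)%:R * x i) = \sum_(i in J) x i.
  rewrite [RHS]big_mkcond /=; apply: eq_bigr => i _.
  by case: (i \in J); rewrite ?mul1r ?mul0r.
have e2 : \sum_i ((i \in J)%:R : R) ^+ 2 = #|J|%:R.
  rewrite -sum1_card natr_sum big_mkcond /= [RHS]big_mkcond /=.
  by apply: eq_bigr => i _; case: (i \in J); rewrite ?expr1n ?expr0n.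
have e3 : \sum_i ((i \in J)%:R * x i) ^+ 2 = \sum_(i in J) x i ^+ 2.
  rewrite [RHS]big_mkcond /=; apply: eq_bigr => i _.
  by case: (i \in J); rewrite ?mul1r ?mul0r ?expr0n.
by rewrite e1 e2 e3.
Qed.

Lemma sqnorm_pow4_le J t :
  sqnorm J t ^+ 4 <= #|J|%:R ^+ 3 * \sum_(i in J) normc (g i t) ^+ 8.
Proof.
rewrite -[4%N]/(2 * 2)%N exprM.
apply: (@le_trans _ _ ((#|J|%:R * \sum_(i in J) (normc (g i t) ^+ 2) ^+ 2) ^+ 2)).
  rewrite ler_sqr ?nnegrE ?sqr_ge0 ?sqr_sum_le //.
  by rewrite mulr_ge0 // sumr_ge0 // => i _; apply: sqr_ge0.
rewrite exprMn (exprSr _ 2) -mulrA ler_wpM2l ?sqr_ge0 //.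
apply: le_trans (sqr_sum_le _ _) _; rewrite ler_wpM2l //.
by apply: ler_sum => i _; rewrite -!exprM.
Qed.

Lemma measurable_sqnorm J : measurable_fun setT (sqnorm J).
Proof.
rewrite /sqnorm; under eq_fun do rewrite big_mkcond /=.
apply: measurable_sum => i; case: (i \in J) => //.
by apply: measurable_funX; apply: measurable_normc.
Qed.

Lemma rintegrable_sqnorm4 J : rintegrable P (fun t => sqnorm J t ^+ 4).
Proof.
apply: (@rintegrable_le _ _ _ _ _
  (fun t => #|J|%:R ^+ 3 * \sum_(i in J) normc (g i t) ^+ 8)) => [||t].
- by apply: measurable_funX; exact: measurable_sqnorm.
- by apply: rintegrableZ; apply: rintegrable_sum.
- by rewrite ger0_norm ?sqnorm_pow4_le // exprn_ge0 // sqnorm_ge0.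
Qed.

Lemma expectation_sqnorm4 J : \int[P]_t (sqnorm J t ^+ 4) <= #|J|%:R ^+ 4 * C8.
Proof.
apply: (@le_trans _ _ (\int[P]_t (#|J|%:R ^+ 3 * \sum_(i in J) normc (g i t) ^+ 8))).
  apply: le_Rintegral => //; first exact: rintegrable_sqnorm4.
    by apply: rintegrableZ; apply: rintegrable_sum.
  by move=> t _; apply: sqnorm_pow4_le.
rewrite RintegralZl //; last exact: rintegrable_sum.
rewrite (exprSr _ 3) -mulrA ler_wpM2l ?exprn_ge0 // Rintegral_sum //.
apply: (@le_trans _ _ (\sum_(i in J) C8)); first by apply: ler_sum => i _.
by rewrite sumr_const mulr_natl.
Qed.

Lemma normc_entry_le (J : {set I}) i t : i \in J -> normc (g i t) ^+ 2 <= sqnorm J t.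
Proof.
by move=> iJ; rewrite /sqnorm (bigD1 i) //= lerDl sumr_ge0 // => j _; apply: sqr_ge0.
Qed.

Lemma le_1Dpow4 (y : R) : 0 <= y -> y <= 1 + y ^+ 4.
Proof.
move=> y0; have [y1|/ltW y1] := leP y 1.
  by rewrite (le_trans y1) // lerDl exprn_ge0.
by rewrite (@le_trans _ _ (y ^+ 4)) ?lerDr // ler_eXnr.
Qed.

Lemma sqr_le_1Dpow4 (y : R) : y ^+ 2 <= 1 + y ^+ 4.
Proof. by rewrite (_ : y ^+ 4 = (y ^+ 2) ^+ 2); [have := sqr_ge0 (y ^+ 2 - 1); nra|ring]. Qed.

Lemma rintegrable_1Dsqnorm4 J (K : R) : rintegrable P (fun t => K * (1 + sqnorm J t ^+ 4)).
Proof.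
apply: rintegrableZ; apply: rintegrableD; first exact: rintegrable_cst.
exact: rintegrable_sqnorm4.
Qed.

(** An entry or its conjugate, so that each mixed moment is treated once, whatever the positions of
    the conjugates. *)
Let h (b : bool) (i : I) (t : T) : R[i] := if b then Num.conj (g i t) else g i t.

Let normc_h b i t : normc (h b i t) = normc (g i t).
Proof. by case: b; rewrite /h ?normc_conj. Qed.

Let h_meas b (J : {set I}) i : i \in J -> cmeasurable (h b i : sub_sigma re_im J -> R[i]).
Proof.
move=> iJ; case: b; rewrite /h /=; last exact: cmeasurable_entry.
by apply: cmeasurable_conj; apply: cmeasurable_entry.
Qed.

Let h_measT b i : cmeasurable (h b i).
Proof.
apply: (cmeasurable_sub_sigma measurable_re_im (J := [set i]%SET)).
by apply: h_meas; rewrite inE.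
Qed.

Let Q := [set: I]%SET.

Let normc_le_q i t : normc (g i t) ^+ 2 <= sqnorm Q t.
Proof. by apply: normc_entry_le; rewrite inE. Qed.

Let h_int1 b i : cintegrable P (h b i).
Proof.
apply: cintegrable_le (h_measT b i) (rintegrable_1Dsqnorm4 Q 2) _ => t.
rewrite normc_h; have := normc_le_q i t; have := normc_ge0 (g i t).
have := le_1Dpow4 (sqnorm_ge0 Q t); have := exprn_ge0 4 (sqnorm_ge0 Q t).
by set x := normc _; set y := sqnorm _ _; set z := y ^+ 4; nra.
Qed.

Let prod2_le i j t : normc (g i t) * normc (g j t) <= sqnorm Q t.
Proof.
have := normc_le_q i t; have := normc_le_q j t.
by set x := normc _; set y := normc _; have := sqr_ge0 (x - y); nra.
Qed.

Let h_int2 b1 b2 i j : cintegrable P (fun t => h b1 i t * h b2 j t).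
Proof.
apply: cintegrable_le (rintegrable_1Dsqnorm4 Q 1) _ => [|t].
  by apply: cmeasurableM.
rewrite mul1r normcM !normc_h (le_trans (prod2_le i j t)) //.
exact: le_1Dpow4 (sqnorm_ge0 Q t).
Qed.

Let h_int3 b1 b2 b3 i j k : cintegrable P (fun t => h b1 i t * (h b2 j t * h b3 k t)).
Proof.
apply: cintegrable_le (rintegrable_1Dsqnorm4 Q 2) _ => [|t].
  by do 2!apply: cmeasurableM => //.
rewrite !normcM !normc_h.
have := prod2_le j k t; have := normc_le_q i t; have := normc_ge0 (g i t).
have := mulr_ge0 (normc_ge0 (g j t)) (normc_ge0 (g k t)).
have := le_1Dpow4 (sqnorm_ge0 Q t); have := sqr_le_1Dpow4 (sqnorm Q t).
have := exprn_ge0 4 (sqnorm_ge0 Q t).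
by set x := normc _; set y := _ * normc _; set q := sqnorm _ _; set z := q ^+ 4; nra.
Qed.

Let h_int4 b1 b2 b3 b4 i j k l :
  cintegrable P (fun t => h b1 i t * h b2 j t * (h b3 k t * h b4 l t)).
Proof.
apply: cintegrable_le (rintegrable_1Dsqnorm4 Q 1) _ => [|t].
  by do 2!apply: cmeasurableM => //.
rewrite mul1r !normcM !normc_h (le_trans _ (sqr_le_1Dpow4 _)) // expr2.
by apply: ler_pM; rewrite ?mulr_ge0 ?normc_ge0 ?prod2_le.
Qed.

Let hE0 b i : cexpectation P (h b i) = 0.
Proof.
case: b; rewrite /h /= ?g_mean // cexpectation_conj ?g_mean ?conjC0 //.
exact: (h_int1 false).
Qed.

Let inS1 (i j : I) : j \in [set i]%SET -> j \notin (~: [set i])%SET.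
Proof. by rewrite !inE => /eqP ->; rewrite eqxx. Qed.

(** An index that occurs only once splits off by independence and contributes its mean, which is
    [0]. *)
Let single b1 b2 b3 b4 i j k l : i != j -> i != k -> i != l ->
  cexpectation P (fun t => h b1 i t * (h b2 j t * (h b3 k t * h b4 l t))) = 0.
Proof.
move=> ij ik il.
have [||_ ->] := @cexpectation_mul _ T R P _ _ _ _ measurable_re_im g_indep
  [set i]%SET (~: [set i])%SET (h b1 i) (fun t => h b2 j t * (h b3 k t * h b4 l t))
  (@inS1 i) _ _ (h_int1 b1 i) (h_int3 b2 b3 b4 j k l).
- by apply: h_meas; rewrite inE.
- by apply: cmeasurableM; last apply: cmeasurableM; apply: h_meas; rewrite !inE eq_sym.
- by rewrite hE0 mul0r.
Qed.

Let pair b1 b2 b3 b4 i j : i != j ->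
  cexpectation P (fun t => h b1 i t * h b2 i t * (h b3 j t * h b4 j t)) =
  cexpectation P (fun t => h b1 i t * h b2 i t) *
  cexpectation P (fun t => h b3 j t * h b4 j t).
Proof.
move=> ij.
have [||_ ->] // := @cexpectation_mul _ T R P _ _ _ _ measurable_re_im g_indep
  [set i]%SET (~: [set i])%SET (fun t => h b1 i t * h b2 i t)
  (fun t => h b3 j t * h b4 j t)
  (@inS1 i) _ _ (h_int2 b1 b2 i i) (h_int2 b3 b4 j j).
- by apply: cmeasurableM; apply: h_meas; rewrite inE.
- by apply: cmeasurableM; apply: h_meas; rewrite !inE eq_sym.
Qed.

(** The fourth cumulant of the entry. It vanishes for Gaussian entries, but it only multiplies
    diagonal terms, so a bound is enough and no exact fourth moment is computed. *)
Definition excess (i : I) : R[i] :=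
  cexpectation P (fun t => g i t * Num.conj (g i t) * (g i t * Num.conj (g i t)))
  - 2 - (rho ^+ 2)%:C.

Lemma expectation_mul2 i j :
  cintegrable P (fun t => g i t * Num.conj (g j t)) /\
  cexpectation P (fun t => g i t * Num.conj (g j t)) = (i == j)%:R.
Proof.
split; first exact: (h_int2 false true).
have [->|ij] := eqVneq i j; first by rewrite g_var.
have [||_ ->] // := @cexpectation_mul _ T R P _ _ _ _ measurable_re_im g_indep
  [set i]%SET (~: [set i])%SET (h false i) (h true j)
  (@inS1 i) _ _ (h_int1 _ i) (h_int1 _ j).
- by apply: h_meas; rewrite inE.
- by apply: h_meas; rewrite !inE eq_sym.
- by rewrite hE0 mul0r.
Qed.

(** Wick's formula: one term per pairing of the four factors, where pairing two unconjugated factors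
    and two conjugated ones costs [rho ^+ 2]. When all indices coincide the three pairings give
    [2 + rho ^+ 2], and the excess corrects the total. *)
Lemma expectation_mul4 i j k l :
  cintegrable P (fun t => g i t * Num.conj (g j t) * (g k t * Num.conj (g l t))) /\
  cexpectation P (fun t => g i t * Num.conj (g j t) * (g k t * Num.conj (g l t))) =
  ((i == j) && (k == l))%:R + ((i == l) && (j == k))%:R
  + (rho ^+ 2)%:C * ((i == k) && (j == l))%:R
  + excess i * [&& i == j, j == k & k == l]%:R.
Proof.
split; first exact: (h_int4 false true false true).
have sqrE x : cexpectation P (fun t => Num.conj (g x t) * Num.conj (g x t)) = rho%:C.
  rewrite -(g_sqr x) (eq_cexpectation _ (_ : _ =1 (fun t => Num.conj (g x t * g x t)))).
    rewrite cexpectation_conj; last exact: (h_int2 false false).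
    by rewrite g_sqr; apply: complexP; rewrite ?Re_conjc ?Im_conjc //= oppr0.
  by move=> t; rewrite rmorphM.
have [eij|ij] := eqVneq i j; last first.
  have [eik|ik] := eqVneq i k.
    have [ejl|jl] := eqVneq j l.
      rewrite -eik -ejl (negPf ij) eq_sym (negPf ij) /= !(mulr0, addr0, add0r) mulr1.
      rewrite (eq_cexpectation _ (_ : _ =1 (fun t => h false i t * h false i t *
        (h true j t * h true j t)))); last by move=> t; rewrite /h /=; ring.
      by rewrite pair // /h /= g_sqr sqrE -rmorphM expr2.
    rewrite -eik ?(eq_sym j i) ?(negPf ij) /= ?(andbF, mulr0, addr0).
    rewrite (eq_cexpectation _ (_ : _ =1 (fun t => h true j t * (h false i t *
        (h false i t * h true l t))))); last by move=> t; rewrite /h /=; ring.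
    by apply: single => //; rewrite eq_sym.
  have [eil|il] := eqVneq i l.
    have [ejk|jk] := eqVneq j k.
      rewrite -eil -ejk ?(negPf ij) /= ?(mulr0, addr0, add0r) /=.
      rewrite (eq_cexpectation _ (_ : _ =1 (fun t => h false i t * h true i t *
        (h false j t * h true j t)))); last by move=> t; rewrite /h /=; ring.
      by rewrite pair // /h /= !g_var mulr1.
    rewrite ?(negPf ij) /= ?(mulr0, addr0, add0r).
    rewrite (eq_cexpectation _ (_ : _ =1 (fun t => h true j t * (h false i t *
        (h false k t * h true l t))))); last by move=> t; rewrite /h /=; ring.
    by apply: single => //; rewrite -?eil eq_sym.
  rewrite /= !(mulr0, addr0, add0r).
  rewrite (eq_cexpectation _ (_ : _ =1 (fun t => h false i t * (h true j t *
        (h false k t * h true l t))))); last by move=> t; rewrite /h /=; ring.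
  exact: single.
rewrite -eij /=; have [ekl|kl] := eqVneq k l.
  rewrite -ekl; have [eik|ik] := eqVneq i k.
    by rewrite -eik /= /excess !mulr1; ring.
  rewrite /= ?(mulr0, addr0); transitivity (1 * 1 : R[i]); last by rewrite mulr1.
  by rewrite -{1}(g_var i) -(g_var k); exact: (pair false true false true).
rewrite /=; have [eik|ik] := eqVneq i k.
  rewrite -eik in kl *; rewrite ?(negPf kl) /= ?(mulr0, addr0).
  rewrite (eq_cexpectation _ (_ : _ =1 (fun t => h true l t * (h false i t *
        (h true i t * h false i t))))); last by move=> t; rewrite /h /=; ring.
  by apply: single; rewrite eq_sym.
rewrite /= andbF !(mulr0, addr0).
rewrite (eq_cexpectation _ (_ : _ =1 (fun t => h false k t * (h false i t *
        (h true i t * h true l t))))); last by move=> t; rewrite /h /=; ring.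
by apply: single => //; rewrite eq_sym.
Qed.

Lemma normc_excess_le i : normc (excess i) <= 4 + rho ^+ 2 + C8.
Proof.
rewrite /excess; set F := fun t => _.
have F4 t : F t = (normc (g i t) ^+ 4)%:C.
  by rewrite /F mul_conjc -rmorphM /= -expr2 -exprM.
have E4 : cexpectation P F = (\int[P]_t (normc (g i t) ^+ 4))%:C.
  apply: complexP; rewrite /cexpectation /=; under eq_Rintegral do rewrite F4 /=.
    by [].
  exact: Rintegral_prob_cst.
have i4 : rintegrable P (fun t => normc (g i t) ^+ 4).
  have [+ _] := h_int4 false true false true i i i i.
  by congr rintegrable; apply/funext => t; rewrite -/(F t) F4.
have ge4 : 0 <= \int[P]_t (normc (g i t) ^+ 4).
  by apply: Rintegral_ge0 => t _; rewrite exprn_ge0 // normc_ge0.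
have le4 : \int[P]_t (normc (g i t) ^+ 4) <= 1 + C8.
  rewrite (le_trans _ (_ : \int[P]_t (1 + normc (g i t) ^+ 8) <= _)) //; last first.
    rewrite (RintegralD measurableT (rintegrable_cst P 1) (g_int8 i)).
    by rewrite Rintegral_prob_cst lerD2l.
  apply: le_Rintegral => //.
    by apply: rintegrableD => //; exact: rintegrable_cst.
  move=> t _; have -> : normc (g i t) ^+ 8 = (normc (g i t) ^+ 4) ^+ 2 by rewrite -exprM.
  by set y := _ ^+ 4; have := sqr_ge0 (y - 1); nra.
rewrite E4 -[2]/(2%:R) (_ : 2%:R = (2%:R : R)%:C); last by rewrite rmorph_nat.
rewrite -!rmorphB normc_real ler_norml.
by apply/andP; split; have := sqr_ge0 rho; lra.
Qed.

End independent_entries.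

(** * Partial transposes of rank one matrices *)

Section partial_transpose_rank_one.
Context (R : realType) (d : nat).
Notation idx := (@mxtens_index d d).

(** Block index of [a], inner index of [b]. Partial transposition is the relabelling of index pairs
    that sends [(a, b)] to [(mixed a b, mixed b a)]. *)
Definition mixed (a b : 'I_(d ^ 2)) : 'I_(d ^ 2) :=
  idx ((mxtens_unindex a).1, (mxtens_unindex b).2).

Lemma mixed_eq a b c e : (mixed a b == mixed c e) =
  ((mxtens_unindex a).1 == (mxtens_unindex c).1) &&
  ((mxtens_unindex b).2 == (mxtens_unindex e).2).
Proof. by rewrite /mixed (can_eq (@mxtens_indexK _ _)) xpair_eqE. Qed.

Lemma unindex_eq (a b : 'I_(d ^ 2)) : (a == b) =
  ((mxtens_unindex a).1 == (mxtens_unindex b).1) &&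
  ((mxtens_unindex a).2 == (mxtens_unindex b).2).
Proof.
rewrite -(can_eq (@mxtens_unindexK d d)).
by case: (mxtens_unindex a) (mxtens_unindex b) => [? ?] [? ?].
Qed.

Definition rank1pt (g : 'I_(d ^ 2) -> R[i]) : 'M[R[i]]_(d ^ 2) :=
  \matrix_(a, b) (g (mixed a b) * Num.conj (g (mixed b a))).

Lemma partial_transpose_mixed (A : 'M[R[i]]_(d ^ 2)) a b :
  partial_transpose A a b = A (mixed a b) (mixed b a).
Proof.
by rewrite mxE /mixed; case: (mxtens_unindex a) (mxtens_unindex b) => [? ?] [? ?].
Qed.

Lemma partial_transpose_gram p (G : 'M[R[i]]_(d ^ 2, p)) (c : R[i]) :
  partial_transpose (c *: (G *m G ^t*)) = c *: \sum_s rank1pt (fun a => G a s).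
Proof.
apply/matrixP => a b; rewrite partial_transpose_mixed [RHS]mxE summxE !mxE.
by congr (_ * _); apply: eq_bigr => s _; rewrite !mxE.
Qed.

Lemma rank1pt_herm g : (rank1pt g) ^t* = rank1pt g.
Proof.
by apply/matrixP => a b; rewrite !mxE rmorphM /= conjCK mulrC.
Qed.

Lemma sum_unindex (V : nmodType) (F : 'I_(d ^ 2) -> V) :
  \sum_a F a = \sum_i \sum_k F (idx (i, k)).
Proof.
rewrite pair_bigA /= (reindex (idx : 'I_d * 'I_d -> 'I_(d ^ 2))) /=.
  by apply: eq_bigr => -[].
exists (@mxtens_unindex d d) => x _; [exact: mxtens_indexK|exact: mxtens_unindexK].
Qed.

(** Partial transposition permutes the entries, so the Frobenius norm is that of the rank one matrix
    before transposition. *)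
Lemma frob_rank1pt g : frob (rank1pt g) = \sum_a normc (g a) ^+ 2.
Proof.
have q0 : 0 <= \sum_a normc (g a) ^+ 2 by apply: sumr_ge0 => a _; apply: sqr_ge0.
apply: (@pexpIrn _ 2); rewrite ?nnegrE ?frob_ge0 // sqr_frob_pair expr2 big_distrlr /=.
rewrite pair_bigA /= [RHS](reindex_inj (h := fun ab => (mixed ab.1 ab.2, mixed ab.2 ab.1))) /=.
  by apply: eq_bigr => -[a b] _ /=; rewrite mxE normcM normc_conj exprMn.
move=> [a b] [c e] /eqP; rewrite xpair_eqE !mixed_eq => /andP[].
move=> /andP[/eqP h1 /eqP h2] /andP[/eqP h3 /eqP h4].
by congr pair; apply/eqP; rewrite unindex_eq ?h1 ?h2 ?h3 ?h4 !eqxx.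
Qed.

Definition reshape (g : 'I_(d ^ 2) -> R[i]) : 'M[R[i]]_d := \matrix_(i, k) g (idx (i, k)).

Lemma frob_gramC m n (M : 'M[R[i]]_(m, n)) : frob (M ^t* *m M) = frob (M *m M ^t*).
Proof.
apply: (@pexpIrn _ 2); rewrite ?nnegrE ?frob_ge0 //.
apply: (@complexI R); rewrite -!mxtrace_trCM !trmx_mul !map_mxM.
have -> : (M ^t*)^T ^ (Num.conj) = M by exact: trmxCK.
by rewrite mxtrace_mulC -!mulmxA mxtrace_mulC -!mulmxA.
Qed.

(* A column of [B], read as a d x d matrix [V], is sent to [M V^T conj(M)]. *)
Lemma frob_rank1ptM m g (B : 'M[R[i]]_(d ^ 2, m)) :
  frob (rank1pt g *m B) <= frob (reshape g *m (reshape g) ^t*) * frob B.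
Proof.
set M := reshape g; set k := frob (M *m _).
pose V (c : 'I_m) : 'M[R[i]]_d := \matrix_(j, l) B (idx (j, l)) c.
pose U (c : 'I_m) := M *m ((V c)^T *m (M ^t*)^T).
have UE c i k' : (rank1pt g *m B) (idx (i, k')) c = U c i k'.
  rewrite [LHS]mxE sum_unindex exchange_big /= [RHS]mxE; apply: eq_bigr => l _.
  rewrite [X in _ = _ * X]mxE mulr_sumr; apply: eq_bigr => j _.
  rewrite !mxE /mixed !mxtens_indexK /=; ring.
have frobE n' (A : 'M[R[i]]_(d ^ 2, n')) (A' : 'I_n' -> 'M[R[i]]_d) :
    (forall c i l, A (idx (i, l)) c = A' c i l) ->
    frob A ^+ 2 = \sum_c frob (A' c) ^+ 2.
  move=> AE; rewrite sqr_frob exchange_big /=; apply: eq_bigr => c _.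
  rewrite sum_unindex sqr_frob.
  by apply: eq_bigr => i _; apply: eq_bigr => l _; rewrite AE.
(* Each multiplication by [M] costs the square root of [k]: the norm of [M] as an operator is
   controlled through its Gram matrix, once on the left and once, after transposing, on the
   right. *)
have UV c : frob (U c) ^+ 2 <= k ^+ 2 * frob (V c) ^+ 2.
  apply: le_trans (sqr_frobM_le _ _) _.
  rewrite frob_gramC -/k (expr2 k) -mulrA ler_wpM2l ?frob_ge0 //.
  rewrite -frob_tr trmx_mul !trmxK; apply: le_trans (sqr_frobM_le _ _) _.
  by rewrite trmxCK.
apply: ler_of_sqr; first by rewrite mulr_ge0 ?frob_ge0.
rewrite exprMn (frobE _ _ _ UE) (frobE _ B V) => [|c i l]; last by rewrite mxE.
by rewrite mulr_sumr; apply: ler_sum => c _.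
Qed.

Lemma sqr_frob_gram m n (M : 'M[R[i]]_(m, n)) :
  (frob (M *m M ^t*) ^+ 2)%:C =
  \sum_i \sum_j \sum_k \sum_l M i k * Num.conj (M j k) * (M j l * Num.conj (M i l)).
Proof.
rewrite sqr_frob rmorph_sum; apply: eq_bigr => i _; rewrite rmorph_sum.
apply: eq_bigr => j _; rewrite /= -mul_conjc mxE rmorph_sum big_distrlr /=.
apply: eq_bigr => k _; apply: eq_bigr => l _.
by rewrite !mxE rmorphM /= conjCK [Num.conj (M i l) * _]mulrC.
Qed.

End partial_transpose_rank_one.

(** * The self-consistent equation *)

Section self_consistent_error.
Variable R : realType.

(** Here [pinv] stands for a bound on [n / p], [b] for [1 / Im z], which bounds the resolvent and
    its normalized trace, and [w] for [|z|]. The local [k] is the constant in the bound on the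
    change of [m] when one column is removed. *)
Definition error_constant (pinv b w : R) : R :=
  let k := pinv + pinv ^+ 2 * b ^+ 3 in
  (w + 2 * pinv * b) * (b * k + pinv * b ^+ 2 * k)
  + (1 + w * b + pinv * b ^+ 2) * (pinv ^+ 2 * b ^+ 3 + 2 * pinv * b * k).

Lemma error_constant_ge0 (pinv b w : R) : 0 <= pinv -> 0 <= b -> 0 <= w ->
  0 <= error_constant pinv b w.
Proof.
move=> p0 b0 w0; rewrite /error_constant.
by repeat (apply: addr_ge0 || apply: mulr_ge0 || apply: exprn_ge0) => //.
Qed.

(* [r = d^(-1/2)]; [x], [u], [k] are the sizes of [|Z|_F / d^2], [|tr (Z A^2)| / d]
   and [|Z|_op / d^(3/2)], all of order one. *)
Lemma error_bound (P b w r x u k dl c : R) :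
  0 <= P -> 0 <= b -> 0 <= w -> 0 < r <= 1 -> 0 <= x -> 0 <= u -> 0 <= k ->
  0 <= c <= P -> 0 <= dl <= r ^+ 4 * (P * u + P ^+ 2 * b ^+ 3 * x ^+ 2) ->
  dl * (w + 2 * c * b) * (b * x * r ^- 2 + c * b ^+ 2)
  + (1 + w * b + c * b ^+ 2) * (r * P ^+ 2 * b ^+ 3 * k * x ^+ 2)
  + (1 + w * b + c * b ^+ 2) * c * dl * (2 * b)
  <= r * error_constant P b w * (1 + x ^+ 4 + u ^+ 2 + k ^+ 2).
Proof.
move=> P0 b0 w0 /andP[r0 r1] x0 u0 k0 /andP[c0 cP] /andP[dl0 dlle].
set S := 1 + _ + _ + _.
pose K := P + P ^+ 2 * b ^+ 3.
have PbK : 0 <= P ^+ 2 * b ^+ 3 by rewrite mulr_ge0 ?exprn_ge0.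
have K0 : 0 <= K by rewrite addr_ge0.
have x4 : x ^+ 4 = (x ^+ 2) ^+ 2 by ring.
have x20 := sqr_ge0 x; have u20 := sqr_ge0 u; have k20 := sqr_ge0 k.
(* These squares are the cases of [2 a b <= a ^ 2 + b ^ 2] after which every monomial in [x], [u],
   [k] met below is at most [S] by linear arithmetic. *)
have q1 : 0 <= x ^+ 4 - 2 * x ^+ 2 + 1.
  by rewrite (_ : _ + 1 = (x ^+ 2 - 1) ^+ 2) ?sqr_ge0 //; ring.
have q2 : 0 <= x ^+ 2 - 2 * (x * u) + u ^+ 2.
  by rewrite (_ : _ + u ^+ 2 = (x - u) ^+ 2) ?sqr_ge0 //; ring.
have q3 : 0 <= x ^+ 2 - 2 * (x * x ^+ 2) + x ^+ 4.
  by rewrite (_ : _ + x ^+ 4 = (x - x ^+ 2) ^+ 2) ?sqr_ge0 //; ring.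
have q4 : 0 <= k ^+ 2 - 2 * (k * x ^+ 2) + x ^+ 4.
  by rewrite (_ : _ + x ^+ 4 = (k - x ^+ 2) ^+ 2) ?sqr_ge0 //; ring.
have q5 : 0 <= u ^+ 2 - 2 * u + 1.
  by rewrite (_ : _ + 1 = (u - 1) ^+ 2) ?sqr_ge0 //; ring.
have x40 : 0 <= x ^+ 4 by rewrite exprn_ge0.
have [S1 uS x2S] : [/\ 1 <= S, u <= S & x ^+ 2 <= S].
  move: x20 u20 k20 x40 q1 q2 q3 q4 q5; rewrite /S; set X4 := x ^+ 4.
  by set X2 := x ^+ 2; set U2 := u ^+ 2; set K2 := k ^+ 2 => *; split; lra.
have [xuS x3S kxS] : [/\ x * u <= S, x * x ^+ 2 <= S & k * x ^+ 2 <= S].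
  move: x20 u20 k20 x40 q1 q2 q3 q4 q5; rewrite /S; set X4 := x ^+ 4.
  set X2 := x ^+ 2; set U2 := u ^+ 2; set K2 := k ^+ 2; set xu := x * u.
  by set x3 := x * X2; set kx := k * X2 => *; split; lra.
have S0 : 0 <= S by exact: le_trans S1.
have r20 : 0 < r ^+ 2 by rewrite exprn_gt0.
have r4r : r ^+ 4 <= r by rewrite ler_iXnr // ltW.
have r2r : r ^+ 2 <= r by rewrite ler_iXnr // ltW.
have dlS : dl <= r * (K * S).
  apply: le_trans dlle _; apply: ler_pM => //.
  - by rewrite exprn_ge0 // ltW.
  - by rewrite addr_ge0 ?mulr_ge0 ?exprn_ge0.
  - by rewrite mulrDl; apply: lerD; apply: ler_wpM2l.
(* The bound on the trace of [Z G] over [n] is of order [r ^- 2], so here the full smallness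
   [r ^+ 4] of [dl] is used; a factor [r ^+ 2] survives. *)
have dlxS : dl * (b * x * r ^- 2) <= r * (b * (K * S)).
  have e : r ^+ 4 * (P * u + P ^+ 2 * b ^+ 3 * x ^+ 2) * (b * x * r ^- 2) =
    r ^+ 2 * (b * (P * (x * u) + P ^+ 2 * b ^+ 3 * (x * x ^+ 2))).
    by field; rewrite gt_eqF.
  apply: (@le_trans _ _ (r ^+ 4 * (P * u + P ^+ 2 * b ^+ 3 * x ^+ 2) * (b * x * r ^- 2))).
    by apply: ler_wpM2r dlle; rewrite !mulr_ge0 // invr_ge0 ltW.
  rewrite e; apply: ler_pM => //.
  - exact: ltW.
  - by rewrite mulr_ge0 // addr_ge0 // mulr_ge0 // mulr_ge0.
  - rewrite ler_wpM2l // mulrDl; apply: lerD; exact: ler_wpM2l.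
have wc : w + 2 * c * b <= w + 2 * P * b by rewrite lerD2l ler_wpM2r // ler_wpM2l.
have wc0 : 0 <= w + 2 * c * b by rewrite addr_ge0 // !mulr_ge0.
have cb : c * b ^+ 2 <= P * b ^+ 2 by rewrite ler_wpM2r // sqr_ge0.
have cb0 : 0 <= c * b ^+ 2 by rewrite mulr_ge0 // sqr_ge0.
have Dc : 1 + w * b + c * b ^+ 2 <= 1 + w * b + P * b ^+ 2 by rewrite lerD2l.
have Dc0 : 0 <= 1 + w * b + c * b ^+ 2 by rewrite !addr_ge0 // mulr_ge0.
have rKS0 : 0 <= r * (K * S) by rewrite !mulr_ge0 // ltW.
have t1 : dl * (w + 2 * c * b) * (b * x * r ^- 2 + c * b ^+ 2) <=
    (w + 2 * P * b) * (r * (b * (K * S)) + P * b ^+ 2 * (r * (K * S))).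
  rewrite (mulrC dl) -(mulrA (w + 2 * c * b)); apply: ler_pM => //.
    by rewrite mulr_ge0 // addr_ge0 // !mulr_ge0 // invr_ge0 ltW.
  rewrite mulrDr; apply: lerD => //.
  by rewrite mulrC; apply: ler_pM.
have t2 : (1 + w * b + c * b ^+ 2) * (r * P ^+ 2 * b ^+ 3 * k * x ^+ 2) <=
    (1 + w * b + P * b ^+ 2) * (r * (P ^+ 2 * b ^+ 3) * S).
  apply: ler_pM => //.
    by rewrite !(mulr_ge0, exprn_ge0) // ltW.
  rewrite (_ : r * P ^+ 2 * b ^+ 3 * k * x ^+ 2 = r * (P ^+ 2 * b ^+ 3) * (k * x ^+ 2)).
    by rewrite ler_wpM2l // mulr_ge0 // ltW.
  ring.
have t3 : (1 + w * b + c * b ^+ 2) * c * dl * (2 * b) <=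
    (1 + w * b + P * b ^+ 2) * P * (r * (K * S)) * (2 * b).
  apply: ler_wpM2r; first by rewrite mulr_ge0.
  apply: ler_pM => //; first by rewrite mulr_ge0.
  exact: ler_pM.
apply: le_trans (lerD (lerD t1 t2) t3) _.
by rewrite /error_constant -/K le_eqVlt; apply/orP; left; apply/eqP; ring.
Qed.

End self_consistent_error.

(** * Expansion of the resolvent and removal of one column *)

Section neumann.
Variables (F : comPzRingType) (m : nat) (Z A G : 'M[F]_m) (q : F).
Hypothesis GE : G = A - q *: (A *m Z *m G).

Let expand2 (x y t : F) : x - q * (y - q * t) = x - q * y + q ^+ 2 * t.
Proof. by ring. Qed.

(** The resolvent identity is used twice. The last term keeps the full [G], so the expansion is
    exact and needs no convergence. *)
Lemma mxtrace_neumann_mul : \tr (Z *m G) = \tr (Z *m A) - q * \tr (Z *m A *m Z *m A)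
  + q ^+ 2 * \tr (Z *m (A *m Z) *m (A *m Z *m G)).
Proof.
have e1 : Z *m G = Z *m A - q *: (Z *m A *m Z *m G).
  by rewrite {1}GE mulmxBr -scalemxAr !mulmxA.
have e2 : Z *m A *m Z *m G = Z *m A *m Z *m A - q *: (Z *m (A *m Z) *m (A *m Z *m G)).
  by rewrite {1}GE mulmxBr -scalemxAr !mulmxA.
by rewrite e1 linearB /= mxtraceZ e2 linearB /= mxtraceZ expand2.
Qed.

Lemma mxtrace_neumann : \tr G = \tr A - q * \tr (Z *m (A *m A))
  + q ^+ 2 * \tr (A *m Z *m (A *m Z *m G)).
Proof.
have e2 : A *m Z *m G = A *m Z *m A - q *: (A *m Z *m (A *m Z *m G)).
  by rewrite {1}GE mulmxBr -scalemxAr !mulmxA.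
have e3 : \tr (A *m Z *m A) = \tr (Z *m (A *m A)).
  by rewrite -mulmxA mxtrace_mulC mulmxA.
by rewrite {1}GE linearB /= mxtraceZ [in LHS]e2 linearB /= mxtraceZ expand2 e3.
Qed.

End neumann.

Section leave_one_out.
Variables (R : realType) (d p : nat) (z : R[i]).
Hypotheses (d_gt0 : (0 < d)%N) (p_gt0 : (0 < p)%N) (z_gt0 : 0 < complex.Im z).
Notation n := (d ^ 2)%N.
Notation nC := (n%:R : R[i]).
Notation pC := (p%:R : R[i]).

Lemma normc_nat (k : nat) : normc (k%:R : R[i]) = k%:R.
Proof. by rewrite -(rmorph_nat (real_complex R)) normc_real ger0_norm. Qed.

Lemma normcV (x : R[i]) : normc x^-1 = (normc x)^-1.
Proof. exact: Normc.normcV. Qed.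

Definition stieltjes (m : nat) (H : 'M[R[i]]_m) (y : R[i]) : R[i] :=
  m%:R^-1 * \tr (resolvent H y).

(* Vanishes when [stieltjes H y] is the Stieltjes transform at [y] of the centered
   semicircle law of variance [v]. *)
Definition defect (m : nat) (v : R) (H : 'M[R[i]]_m) (y : R[i]) : R[i] :=
  1 + y * stieltjes H y + v%:C * stieltjes H y ^+ 2.

(** The comparison between the full resolvent and the one without [Z], with all traces replaced by
    arbitrary scalars subject to the norm bounds: only commutative algebra remains. *)
Lemma leave_one_out_scalar (P kap X : R) (tZG tZA tZAZA tA tG t3 s2 s1 : R[i]) :
  0 <= kap -> n%:R / p%:R <= P ->
  let b := (complex.Im z)^-1 in
  let w := normc z in
  let r := (Num.sqrt d%:R)^-1 in
  let c := n%:R / p%:R in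
  let m := nC^-1 * tG in
  let m0 := nC^-1 * tA in
  let D := 1 + z * m + c%:C * m ^+ 2 in
  let D0 := 1 + z * m0 + c%:C * m0 ^+ 2 in
  normc m <= b -> normc m0 <= b -> normc D0 <= 1 + w * b + c * b ^+ 2 ->
  tZG = tZA - pC^-1 * tZAZA + pC^-1 ^+ 2 * t3 ->
  tG = tA - pC^-1 * s1 + pC^-1 ^+ 2 * s2 ->
  normc t3 <= kap * b ^+ 3 * X ^+ 2 -> normc s2 <= b ^+ 3 * X ^+ 2 ->
  normc tZG <= b * X * d%:R -> 0 <= b -> 0 <= X ->
  is_true (complex.Re (Num.conj D * (nC^-1 * tZG + c%:C * m ^+ 2)) <=
    complex.Re (Num.conj D0 * (nC^-1 * tZA))
    - complex.Re (Num.conj D0 * ((pC * nC)^-1 * (tZAZA - tA ^+ 2)))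
    + r * error_constant P b w *
      (1 + (X / d%:R ^+ 2) ^+ 4 + (normc s1 / d%:R) ^+ 2 + (kap * r ^+ 3) ^+ 2)).
Proof.
move=> kap_ge0 P_ge b w r c m m0 D D0 mb m0b D0b trZG trG t3_le s2_le tG_le b0 X0.
have dR : 0 < d%:R :> R by rewrite ltr0n.
have pR : 0 < p%:R :> R by rewrite ltr0n.
have nR : 0 < n%:R :> R by rewrite ltr0n expn_gt0 d_gt0.
have pCn0 : pC != 0 by rewrite pnatr_eq0 -lt0n.
have nCn0 : nC != 0 by rewrite pnatr_eq0 -lt0n expn_gt0 d_gt0.
have r0 : 0 < r by rewrite invr_gt0 sqrtr_gt0.
have r2 : r ^+ 2 = d%:R^-1 by rewrite exprVn sqr_sqrtr.
have r1 : r <= 1.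
  by rewrite invf_le1 ?sqrtr_gt0 // -[leLHS]sqrtr1 ler_wsqrtr ?ler1n.
have c0 : 0 <= c by rewrite divr_ge0.
have P0 : 0 <= P by exact: le_trans P_ge.
have w0 : 0 <= w by exact: normc_ge0.
have cC : c%:C = nC / pC by rewrite rmorphM /= fmorphV !rmorph_nat.
pose T := nC^-1 * tZG.
pose dm := m - m0.
(* The three errors: [E1] replaces the weight [D] by [D0], [E2] is the third-order term of the
   expansion, [E3] replaces [m] by [m0] in the quadratic term. *)
pose E1 := Num.conj (D - D0) * (T + c%:C * m ^+ 2).
pose E2 := Num.conj D0 * ((pC ^+ 2 * nC)^-1 * t3).
pose E3 := Num.conj D0 * (c%:C * dm * (m + m0)).
have key : Num.conj D * (T + c%:C * m ^+ 2) = Num.conj D0 * (nC^-1 * tZA)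
  - Num.conj D0 * ((pC * nC)^-1 * (tZAZA - tA ^+ 2)) + (E1 + E2 + E3).
  (* With [c = n / p], [c m0 ^ 2] equals [(p n)^-1] times the square of the trace of [A]: it is
     subtracted from the second-order term so that only a centered quantity is left there. *)
  have e : T + c%:C * m0 ^+ 2 = nC^-1 * tZA - (pC * nC)^-1 * (tZAZA - tA ^+ 2)
      + (pC ^+ 2 * nC)^-1 * t3.
    rewrite /T trZG /m0 cC; move: nCn0 pCn0.
    by move: (nC) (pC) => nn pp nn0 pp0; field; rewrite nn0 pp0.
  have qE : T + c%:C * m ^+ 2 = nC^-1 * tZA - (pC * nC)^-1 * (tZAZA - tA ^+ 2)
      + (pC ^+ 2 * nC)^-1 * t3 + c%:C * dm * (m + m0).
    by rewrite -e /dm; ring.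
  rewrite /E1 /E2 /E3.
  have -> : Num.conj D = Num.conj (D - D0) + Num.conj D0 by rewrite -rmorphD subrK.
  move: (Num.conj D0) (Num.conj (D - D0)) => y1 y2.
  by rewrite mulrDl [X in _ + X = _](congr1 (GRing.mul y1) qE); ring.
have ReB (x y u : R[i]) : complex.Re (x - y + u) <= complex.Re x - complex.Re y + normc u.
  by rewrite !Re_add Re_opp lerD2l Re_le_normc.
rewrite key; apply: le_trans (ReB _ _ _) _; rewrite lerD2l.
pose x := X / d%:R ^+ 2; pose u := normc s1 / d%:R.
pose k := kap * r ^+ 3; pose dl := normc dm.
have x0 : 0 <= x by rewrite divr_ge0 // exprn_ge0.
have u0 : 0 <= u by rewrite divr_ge0 // normc_ge0.
have k0 : 0 <= k by rewrite mulr_ge0 // exprn_ge0 // ltW.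
have rn0 : r != 0 by rewrite gt_eqF.
(* Everything is rewritten in powers of [r], with coefficients [x], [u], [k] of order one, to meet
   the form of [error_bound]. *)
have dE : d%:R = r ^- 2 by rewrite r2 invrK.
have nE : n%:R = r ^- 4 :> R by rewrite natrX dE; field.
have XE : X = x * r ^- 4 by rewrite /x dE; field.
have uE : normc s1 = u * r ^- 2 by rewrite /u dE; field.
have kE : kap = k * r ^- 3 by rewrite /k; field.
have pV : p%:R^-1 <= P * r ^+ 4.
  rewrite -ler_pdivrMr ?exprn_gt0 //; apply: le_trans P_ge.
  by rewrite nE mulrC.
have nV : normc (nC^-1) = r ^+ 4 by rewrite normcV normc_nat nE invrK.
have pV0 : 0 <= p%:R^-1 :> R by rewrite invr_ge0 ltW.
have r40 : 0 <= r ^+ 4 by rewrite exprn_ge0 // ltW.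
have pV2 : (p%:R^-1) ^+ 2 <= P ^+ 2 * r ^+ 8.
  have -> : P ^+ 2 * r ^+ 8 = (P * r ^+ 4) ^+ 2 by rewrite exprMn -exprM.
  by apply: lerXn2r => //; rewrite nnegrE; exact: mulr_ge0 P0 r40.
have dlle : dl <= r ^+ 4 * (P * u + P ^+ 2 * b ^+ 3 * x ^+ 2).
  have -> : dl = r ^+ 4 * normc (- (pC^-1 * s1) + pC^-1 ^+ 2 * s2).
    by rewrite -nV -normcM /dl /dm /m /m0 trG; congr normc; ring.
  rewrite ler_wpM2l //; apply: le_trans (normcD_le _ _) _.
  rewrite normcN !normcM normcV normc_nat -expr2; apply: lerD.
    rewrite uE; apply: (@le_trans _ _ (P * r ^+ 4 * (u * r ^- 2))).
      by rewrite ler_wpM2r // mulr_ge0 // invr_ge0 exprn_ge0 // ltW.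
    rewrite (_ : _ * _ = P * u * r ^+ 2); last by field.
    by apply: ler_piMr; [exact: mulr_ge0|apply: exprn_ile1 => //; exact: ltW].
  apply: (@le_trans _ _ (P ^+ 2 * r ^+ 8 * (b ^+ 3 * X ^+ 2))).
    by apply: ler_pM; rewrite ?sqr_ge0 ?normc_ge0.
  by rewrite XE le_eqVlt; apply/orP; left; apply/eqP; field.
have dl0 : 0 <= dl by exact: normc_ge0.
have cP : 0 <= c <= P by rewrite c0.
have dlb : 0 <= dl <= r ^+ 4 * (P * u + P ^+ 2 * b ^+ 3 * x ^+ 2) by rewrite dl0.
have r01 : 0 < r <= 1 by rewrite r0.
apply: le_trans (error_bound P0 b0 w0 r01 x0 u0 k0 cP dlb).
have mm0 : normc (m + m0) <= 2 * b.
  by apply: le_trans (normcD_le _ _) _; rewrite mulr_natl mulr2n lerD.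
have nc : normc c%:C = c by rewrite normc_real ger0_norm.
apply: le_trans (normcD_le _ _) _; apply: lerD; first apply: le_trans (normcD_le _ _) _; first apply: lerD.
- rewrite /E1 normcM normc_conj.
  have -> : D - D0 = dm * (z + c%:C * (m + m0)) by rewrite /D /D0 /dm; ring.
  rewrite normcM -/dl; apply: ler_pM.
  - by apply: mulr_ge0 => //; exact: normc_ge0.
  - exact: normc_ge0.
  - apply: ler_wpM2l => //; apply: le_trans (normcD_le _ _) _; rewrite lerD2l normcM nc.
    have -> : 2 * c * b = c * (2 * b) by ring.
    exact: ler_wpM2l.
  apply: le_trans (normcD_le _ _) _; apply: lerD.
    rewrite /T normcM nV; apply: (@le_trans _ _ (r ^+ 4 * (b * X * d%:R))).
      by rewrite ler_wpM2l.
    by rewrite XE dE le_eqVlt; apply/orP; left; apply/eqP; field.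
  rewrite normcM nc ler_wpM2l // !expr2 normcM; apply: ler_pM; rewrite ?normc_ge0 //.
- rewrite /E2 normcM normc_conj; apply: ler_pM; rewrite ?normc_ge0 //.
  rewrite invfM !normcM nV -exprVn expr2 normcM normcV normc_nat -expr2.
  apply: (@le_trans _ _ (P ^+ 2 * r ^+ 8 * r ^+ 4 * (kap * b ^+ 3 * X ^+ 2))).
    apply: ler_pM => //; [|exact: normc_ge0|exact: ler_wpM2r].
    by apply: mulr_ge0 => //; exact: sqr_ge0.
  by rewrite XE kE le_eqVlt; apply/orP; left; apply/eqP; field.
- rewrite /E3 normcM normc_conj -[leRHS]mulrA -[leRHS]mulrA; apply: ler_pM => //.
  - exact: normc_ge0.
  - exact: normc_ge0.
  - rewrite !normcM nc -/dl -(mulrA c); apply: ler_wpM2l => //.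
    exact: ler_wpM2l.
Qed.

Local Notation b := ((complex.Im z)^-1 : R).
Local Notation w := (normc z : R).
Local Notation r := ((Num.sqrt d%:R)^-1 : R).
Local Notation c := (n%:R / p%:R : R).

Let b0 : 0 <= b. Proof. by rewrite invr_ge0 ltW. Qed.
Let z0 : complex.Im z != 0. Proof. by rewrite gt_eqF. Qed.
Let zb : `|complex.Im z|^-1 = b. Proof. by rewrite ger0_norm // ltW. Qed.

Lemma sqrt_sqrn : Num.sqrt n%:R = d%:R :> R.
Proof. by rewrite natrX sqrtr_sqr ger0_norm. Qed.

Lemma normc_stieltjes_le (H : 'M[R[i]]_n) : H ^t* = H -> normc (stieltjes H z) <= b.
Proof.
move=> hH; rewrite /stieltjes normcM normcV normc_nat mulrC.
rewrite ler_pdivrMr ?ltr0n ?expn_gt0 ?d_gt0 // -zb.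
exact: normc_mxtrace_resolvent.
Qed.

Lemma normc_defect_le (v : R) (H : 'M[R[i]]_n) : 0 <= v -> H ^t* = H ->
  normc (defect v H z) <= 1 + w * b + v * b ^+ 2.
Proof.
move=> v0 hH; have mb := normc_stieltjes_le hH; have m0 := normc_ge0 (stieltjes H z).
apply: le_trans (normcD_le _ _) _; apply: lerD.
  apply: le_trans (normcD_le _ _) _; rewrite Normc.normc1 lerD2l normcM.
  by rewrite ler_wpM2l ?normc_ge0.
rewrite normcM normc_real ger0_norm // ler_wpM2l // expr2 normcM expr2.
exact: ler_pM.
Qed.

Variables (H Z : 'M[R[i]]_n).
Hypotheses (hH : H ^t* = H) (hZ : Z ^t* = Z).
Variables (kap P : R).
Hypotheses (kap_ge0 : 0 <= kap)
  (kapP : forall B : 'M[R[i]]_n, frob (Z *m B) <= kap * frob B)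
  (P_ge : c <= P).

Notation H0 := (H - pC^-1 *: Z).
Notation A := (resolvent H0 z).
Notation Gr := (resolvent H z).

Lemma hermitian_subZ : H0 ^t* = H0.
Proof.
rewrite linearB /= linearZ /= map_mxB map_mxZ hH hZ; congr (_ - _ *: _).
by rewrite /= fmorphV rmorph_nat.
Qed.

Let GrE : Gr = A - pC^-1 *: (A *m Z *m Gr).
Proof.
have e : H - H0 = pC^-1 *: Z by rewrite opprB addrC subrK.
by rewrite {1}(resolvent_sub hH hermitian_subZ z0) e -scalemxAr -scalemxAl.
Qed.

Let frobAl (B : 'M[R[i]]_n) : frob (A *m B) <= b * frob B.
Proof. by rewrite -zb; apply: frob_resolventMl => //; exact: hermitian_subZ. Qed.

Let frobGr (B : 'M[R[i]]_n) : frob (B *m Gr) <= b * frob B.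
Proof. by rewrite -zb; apply: frob_resolventMr. Qed.

Local Notation X := (frob Z).
Let X0 : 0 <= X. Proof. exact: frob_ge0. Qed.

Let frobAZG : frob (A *m Z *m Gr) <= b ^+ 2 * X.
Proof.
apply: le_trans (frobGr _) _; rewrite expr2 -mulrA ler_wpM2l //; exact: frobAl.
Qed.

(** One of the three factors [Z] is measured by the operator bound [kap] instead of the Frobenius
    norm [X]. With [X ^ 3] the term divided by [p ^ 2 n] would be of order one; with [kap X ^ 2] it
    is of order [d ^ (-1/2)]. *)
Let t3_le : normc (\tr (Z *m (A *m Z) *m (A *m Z *m Gr))) <= kap * b ^+ 3 * X ^+ 2.
Proof.
apply: le_trans (normc_mxtraceM_le _ _) _.
have -> : kap * b ^+ 3 * X ^+ 2 = (kap * (b * X)) * (b ^+ 2 * X) by ring.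
apply: ler_pM; rewrite ?frob_ge0 //.
by apply: le_trans (kapP _) _; rewrite ler_wpM2l //; exact: frobAl.
Qed.

Let s2_le : normc (\tr (A *m Z *m (A *m Z *m Gr))) <= b ^+ 3 * X ^+ 2.
Proof.
apply: le_trans (normc_mxtraceM_le _ _) _.
have -> : b ^+ 3 * X ^+ 2 = (b * X) * (b ^+ 2 * X) by ring.
by apply: ler_pM; rewrite ?frob_ge0 //; exact: frobAl.
Qed.

Let tG_le : normc (\tr (Z *m Gr)) <= b * X * d%:R.
Proof.
apply: le_trans (normc_mxtraceM_le _ _) _.
rewrite [leRHS]mulrAC [leRHS]mulrC ler_wpM2l // -sqrt_sqrn -zb.
exact: frob_resolvent.
Qed.

Lemma leave_one_out_bound :
  complex.Re (Num.conj (defect c H z) *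
    (nC^-1 * \tr (Z *m Gr) + c%:C * stieltjes H z ^+ 2)) <=
  complex.Re (Num.conj (defect c H0 z) * (nC^-1 * \tr (Z *m A)))
  - complex.Re (Num.conj (defect c H0 z) *
     ((pC * nC)^-1 * (\tr (Z *m A *m Z *m A) - (\tr A) ^+ 2)))
  + r * error_constant P b w *
    (1 + (X / d%:R ^+ 2) ^+ 4 + (normc (\tr (Z *m (A *m A))) / d%:R) ^+ 2
     + (kap * r ^+ 3) ^+ 2).
Proof.
have hH0 := hermitian_subZ.
have mb := normc_stieltjes_le hH; have m0b := normc_stieltjes_le hH0.
have c0 : 0 <= c by rewrite divr_ge0.
have D0b := normc_defect_le c0 hH0.
have trZG := mxtrace_neumann_mul GrE; have trG := mxtrace_neumann GrE.
move: mb m0b D0b trZG trG t3_le s2_le tG_le b0 X0.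
rewrite /defect /stieltjes.
move: (\tr (Z *m Gr)) (\tr (Z *m A)) (\tr (Z *m A *m Z *m A)) (\tr A) (\tr Gr)
  (\tr (Z *m (A *m Z) *m (A *m Z *m Gr))) (\tr (A *m Z *m (A *m Z *m Gr)))
  (\tr (Z *m (A *m A))) (frob Z) => tZG tZA tZAZA tA tG t3 s2 s1 X.
exact: leave_one_out_scalar.
Qed.

End leave_one_out.

Section complex_expectation_scale.
Context (disp : measure_display) (T : measurableType disp) (R : realType)
  (P : probability T R).
Implicit Types F : T -> R[i].

Lemma cintegrableZ (c : R[i]) F : cintegrable P F -> cintegrable P (fun t => c * F t).
Proof.
move=> [rF jF]; split.
  under eq_fun do rewrite Re_mul -mulNr.
  by apply: rintegrableD; apply: rintegrableZ.
under eq_fun do rewrite Im_mul.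
by apply: rintegrableD; apply: rintegrableZ.
Qed.

Lemma cexpectationZ (c : R[i]) F : cintegrable P F ->
  cexpectation P (fun t => c * F t) = c * cexpectation P F.
Proof.
move=> [rF jF]; apply: complexP; rewrite ?Re_mul ?Im_mul /cexpectation /=.
  under eq_Rintegral do rewrite Re_mul -mulNr.
  rewrite RintegralD //; [|exact: rintegrableZ|exact: rintegrableZ].
  by rewrite !RintegralZl // mulNr.
under eq_Rintegral do rewrite Im_mul.
rewrite RintegralD //; [|exact: rintegrableZ|exact: rintegrableZ].
by rewrite !RintegralZl.
Qed.

End complex_expectation_scale.

(** * Covariance of the centered partial transposes *)

Section gaussian_columns.
Context (disp : measure_display) (T : measurableType disp) (R : realType)
  (P : probability T R) (kind : entry_kind) (d p : nat)
  (G : T -> 'M[R[i]]_(d ^ 2, p)).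
Hypothesis G_gauss : is_gaussian_matrix P kind G.
Local Notation n := (d ^ 2)%N.
Local Notation rho := (second_moment R kind).
Local Notation C8 := (eighth_moment_bound R kind).

Definition entry (x : 'I_n * 'I_p) (t : T) : R[i] := G t x.1 x.2.

Let std x := std_normal_moments (G_gauss.1 x.1 x.2).
Let e_meas x : cmeasurable (entry x). Proof. by have [] := std x. Qed.
Let e_int8 x : rintegrable P (fun t => normc (entry x t) ^+ 8).
Proof. by have [] := std x. Qed.
Let e_mean x : cexpectation P (entry x) = 0. Proof. by have [] := std x. Qed.
Let e_var x : cexpectation P (fun t => entry x t * Num.conj (entry x t)) = 1.
Proof. by have [] := std x. Qed.
Let e_sqr x : cexpectation P (fun t => entry x t * entry x t) = rho%:C.
Proof. by have [_ _ _ _ []] := std x. Qed.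
Let e_E8 x : \int[P]_t (normc (entry x t) ^+ 8) <= C8.
Proof. by have [_ _ _ _ []] := std x. Qed.
Let e_indep : mutually_independent P (re_im entry). Proof. exact: G_gauss.2. Qed.
Let e_reim x : measurable_fun setT (re_im entry x).
Proof. exact: measurable_re_im. Qed.

Lemma sqr_second_moment : rho ^+ 2 = rho.
Proof. by case: kind; rewrite /= ?expr1n ?expr0n. Qed.

Lemma second_moment_le1 : 0 <= rho <= 1.
Proof. by case: kind; rewrite /= ?lexx ?ler01. Qed.

Definition col_set (s : 'I_p) : {set 'I_n * 'I_p} := [set x | x.2 == s]%SET.
Definition other_cols (s : 'I_p) : {set 'I_n * 'I_p} := [set x | x.2 != s]%SET.

Lemma card_col_set s : #|col_set s| = n.
Proof.
have -> : col_set s = [set (a, s) | a in 'I_n]%SET.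
  apply/setP => -[a s']; rewrite inE /=; apply/eqP/imsetP => [->|[a' _ [_ ->]]] //.
  by exists a.
by rewrite card_imset ?card_ord // => a a' [].
Qed.

Definition ptcol (s : 'I_p) (t : T) : 'M[R[i]]_n := rank1pt (fun a => G t a s).
Definition Zcol (s : 'I_p) (t : T) : 'M[R[i]]_n := ptcol s t - 1%:M.

Lemma Zcol_herm s t : (Zcol s t) ^t* = Zcol s t.
Proof. by rewrite /Zcol linearB /= map_mxB rank1pt_herm trmx1 map_mx1. Qed.

Lemma ZcolE s t a b : Zcol s t a b =
  entry (mixed a b, s) t * Num.conj (entry (mixed b a, s) t) - (a == b)%:R.
Proof. by rewrite !mxE. Qed.

Lemma mxmeasurable_Zcol (J : {set 'I_n * 'I_p}) s : (forall a, (a, s) \in J) ->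
  mxmeasurable (Zcol s : sub_sigma (re_im entry) J -> _).
Proof.
move=> sJ a b; rewrite (_ : (fun t => _) = (fun t => entry (mixed a b, s) t *
  Num.conj (entry (mixed b a, s) t) + - (a == b)%:R)); last first.
  by apply/funext => t; rewrite ZcolE.
apply: cmeasurableD; last exact: cmeasurable_cst.
by apply: cmeasurableM; last apply: cmeasurable_conj; apply: cmeasurable_entry.
Qed.

Let mul2 := expectation_mul2 e_meas e_indep e_int8 e_mean e_var.
Let mul4 := expectation_mul4 e_meas e_indep e_int8 e_mean e_var e_sqr.

Let pair_eq (a b : 'I_n) (s : 'I_p) : ((a, s) == (b, s)) = (a == b).
Proof. by rewrite xpair_eqE eqxx andbT. Qed.

Let mixed_sym (a b : 'I_n) : (mixed a b == mixed b a) = (a == b).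
Proof. by rewrite mixed_eq unindex_eq; congr (_ && _); exact: eq_sym. Qed.

Let mixed_id (a : 'I_n) : mixed a a = a.
Proof. by apply/eqP; rewrite unindex_eq /mixed mxtens_indexK /= !eqxx. Qed.

Let mixed_pair (a b c e : 'I_n) : (mixed a b == mixed c e) && (mixed b a == mixed e c) =
  (a == c) && (b == e).
Proof.
rewrite !mixed_eq (unindex_eq a c) (unindex_eq b e).
by rewrite andbACA [X in _ && X]andbC andbACA.
Qed.

Lemma Zcol_mean s a b : cintegrable P (fun t => Zcol s t a b) /\
  cexpectation P (fun t => Zcol s t a b) = 0.
Proof.
have [i2 E2] := mul2 (mixed a b, s) (mixed b a, s).
rewrite (_ : (fun t => _) = (fun t => entry (mixed a b, s) t *
  Num.conj (entry (mixed b a, s) t) + - (a == b)%:R)); last first.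
  by apply/funext => t; rewrite ZcolE.
have ic := cintegrable_cst P (- (a == b)%:R).
split; first exact: cintegrableD.
rewrite cexpectationD // E2 cexpectation_cst pair_eq mixed_sym; exact: subrr.
Qed.

(* Up to the excess term, [Zcol s] has the covariance of a Gaussian Hermitian matrix
   (GUE if [rho = 0], GOE if [rho = 1]): this is why the limit is semicircular. *)
Lemma Zcol_cov s a b c e : cintegrable P (fun t => Zcol s t a b * Zcol s t c e) /\
  cexpectation P (fun t => Zcol s t a b * Zcol s t c e) =
  ((a == e) && (b == c))%:R + rho%:C * ((a == c) && (b == e))%:R
  + excess P entry rho (a, s) * [&& a == b, b == c & c == e]%:R.
Proof.
have [i4 E4] := mul4 (mixed a b, s) (mixed b a, s) (mixed c e, s) (mixed e c, s).
have [i1 E1] := mul2 (mixed a b, s) (mixed b a, s).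
have [i2 E2] := mul2 (mixed c e, s) (mixed e c, s).
move: E4 E1 E2; rewrite !pair_eq !mixed_sym sqr_second_moment => E4 E1 E2.
pose F1 t := entry (mixed a b, s) t * Num.conj (entry (mixed b a, s) t).
pose F2 t := entry (mixed c e, s) t * Num.conj (entry (mixed e c, s) t).
rewrite (_ : (fun t => _) = (fun t => F1 t * F2 t + ((- (c == e)%:R) * F1 t +
   ((- (a == b)%:R) * F2 t + (a == b)%:R * (c == e)%:R)))); last first.
  by apply/funext => t; rewrite !ZcolE /F1 /F2; ring.
have j1 := cintegrableZ (- (c == e)%:R) i1.
have j2 := cintegrableZ (- (a == b)%:R) i2.
have j3 := cintegrable_cst P ((a == b)%:R * (c == e)%:R).
have j23 := cintegrableD j2 j3; have j123 := cintegrableD j1 j23.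
split; first exact: cintegrableD.
rewrite cexpectationD // cexpectationD // cexpectationD // cexpectation_cst.
rewrite !cexpectationZ // E4 E1 E2 !mixed_pair.
(* On the diagonal [mixed a a = a], so the coincidence of all four indices of the entries becomes
   the coincidence of [a], [b], [c], [e]. *)
have -> : [&& a == b, mixed b a == mixed c e & c == e] = [&& a == b, b == c & c == e].
  have [->|//] := eqVneq a b; have [->|//] := eqVneq c e; last by rewrite !andbF.
  by rewrite /= !andbT mixed_eq unindex_eq.
have -> : excess P entry rho (mixed a b, s) * [&& a == b, b == c & c == e]%:R =
     excess P entry rho (a, s) * [&& a == b, b == c & c == e]%:R.
  by have [->|] := eqVneq a b; [rewrite mixed_id|rewrite !mulr0].
rewrite -mulnb natrM; ring.
Qed.

Lemma sum_delta (m : nat) (x : 'I_m) (F : 'I_m -> R[i]) :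
  \sum_y (x == y)%:R * F y = F x.
Proof.
rewrite (bigD1 x) //= eqxx mul1r big1 ?addr0 // => y yx.
by rewrite eq_sym (negPf yx) mul0r.
Qed.

Let col_other s (x : 'I_n * 'I_p) : x \in col_set s -> x \notin other_cols s.
Proof. by rewrite !inE negbK. Qed.

Let Z_meas s : mxmeasurable (Zcol s : sub_sigma (re_im entry) (col_set s) -> _).
Proof. by apply: mxmeasurable_Zcol => a; rewrite inE. Qed.

Let bounded_int (K : R) (F : T -> R[i]) : cmeasurable F ->
  (forall t, normc (F t) <= K) -> cintegrable P F.
Proof. by move=> mF FK; apply: cintegrable_le (rintegrable_cst P K) _. Qed.

Lemma Zcol_lin s (K : R) (W : 'I_n -> 'I_n -> T -> R[i]) :
  (forall a b, cmeasurable (W a b : sub_sigma (re_im entry) (other_cols s) -> R[i])) ->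
  (forall a b t, normc (W a b t) <= K) ->
  cintegrable P (fun t => \sum_a \sum_b Zcol s t a b * W a b t) /\
  cexpectation P (fun t => \sum_a \sum_b Zcol s t a b * W a b t) = 0.
Proof.
move=> mW WK.
have iW a b : cintegrable P (W a b).
  by apply: (bounded_int (K := K)) => //; apply: (cmeasurable_sub_sigma e_reim (mW a b)).
have ZW a b := cexpectation_mul e_reim e_indep (@col_other s) (@Z_meas s a b) (mW a b)
  (Zcol_mean s a b).1 (iW a b).
have iZW a : cintegrable P (fun t => \sum_b Zcol s t a b * W a b t).
  by apply: cintegrable_sum => b; exact: (ZW a b).1.
split; first exact: cintegrable_sum.
rewrite cexpectation_sum // big1 // => a _; rewrite cexpectation_sum; last first.
  by move=> b; exact: (ZW a b).1.
by rewrite big1 // => b _; rewrite (ZW a b).2 (Zcol_mean s a b).2 mul0r.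
Qed.

(** The weights depend on the other columns only, so integrating out column [s] replaces each
    product of two entries of [Zcol s] by its covariance, whose deltas collapse the four sums. For
    [W a b c e = A b c * A e a] the first surviving term sums to the square of the trace of [A]. *)
Lemma Zcol_quad s (K : R) (W : 'I_n -> 'I_n -> 'I_n -> 'I_n -> T -> R[i]) :
  (forall a b c e,
     cmeasurable (W a b c e : sub_sigma (re_im entry) (other_cols s) -> R[i])) ->
  (forall a b c e t, normc (W a b c e t) <= K) ->
  [/\ cintegrable P (fun t => \sum_a \sum_b \sum_c \sum_e
         Zcol s t a b * Zcol s t c e * W a b c e t),
     cintegrable P (fun t => \sum_a (\sum_b (W a b b a t + rho%:C * W a b a b t)
         + excess P entry rho (a, s) * W a a a a t)) &
     cexpectation P (fun t => \sum_a \sum_b \sum_c \sum_e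
         Zcol s t a b * Zcol s t c e * W a b c e t) =
     cexpectation P (fun t => \sum_a (\sum_b (W a b b a t + rho%:C * W a b a b t)
         + excess P entry rho (a, s) * W a a a a t))].
Proof.
move=> mW WK.
have iW a b c e : cintegrable P (W a b c e).
  by apply: (bounded_int (K := K)) => //; apply: (cmeasurable_sub_sigma e_reim (mW a b c e)).
have mZZ a b c e : cmeasurable ((fun t => Zcol s t a b * Zcol s t c e) :
    sub_sigma (re_im entry) (col_set s) -> R[i]).
  by apply: cmeasurableM; exact: Z_meas.
have ZW a b c e := cexpectation_mul e_reim e_indep (@col_other s) (mZZ a b c e)
  (mW a b c e) (Zcol_cov s a b c e).1 (iW a b c e).
have i1 a b c e := (ZW a b c e).1.
have i2 a b c := cintegrable_sum (index_enum _) xpredT (i1 a b c).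
have i3 a b := cintegrable_sum (index_enum _) xpredT (i2 a b).
have i4 a := cintegrable_sum (index_enum _) xpredT (i3 a).
have j1 a b : cintegrable P (fun t => W a b b a t + rho%:C * W a b a b t).
  by apply: cintegrableD => //; exact: cintegrableZ.
have j2 a := cintegrable_sum (index_enum _) xpredT (j1 a).
have j3 a := cintegrableD (j2 a) (cintegrableZ (excess P entry rho (a, s)) (iW a a a a)).
split; [exact: cintegrable_sum|exact: cintegrable_sum|].
rewrite cexpectation_sum // [RHS]cexpectation_sum //; apply: eq_bigr => a _.
rewrite cexpectation_sum // cexpectationD //; last exact: cintegrableZ.
(* The diagonal term is spread over [b] against a delta, which allows a comparison for fixed [a] and
   [b]. *)
rewrite cexpectationZ // cexpectation_sum // -[in RHS]
  (sum_delta a (fun b => excess P entry rho (a, s) * cexpectation P (W a b b b))).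
rewrite -big_split /=; apply: eq_bigr => b _.
rewrite cexpectation_sum // cexpectationD //; last exact: cintegrableZ.
rewrite cexpectationZ //.
under eq_bigr => c _ do
  (rewrite cexpectation_sum //; under eq_bigr => e _ do rewrite (ZW a b c e).2 (Zcol_cov s a b c e).2).
pose w c e := cexpectation P (W a b c e).
transitivity (\sum_c ((b == c)%:R * w c a + rho%:C * ((a == c)%:R * w c b)
   + (a == b)%:R * (excess P entry rho (a, s) * ((b == c)%:R * w c c)))).
  apply: eq_bigr => c _; rewrite -/(w c).
  rewrite -[w c a](sum_delta a (w c)) -[w c b](sum_delta b (w c)).
  rewrite -[w c c](sum_delta c (w c)) !mulr_sumr -!big_split /=.
  apply: eq_bigr => e _; rewrite -/(w c e) -!mulnb !natrM; ring.
rewrite !big_split /= sum_delta -mulr_sumr sum_delta -!mulr_sumr sum_delta.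
by rewrite /w; ring.
Qed.

End gaussian_columns.

Lemma mxtrace_mul2 (F : pzSemiRingType) m (Z A : 'M[F]_m) :
  \tr (Z *m A) = \sum_i \sum_j Z i j * A j i.
Proof. by apply: eq_bigr => i _; rewrite mxE. Qed.

Lemma mxtrace_mul4 (F : pzSemiRingType) m (Z A : 'M[F]_m) :
  \tr (Z *m A *m Z *m A) = \sum_i \sum_j \sum_k \sum_l Z i j * (A j k * (Z k l * A l i)).
Proof.
rewrite -!mulmxA mxtrace_mul2; apply: eq_bigr => i _; apply: eq_bigr => j _.
rewrite mxE mulr_sumr; apply: eq_bigr => k _.
by rewrite mxE !mulr_sumr.
Qed.

Lemma measurable_frob (dd : measure_display) (D : measurableType dd) (R : realType) m n
  (A : D -> 'M[R[i]]_(m, n)) : mxmeasurable A -> measurable_fun setT (fun t => frob (A t)).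
Proof.
move=> mA; apply: measurableT_comp.
  by apply: continuous_measurable_fun; exact: sqrt_continuous.
do 2!(apply: measurable_sum => ?).
by apply: measurable_funX; apply: measurable_normc.
Qed.

(** * Second moment of the defect *)

Section defect_second_moment.
Context (disp : measure_display) (T : measurableType disp) (R : realType)
  (P : probability T R) (kind : entry_kind) (d p : nat)
  (G : T -> 'M[R[i]]_(d ^ 2, p)) (z : R[i]) (Pb : R).
Hypotheses (G_gauss : is_gaussian_matrix P kind G)
  (d_gt0 : (0 < d)%N) (p_gt0 : (0 < p)%N) (z_gt0 : 0 < complex.Im z)
  (Pb_ge : (d ^ 2)%:R / p%:R <= Pb).
Local Notation n := (d ^ 2)%N.
Local Notation rho := (second_moment R kind).
Local Notation C8 := (eighth_moment_bound R kind).
Local Notation nC := (n%:R : R[i]).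
Local Notation pC := (p%:R : R[i]).
Local Notation b := ((complex.Im z)^-1 : R).
Local Notation w := (normc z : R).
Local Notation r := ((Num.sqrt d%:R)^-1 : R).
Local Notation c := (n%:R / p%:R : R).
Local Notation Z := (Zcol G).
Local Notation g := (entry G).
Local Notation ex s a := (excess P g rho (a, s)).

Definition Hmat (t : T) : 'M[R[i]]_n := pC^-1 *: \sum_s Z s t.

Lemma Hmat_herm t : (Hmat t) ^t* = Hmat t.
Proof.
rewrite /Hmat linearZ /= map_mxZ /= fmorphV rmorph_nat; congr (_ *: _).
rewrite linear_sum /= rmorph_sum /=.
by apply: eq_bigr => s _; exact: Zcol_herm.
Qed.

Local Notation H0 s t := (Hmat t - pC^-1 *: Z s t).
Local Notation A s t := (resolvent (H0 s t) z).

Let H0_herm s t : (H0 s t) ^t* = H0 s t.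
Proof. by apply: hermitian_subZ; [exact: Hmat_herm|exact: Zcol_herm]. Qed.

Let z0 : complex.Im z != 0. Proof. by rewrite gt_eqF. Qed.
Let b0 : 0 <= b. Proof. by rewrite invr_ge0 ltW. Qed.
Let zb : `|complex.Im z|^-1 = b. Proof. by rewrite ger0_norm // ltW. Qed.
Let dR : 0 < d%:R :> R. Proof. by rewrite ltr0n. Qed.
Let pR : 0 < p%:R :> R. Proof. by rewrite ltr0n. Qed.
Let nR : 0 < n%:R :> R. Proof. by rewrite ltr0n expn_gt0 d_gt0. Qed.
Let c0 : 0 <= c. Proof. by rewrite divr_ge0. Qed.
Let Pb0 : 0 <= Pb. Proof. exact: le_trans Pb_ge. Qed.
Let r_gt0 : 0 < r. Proof. by rewrite invr_gt0 sqrtr_gt0. Qed.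
Let r_sqr : r ^+ 2 = d%:R^-1. Proof. by rewrite exprVn sqr_sqrtr // ltW. Qed.
Let r_le1 : r <= 1.
Proof. by rewrite invf_le1 ?sqrtr_gt0 // -[leLHS]sqrtr1 ler_wsqrtr ?ler1n. Qed.

Let std x := std_normal_moments (G_gauss.1 x.1 x.2).
Let e_meas x : cmeasurable (g x). Proof. by have [] := std x. Qed.
Let e_int8 x : rintegrable P (fun t => normc (g x t) ^+ 8).
Proof. by have [] := std x. Qed.
Let e_E8 x : \int[P]_t (normc (g x t) ^+ 8) <= C8.
Proof. by have [_ _ _ _ []] := std x. Qed.
Let e_reim x : measurable_fun setT (re_im g x).
Proof. exact: measurable_re_im. Qed.

Lemma mxmeasurable_Hmat : mxmeasurable Hmat.
Proof.
move=> i j; apply: (cmeasurable_sub_sigma e_reim (J := [set: _]%SET)); move: i j.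
apply: mxmeasurableZ; apply: mxmeasurable_sum => s.
by apply: mxmeasurable_Zcol => a; rewrite inE.
Qed.

Let mxmeasurable_A s :
  mxmeasurable ((fun t => A s t) : sub_sigma (re_im g) (other_cols d s) -> _).
Proof.
apply: mxmeasurable_inv => [t|]; first exact: hermitian_shift_unit.
apply: mxmeasurableD; last exact: mxmeasurable_cst.
(* Written as the sum over the other columns, [H0] is visibly independent of column [s]. *)
rewrite (_ : (fun t => _) = (fun t => pC^-1 *: \sum_(s' | s' != s) Z s' t)); last first.
  by apply/funext => t; rewrite /Hmat (bigD1 s) //= scalerDr [LHS]addrC addKr.
apply: mxmeasurableZ => i j; under eq_fun do rewrite summxE big_mkcond /=.
apply: cmeasurable_sum => s'; case: (eqVneq s' s) => [_|s's] /=.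
  exact: cmeasurable_cst.
by apply: mxmeasurable_Zcol => a; rewrite inE.
Qed.

Let cmeasurable_D0 s : cmeasurable
  ((fun t => defect c (H0 s t) z) : sub_sigma (re_im g) (other_cols d s) -> R[i]).
Proof.
have mm : cmeasurable ((fun t => stieltjes (H0 s t) z) :
    sub_sigma (re_im g) (other_cols d s) -> R[i]).
  apply: cmeasurableM; first exact: cmeasurable_cst.
  by apply: cmeasurable_mxtrace; exact: mxmeasurable_A.
apply: cmeasurableD; last first.
  by apply: cmeasurableM; [exact: cmeasurable_cst|exact: cmeasurableM].
apply: cmeasurableD; first exact: cmeasurable_cst.
by apply: cmeasurableM; first exact: cmeasurable_cst.
Qed.

Local Notation D0 s t := (defect c (H0 s t) z).
Local Notation K0 := (1 + w * b + c * b ^+ 2).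

Let D0_le s t : normc (Num.conj (D0 s t)) <= K0.
Proof. by rewrite normc_conj; apply: normc_defect_le. Qed.

Let entry_le_frob (m m' : nat) (B : 'M[R[i]]_(m, m')) i j : normc (B i j) <= frob B.
Proof.
apply: ler_of_sqr (frob_ge0 _) _; rewrite sqr_frob (bigD1 i) //= (bigD1 j) //=.
by rewrite -addrA lerDl addr_ge0 // sumr_ge0 // => ? _; rewrite ?sqr_ge0 // sumr_ge0 // => ? _; rewrite sqr_ge0.
Qed.

Let A_frob s t : frob (A s t) <= b * d%:R.
Proof. by rewrite -zb -sqrt_sqrn; apply: frob_resolvent. Qed.

Let A_entry s t i j : normc (A s t i j) <= b * d%:R.
Proof. exact: le_trans (entry_le_frob _ _ _) (A_frob s t). Qed.

Let K0_ge0 : 0 <= K0.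
Proof. by rewrite !addr_ge0 // mulr_ge0 ?normc_ge0 ?sqr_ge0. Qed.

Lemma first_order s :
  let F t := Num.conj (D0 s t) * (nC^-1 * \tr (Z s t *m A s t)) in
  cintegrable P F /\ cexpectation P F = 0.
Proof.
pose W i j t := Num.conj (D0 s t) * (nC^-1 * A s t j i).
have mW i j : cmeasurable (W i j : sub_sigma (re_im g) (other_cols d s) -> R[i]).
  apply: cmeasurableM; first exact/cmeasurable_conj/cmeasurable_D0.
  by apply: cmeasurableM; [exact: cmeasurable_cst|exact: mxmeasurable_A].
have WK i j t : normc (W i j t) <= K0 * (normc nC^-1 * (b * d%:R)).
  rewrite !normcM; apply: ler_pM => //; rewrite ?mulr_ge0 ?normc_ge0 //.
  by rewrite ler_wpM2l ?normc_ge0.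
have [iZ EZ] := Zcol_lin G_gauss mW WK.
move=> F; have -> : F = (fun t => \sum_a \sum_b0 Z s t a b0 * W a b0 t) => //.
apply/funext => t; rewrite /F mxtrace_mul2 !mulr_sumr; apply: eq_bigr => i _.
rewrite !mulr_sumr; apply: eq_bigr => j _; rewrite /W.
move: (Num.conj _) (A s t j i) (Z s t i j) => *; ring.
Qed.

Local Notation exb := (5 + C8).

Let ex_le s a : normc (ex s a) <= exb.
Proof.
apply: le_trans (normc_excess_le rho e_meas e_int8 e_E8 (a, s)) _.
by have /andP[_] := second_moment_le1 R kind; rewrite sqr_second_moment; lra.
Qed.

Let normc_conjD0M s t (x : R[i]) : normc (Num.conj (D0 s t) * x) <= K0 * normc x.
Proof. by rewrite normcM ler_wpM2r ?normc_ge0. Qed.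

(* [W a b a b] and [W a a a a] only run over few of the entries, so both sums are
   controlled by Frobenius norms. *)
Let quad_err (s : 'I_p) (B C : 'M[R[i]]_n) :
  normc (\sum_a (\sum_b0 rho%:C * (B b0 a * C b0 a) + ex s a * (B a a * C a a)))
  <= (1 + exb) * (frob B * frob C).
Proof.
have /andP[rho0 rho1] := second_moment_le1 R kind.
have exb0 : 0 <= exb.
  have [a] : inhabited 'I_n by constructor; exists 0%N; rewrite expn_gt0 d_gt0.
  exact: le_trans (normc_ge0 _) (ex_le s a).
rewrite big_split /= mulrDl mul1r; apply: le_trans (normcD_le _ _) _; apply: lerD.
  apply: le_trans (normc_sum_le _ _ _) _; rewrite -(frob_tr B) -(frob_tr C).
  apply: le_trans (sum_normcM_le _ _); apply: ler_sum => a _.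
  apply: le_trans (normc_sum_le _ _ _) _; apply: ler_sum => b' _.
  rewrite !normcM normc_real ger0_norm // !mxE.
  by rewrite ler_piMl // mulr_ge0 ?normc_ge0.
apply: (@le_trans _ _ (exb * \sum_a \sum_b0 normc (B a b0) * normc (C a b0))).
  apply: le_trans (normc_sum_le _ _ _) _; rewrite mulr_sumr; apply: ler_sum => a _.
  rewrite !normcM (bigD1 a) //=; apply: ler_pM; rewrite ?mulr_ge0 ?normc_ge0 ?ex_le //.
  by rewrite lerDl sumr_ge0 // => b' _; rewrite mulr_ge0 ?normc_ge0.
by rewrite ler_wpM2l // sum_normcM_le.
Qed.

Let exb_ge0 : 0 <= exb.
Proof.
have a : 'I_n by exists 0%N; rewrite expn_gt0 d_gt0.
have s : 'I_p by exists 0%N.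
exact: le_trans (normc_ge0 _) (ex_le s a).
Qed.

Let split_quad (s : 'I_p) (W : 'I_n -> 'I_n -> 'I_n -> 'I_n -> T -> R[i]) t :
  \sum_a (\sum_b0 (W a b0 b0 a t + rho%:C * W a b0 a b0 t) + ex s a * W a a a a t) =
  \sum_a \sum_b0 W a b0 b0 a t +
  \sum_a (\sum_b0 rho%:C * W a b0 a b0 t + ex s a * W a a a a t).
Proof. by rewrite -big_split /=; apply: eq_bigr => a _; rewrite big_split /= addrA. Qed.

(** The main part of the expectation of the trace of [Z A Z A] is the square of the trace of [A] and
    cancels. The remaining contractions are at most a constant times [frob A ^ 2 <= b ^ 2 n], hence
    of order [1 / p] after division by [p n]. *)
Lemma second_order s :
  let F t := Num.conj (D0 s t) *
    ((pC * nC)^-1 * (\tr (Z s t *m A s t *m Z s t *m A s t) - \tr (A s t) ^+ 2)) in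
  cintegrable P F /\
  - complex.Re (cexpectation P F) <= K0 * (p%:R^-1 * ((1 + exb) * b ^+ 2)).
Proof.
pose W i j k l t := Num.conj (D0 s t) * ((pC * nC)^-1 * (A s t j k * A s t l i)).
have mW i j k l : cmeasurable (W i j k l : sub_sigma (re_im g) (other_cols d s) -> R[i]).
  apply: cmeasurableM; first exact/cmeasurable_conj/cmeasurable_D0.
  apply: cmeasurableM; first exact: cmeasurable_cst.
  by apply: cmeasurableM; exact: mxmeasurable_A.
have WK i j k l t : normc (W i j k l t) <=
    K0 * (normc (pC * nC)^-1 * ((b * d%:R) * (b * d%:R))).
  apply: le_trans (normc_conjD0M _ _ _) _; rewrite ler_wpM2l // !normcM.
  by rewrite ler_wpM2l ?mulr_ge0 ?normc_ge0 // ler_pM ?normc_ge0.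
have [iZ iW EZ] := Zcol_quad G_gauss mW WK.
move=> F.
pose Q t := Num.conj (D0 s t) * ((pC * nC)^-1 * \tr (A s t) ^+ 2).
have mQ : cmeasurable Q.
  apply: (cmeasurable_sub_sigma e_reim (J := other_cols d s)).
  apply: cmeasurableM; first exact/cmeasurable_conj/cmeasurable_D0.
  apply: cmeasurableM; first exact: cmeasurable_cst.
  have mt : cmeasurable ((fun t => \tr (A s t)) :
    sub_sigma (re_im g) (other_cols d s) -> R[i]).
    by apply: cmeasurable_mxtrace; exact: mxmeasurable_A.
  exact: cmeasurableM.
have QE t : Q t = \sum_a \sum_b0 W a b0 b0 a t.
  rewrite /Q /W expr2 big_distrlr /= !mulr_sumr exchange_big; apply: eq_bigr => i _.
  by rewrite !mulr_sumr; apply: eq_bigr => j _.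
have FE t : F t = (\sum_a \sum_b0 \sum_c0 \sum_e Z s t a b0 * Z s t c0 e * W a b0 c0 e t)
    + - Q t.
  rewrite /F /Q mulrBr mulrBr; congr (_ - _).
  rewrite mxtrace_mul4 !mulr_sumr; apply: eq_bigr => i _.
  rewrite !mulr_sumr; apply: eq_bigr => j _; rewrite !mulr_sumr; apply: eq_bigr => k _.
  rewrite !mulr_sumr; apply: eq_bigr => l _; rewrite /W.
  move: (Num.conj _) (A s t j k) (A s t l i) (Z s t i j) (Z s t k l) => *; ring.
have iQ : cintegrable P Q.
  apply: (cintegrable_le mQ (rintegrable_cst P
     (K0 * (normc (pC * nC)^-1 * ((b * n%:R) * (b * n%:R)))))) => t.
  apply: le_trans (normc_conjD0M _ _ _) _; rewrite ler_wpM2l // normcM expr2 normcM.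
  rewrite ler_wpM2l ?normc_ge0 //.
  by apply: ler_pM; rewrite ?normc_ge0 // -zb; apply: normc_mxtrace_resolvent.
rewrite (_ : F = (fun t => (\sum_a \sum_b0 \sum_c0 \sum_e
  Z s t a b0 * Z s t c0 e * W a b0 c0 e t) + - Q t)); last exact/funext.
split; first exact: cintegrableD iZ (cintegrableN iQ).
rewrite (cexpectationD iZ (cintegrableN iQ)) EZ.
rewrite -(cexpectationD iW (cintegrableN iQ)) -Re_opp.
rewrite -cexpectationN; last exact: cintegrableD iW (cintegrableN iQ).
rewrite -[leRHS](Rintegral_prob_cst P).
apply: Re_cexpectation_le; [exact/cintegrableN/(cintegrableD iW)/cintegrableN|exact: rintegrable_cst|].
move=> t; rewrite split_quad -QE addrAC subrr add0r.
apply: le_trans (Re_le_normc _) _; rewrite normcN.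
rewrite (_ : \sum_a _ = Num.conj (D0 s t) * ((pC * nC)^-1 *
  \sum_a (\sum_b0 rho%:C * (A s t b0 a * A s t b0 a) + ex s a * (A s t a a * A s t a a)))).
  apply: le_trans (normc_conjD0M _ _ _) _; rewrite ler_wpM2l // normcM.
  apply: (@le_trans _ _ (normc (pC * nC)^-1 * ((1 + exb) * ((b * d%:R) * (b * d%:R))))).
    rewrite ler_wpM2l ?normc_ge0 //; apply: le_trans (quad_err _ _ _) _.
    apply: ler_wpM2l; first exact: addr_ge0 ler01 exb_ge0.
    by apply: ler_pM; rewrite ?frob_ge0 ?A_frob.
  rewrite normcV normcM !normc_nat natrX; move: (complex.Im z)^-1 => bb.
  rewrite le_eqVlt; apply/orP; left; apply/eqP; field.
  by rewrite !gt_eqF.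
rewrite !mulr_sumr; apply: eq_bigr => a _; rewrite !mulrDr !mulr_sumr /W; congr (_ + _).
  by apply: eq_bigr => b' _; move: (Num.conj _) => D; ring.
by move: (Num.conj _) => D; ring.
Qed.

Local Notation trZAA s t := (\tr (Z s t *m (A s t *m A s t))).

(** The product of Frobenius norms would only bound this trace by a quantity of order [d ^ 3]. Since
    [Z_s] is centered with nearly uncorrelated entries and [A] is independent of it, the mean square
    is of the order of [frob (A ^ 2) ^ 2], so the trace is of order [d]. *)
Lemma linear_variance s : rintegrable P (fun t => normc (trZAA s t) ^+ 2) /\
  \int[P]_t (normc (trZAA s t) ^+ 2) <= (2 + exb) * (b ^+ 4 * d%:R ^+ 2).
Proof.
pose B t := A s t *m A s t.
have mB : mxmeasurable (B : sub_sigma (re_im g) (other_cols d s) -> _).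
  by apply: mxmeasurableM; exact: mxmeasurable_A.
have B_le t : frob (B t) <= b * (b * d%:R).
  rewrite -zb; apply: le_trans (frob_resolventMl _ (H0_herm s t) z0) _.
  by rewrite ler_wpM2l ?zb.
pose W i j k l t := B t j i * Num.conj (B t k l).
have mW i j k l : cmeasurable (W i j k l : sub_sigma (re_im g) (other_cols d s) -> R[i]).
  by apply: cmeasurableM; [exact: mB|apply: cmeasurable_conj; exact: mB].
have WK i j k l t : normc (W i j k l t) <= (b * (b * d%:R)) * (b * (b * d%:R)).
  rewrite normcM normc_conj; apply: ler_pM; rewrite ?normc_ge0 //;
  exact: le_trans (entry_le_frob _ _ _) (B_le t).
have [iZ iW EZ] := Zcol_quad G_gauss mW WK.
have uE t : (normc (trZAA s t) ^+ 2)%:C =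
   \sum_a \sum_b0 \sum_c0 \sum_e Z s t a b0 * Z s t c0 e * W a b0 c0 e t.
  rewrite -mul_conjc -/(B t).
  (* As [Z] is Hermitian, the conjugate of the trace is again linear in the unconjugated entries of
     [Z], and the squared modulus takes the form covered by [Zcol_quad]. *)
  have -> : Num.conj (\tr (Z s t *m B t)) = \sum_c0 \sum_e Z s t c0 e * Num.conj (B t c0 e).
    rewrite mxtrace_mul2 rmorph_sum [RHS]exchange_big; apply: eq_bigr => i _ /=.
    rewrite rmorph_sum; apply: eq_bigr => j _ /=; rewrite rmorphM /=.
    congr (_ * _); have /matrixP/(_ j i) := Zcol_herm G s t.
    by rewrite [X in X = _ -> _]mxE [X in Num.conj X = _ -> _]mxE.
  rewrite mxtrace_mul2 mulr_suml; apply: eq_bigr => i _.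
  rewrite mulr_suml; apply: eq_bigr => j _.
  rewrite mulr_sumr; apply: eq_bigr => k _; rewrite mulr_sumr; apply: eq_bigr => l _.
  rewrite /W; move: (Num.conj _) (B t j i) (Z s t i j) (Z s t k l) => *; ring.
have ReE t : normc (trZAA s t) ^+ 2 = complex.Re (\sum_a \sum_b0 \sum_c0 \sum_e
   Z s t a b0 * Z s t c0 e * W a b0 c0 e t) by rewrite -uE.
have [iR _] := iZ.
split; first by rewrite (funext ReE).
have := congr1 (@complex.Re R) EZ; rewrite {1}/cexpectation /=.
under eq_Rintegral do rewrite -ReE.
move=> ->; rewrite -[leRHS](Rintegral_prob_cst P).
apply: Re_cexpectation_le => //; first exact: rintegrable_cst.
move=> t; apply: le_trans (Re_le_normc _) _; rewrite split_quad.
apply: le_trans (normcD_le _ _) _.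
have f2 : frob (B t) * frob (B t) <= b ^+ 4 * d%:R ^+ 2.
  have -> : b ^+ 4 * d%:R ^+ 2 = (b * (b * d%:R)) * (b * (b * d%:R)) by ring.
  by apply: ler_pM; rewrite ?frob_ge0.
apply: (@le_trans _ _ ((2 + exb) * (frob (B t) * frob (B t)))); last first.
  apply: ler_wpM2l => //; exact: addr_ge0 (ler0n _ 2) exb_ge0.
rewrite (_ : 2 + exb = 1 + (1 + exb)); last by ring.
rewrite [leRHS]mulrDl mul1r; apply: lerD.
  rewrite /W; apply: le_trans (normc_sum_le _ _ _) _.
  rewrite -{1}(frob_tr (B t)) -{1}(frob_tr (B t)).
  apply: le_trans (sum_normcM_le _ _); apply: ler_sum => a _.
  apply: le_trans (normc_sum_le _ _ _) _; apply: ler_sum => b' _.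
  by rewrite normcM normc_conj !mxE.
have := quad_err s (B t) ((B t) ^t*); rewrite frob_trC.
apply: le_trans; rewrite le_eqVlt; apply/orP; left; apply/eqP; congr normc.
have CE i j : ((B t) ^t*) i j = Num.conj (B t j i) by rewrite mxE [X in Num.conj X]mxE.
apply: eq_bigr => a _; rewrite CE; congr (_ + _).
by apply: eq_bigr => b' _; rewrite CE.
Qed.

Let Z_measT s : mxmeasurable (Z s).
Proof.
move=> i j; apply: (cmeasurable_sub_sigma e_reim (J := [set: _]%SET)); move: i j.
by apply: mxmeasurable_Zcol => a; rewrite inE.
Qed.

Let sqnorm_col s t : sqnorm g (col_set d s) t = \sum_a normc (G t a s) ^+ 2.
Proof.
rewrite /sqnorm (eq_bigl (fun x : 'I_n * 'I_p => xpredT x.1 && (x.2 == s))); last first.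
  by move=> x; rewrite inE.
rewrite -(pair_big xpredT (fun s' => s' == s) (fun a s' => normc (G t a s') ^+ 2)) /=.
by apply: eq_bigr => a _; rewrite big_pred1_eq.
Qed.

Let pow4_add_le (x y : R) : (x + y) ^+ 4 <= 8 * (x ^+ 4 + y ^+ 4).
Proof.
have h2 (u v : R) : (u + v) ^+ 2 <= 2 * (u ^+ 2 + v ^+ 2).
  by rewrite -subr_ge0 (_ : _ - _ = (u - v) ^+ 2) ?sqr_ge0 //; ring.
rewrite -[4%N]/(2 * 2)%N !exprM.
apply: (@le_trans _ _ ((2 * (x ^+ 2 + y ^+ 2)) ^+ 2)).
  apply: lerXn2r => //; rewrite nnegrE ?sqr_ge0 //.
  by apply: mulr_ge0 => //; apply: addr_ge0; exact: sqr_ge0.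
rewrite exprMn (_ : 8 = 2 ^+ 2 * 2); last by ring.
by rewrite -mulrA ler_wpM2l.
Qed.

Local Notation xhat s t := (frob (Z s t) / d%:R ^+ 2).

(** The norm is at most the squared length of the column plus [d], the norm of the identity. Its
    fourth power is what makes eighth moments of the entries necessary. *)
Lemma frob_Zcol_moment s : rintegrable P (fun t => xhat s t ^+ 4) /\
  \int[P]_t (xhat s t ^+ 4) <= 8 * (C8 + 1).
Proof.
pose q t := sqnorm g (col_set d s) t.
have iq : rintegrable P (fun t => q t ^+ 4) by exact: rintegrable_sqnorm4.
have iB : rintegrable P (fun t => 8 * (d%:R ^- 8 * q t ^+ 4 + 1)).
  apply: rintegrableZ; apply: rintegrableD; last exact: rintegrable_cst.
  exact: rintegrableZ.
have le t : xhat s t ^+ 4 <= 8 * (d%:R ^- 8 * q t ^+ 4 + 1).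
  have fq : frob (Z s t) <= q t + d%:R.
    apply: le_trans (frobD _ _) _; rewrite frob_rank1pt /q sqnorm_col lerD2l.
    by rewrite -scaleN1r frobZ normcN Normc.normc1 mul1r frob_scalar1 sqrt_sqrn.
  rewrite expr_div_n ler_pdivrMr ?exprn_gt0 //.
  apply: (@le_trans _ _ ((q t + d%:R) ^+ 4)).
    apply: lerXn2r => //; rewrite nnegrE ?frob_ge0 //.
    by apply: addr_ge0 => //; exact: sqnorm_ge0.
  apply: le_trans (pow4_add_le _ _) _.
  rewrite -mulrA ler_wpM2l // mulrDl mul1r -exprM; apply: lerD.
    by rewrite mulrAC mulVf ?mul1r // expf_neq0 // gt_eqF.
  by apply: ler_weXn2l => //; rewrite ler1n.
have ix : rintegrable P (fun t => xhat s t ^+ 4).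
  apply: rintegrable_le iB _ => [|t].
    apply: measurable_funX; apply: measurable_funM => //.
    exact: measurable_frob.
  by rewrite ger0_norm // exprn_ge0 // divr_ge0 ?frob_ge0 ?exprn_ge0.
split=> //; apply: le_trans (le_Rintegral measurableT ix iB _) _ => //.
have iq' := rintegrableZ (d%:R ^- 8) iq.
rewrite RintegralZl //; last by apply: rintegrableD => //; exact: rintegrable_cst.
rewrite ler_wpM2l // (RintegralD measurableT iq' (rintegrable_cst P 1)).
rewrite Rintegral_prob_cst lerD2r RintegralZl //.
rewrite mulrC ler_pdivrMr ?exprn_gt0 //.
apply: le_trans (expectation_sqnorm4 e_meas e_int8 e_E8 _) _.
by rewrite card_col_set natrX -exprM mulrC.
Qed.

Local Notation M s t := (reshape (fun a => G t a s)).
Local Notation kap s t := (frob (M s t *m (M s t) ^t*) + 1).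

Lemma frob_ZcolM s t (B : 'M[R[i]]_n) : frob (Z s t *m B) <= kap s t * frob B.
Proof.
rewrite /Zcol mulmxBl mul1mx mulrDl mul1r; apply: le_trans (frobD _ _) _.
apply: lerD; first exact: frob_rank1ptM.
by rewrite -scaleN1r frobZ normcN Normc.normc1 mul1r.
Qed.

(** In the expansion of the squared norm of [M] times its adjoint over [i, j, k, l], only terms with
    [i = j] or [k = l] have nonzero expectation. There are of order [d ^ 3] of them, so the norm
    itself is of order [d ^ (3/2) = r ^- 3]. *)
Lemma kap_moment s : rintegrable P (fun t => (kap s t * r ^+ 3) ^+ 2) /\
  \int[P]_t ((kap s t * r ^+ 3) ^+ 2) <= 2 * (4 + exb).
Proof.
have [g_mean [g_var g_sqr]] : (forall x, cexpectation P (g x) = 0) /\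
   ((forall x, cexpectation P (fun t => g x t * Num.conj (g x t)) = 1) /\
    (forall x, cexpectation P (fun t => g x t * g x t) = rho%:C)).
  by split; [|split] => x; have [_ _ ? ? []] := std x.
have mul4 := expectation_mul4 e_meas (G_gauss.2 : mutually_independent P (re_im g))
  e_int8 g_mean g_var g_sqr.
pose ent (i k : 'I_d) : 'I_n * 'I_p := (mxtens_index (i, k), s).
have ent_eq i k j l : (ent i k == ent j l) = (i == j) && (k == l).
  by rewrite /ent xpair_eqE eqxx andbT (can_eq (@mxtens_indexK _ _)) xpair_eqE.
pose F i j k l t := g (ent i k) t * Num.conj (g (ent j k) t) *
   (g (ent j l) t * Num.conj (g (ent i l) t)).
have iF i j k l : cintegrable P (F i j k l) by exact: (mul4 _ _ _ _).1.
have EF i j k l : normc (cexpectation P (F i j k l)) <=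
    (i == j)%:R + (k == l)%:R + (1 + exb) * ((i == j)%:R * (k == l)%:R).
  rewrite (mul4 _ _ _ _).2 !ent_eq !eqxx /= !andbT.
  have /andP[rho0 rho1] := second_moment_le1 R kind.
  rewrite (eq_sym j i) sqr_second_moment !andbb.
  have -> : [&& i == j, k == l & i == j] = (i == j) && (k == l).
    by rewrite andbCA andbb andbC.
  rewrite -mulnb natrM.
  apply: le_trans (normcD_le _ _) _.
  have -> : (i == j)%:R + (k == l)%:R + (1 + exb) * ((i == j)%:R * (k == l)%:R) =
    (i == j)%:R + (k == l)%:R + (i == j)%:R * (k == l)%:R
    + exb * ((i == j)%:R * (k == l)%:R) by ring.
  apply: lerD.
    apply: le_trans (normcD_le _ _) _; apply: lerD.
      by apply: le_trans (normcD_le _ _) _; rewrite !normc_nat.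
    rewrite !normcM !normc_nat normc_real ger0_norm // ler_piMl // mulr_ge0 //.
  by rewrite !normcM !normc_nat ler_wpM2r ?mulr_ge0 ?ex_le.
pose f2 t := frob (M s t *m (M s t) ^t*) ^+ 2.
have f2E t : (f2 t)%:C = \sum_i \sum_j \sum_k \sum_l F i j k l t.
  rewrite /f2 sqr_frob_gram; do 4!(apply: eq_bigr => ? _).
  by rewrite !mxE.
have i1 i j k := cintegrable_sum (index_enum _) xpredT (iF i j k).
have i2 i j := cintegrable_sum (index_enum _) xpredT (i1 i j).
have i3 i := cintegrable_sum (index_enum _) xpredT (i2 i).
have i4 := cintegrable_sum (index_enum _) xpredT i3.
have f2R t : f2 t = complex.Re (\sum_i \sum_j \sum_k \sum_l F i j k l t).
  by rewrite -f2E.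
have if2 : rintegrable P f2 by rewrite (funext f2R); exact: i4.1.
have Ef2 : \int[P]_t f2 t <= (3 + exb) * d%:R ^+ 3.
  have -> : \int[P]_t f2 t = complex.Re (cexpectation P
      (fun t => \sum_i \sum_j \sum_k \sum_l F i j k l t)).
    by apply: eq_Rintegral => t _; rewrite f2R.
  rewrite cexpectation_sum //; apply: le_trans (Re_le_normc _) _.
  apply: le_trans (normc_sum_le _ _ _) _.
  apply: (@le_trans _ _ (\sum_(i < d) \sum_(j < d) \sum_(k < d) \sum_(l < d)
    ((i == j)%:R + (k == l)%:R + (1 + exb) * ((i == j)%:R * (k == l)%:R)))).
    apply: ler_sum => i _; rewrite cexpectation_sum //.
    apply: le_trans (normc_sum_le _ _ _) _; apply: ler_sum => j _.
    rewrite cexpectation_sum //; apply: le_trans (normc_sum_le _ _ _) _.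
    apply: ler_sum => k _; rewrite cexpectation_sum //.
    by apply: le_trans (normc_sum_le _ _ _) _; apply: ler_sum.
  have sd (x : 'I_d) : \sum_(y < d) (x == y)%:R = 1 :> R.
    rewrite (bigD1 x) //= eqxx big1 ?addr0 // => y yx.
    by rewrite eq_sym (negPf yx).
  have sc (x : R) : \sum_(y < d) x = x * d%:R.
    by rewrite sumr_const card_ord -[LHS]mulr_natr.
  have -> : \sum_(i < d) \sum_(j < d) \sum_(k < d) \sum_(l < d)
    ((i == j)%:R + (k == l)%:R + (1 + exb) * ((i == j)%:R * (k == l)%:R)) =
    (d%:R ^+ 2 + d%:R ^+ 2 + (1 + exb) * d%:R) * d%:R :> R.
    rewrite -sc; apply: eq_bigr => i _.
    transitivity (\sum_(j < d) ((i == j)%:R * (d%:R ^+ 2 + (1 + exb) * d%:R) + d%:R)).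
      apply: eq_bigr => j _; move: (i == j)%:R => x.
      transitivity (\sum_(k < d) (x * d%:R + 1 + (1 + exb) * x)).
        apply: eq_bigr => k _.
        by rewrite !big_split /= -!mulr_sumr sd mulr1 sc.
      by rewrite sc; move: exb => e; ring.
    by rewrite big_split /= -mulr_suml sd sc; move: exb => e; ring.
  have d1 : 1 <= d%:R :> R by rewrite ler1n.
  have -> : (3 + exb) * d%:R ^+ 3 =
     (d%:R ^+ 2 + d%:R ^+ 2 + (1 + exb) * d%:R ^+ 2) * d%:R by ring.
  rewrite ler_wpM2r // lerD2l ler_wpM2l //; first exact: addr_ge0 ler01 exb_ge0.
  by rewrite ler_eXnr.
have r6 : (r ^+ 3) ^+ 2 = d%:R ^- 3 by rewrite -exprM mulnC exprM r_sqr exprVn.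
have iB : rintegrable P (fun t => 2 * d%:R ^- 3 * f2 t + 2).
  by apply: rintegrableD; [exact: rintegrableZ|exact: rintegrable_cst].
have le t : (kap s t * r ^+ 3) ^+ 2 <= 2 * d%:R ^- 3 * f2 t + 2.
  rewrite exprMn r6 /f2; have := frob_ge0 (M s t *m (M s t) ^t*).
  move: (frob _) => f f0.
  have d3 : 0 < (d%:R ^- 3 : R) <= 1.
    by rewrite invr_gt0 exprn_gt0 //= invf_le1 ?exprn_gt0 // exprn_ege1 // ler1n.
  move: (d%:R ^- 3) d3 => e /andP[e0 e1].
  have -> : 2 * e * f ^+ 2 + 2 = (2 * (f ^+ 2 + 1)) * e + 2 * (1 - e) by ring.
  apply: ler_wpDr; first by rewrite mulr_ge0 // subr_ge0.
  rewrite ler_wpM2r ?(ltW e0) // -subr_ge0 (_ : _ - _ = (f - 1) ^+ 2) ?sqr_ge0 //; ring.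
have mk : measurable_fun setT (fun t => (kap s t * r ^+ 3) ^+ 2).
  apply: measurable_funX; apply: measurable_funM => //; apply: measurable_funD => //.
  apply: measurable_frob; have mM : mxmeasurable (fun t => M s t).
    by move=> i j; under eq_fun do rewrite mxE; exact: (e_meas (ent i j)).
  apply: mxmeasurableM => // i j; under eq_fun do rewrite !mxE.
  by apply: cmeasurable_conj; exact: (e_meas (ent j i)).
have ik : rintegrable P (fun t => (kap s t * r ^+ 3) ^+ 2).
  by apply: rintegrable_le iB _ => // t; rewrite ger0_norm ?sqr_ge0.
split=> //; apply: le_trans (le_Rintegral measurableT ik iB _) _ => //.
have if2' := rintegrableZ (2 * d%:R ^- 3) if2.
rewrite (RintegralD measurableT if2' (rintegrable_cst P 2)) Rintegral_prob_cst RintegralZl //.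
apply: (@le_trans _ _ (2 * d%:R ^- 3 * ((3 + exb) * d%:R ^+ 3) + 2)).
  by rewrite lerD2r ler_wpM2l // mulr_ge0 // invr_ge0 exprn_ge0.
rewrite le_eqVlt; apply/orP; left; apply/eqP; field.
by rewrite gt_eqF.
Qed.

Local Notation Gr t := (resolvent (Hmat t) z).
Local Notation D t := (defect c (Hmat t) z).
Local Notation m t := (stieltjes (Hmat t) z).

(** [H G = 1 + z G] turns [1 + z m] into the normalized trace of [H G], and [H] is the average of
    the [Z_s]: hence [D] is itself an average over the columns. *)
Let sqr_defect t : normc (D t) ^+ 2 = p%:R^-1 * \sum_s
  complex.Re (Num.conj (D t) * (nC^-1 * \tr (Z s t *m Gr t) + c%:C * m t ^+ 2)).
Proof.
have pC0 : pC != 0 by rewrite pnatr_eq0 -lt0n.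
have nC0 : nC != 0 by rewrite pnatr_eq0 expn_eq0 andbT -lt0n.
have trH : nC^-1 * \tr (Hmat t *m Gr t) = 1 + z * m t.
  rewrite mulmx_resolvent //; last exact: Hmat_herm.
  rewrite mxtraceD mxtrace1 mxtraceZ mulrDr mulVf // /stieltjes.
  by rewrite mulrCA.
have sD : \sum_s (nC^-1 * \tr (Z s t *m Gr t) + c%:C * m t ^+ 2) = pC * D t.
  rewrite big_split /= sumr_const card_ord -mulr_sumr -raddf_sum -mulmx_suml.
  rewrite /defect -trH /Hmat -scalemxAl mxtraceZ mulrDr -(mulr_natl (c%:C * _) p).
  by congr (_ + _) => //; rewrite mulrCA mulVKf.
have := congr1 (fun x => complex.Re (Num.conj (D t) * x)) sD.
rewrite mulr_sumr Re_sum => ->.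
have -> : Num.conj (D t) * (pC * D t) = (p%:R * normc (D t) ^+ 2)%:C.
  have -> : (p%:R * normc (D t) ^+ 2)%:C = pC * (normc (D t) ^+ 2)%:C.
    by rewrite (rmorphM (real_complex R)) rmorph_nat.
  by rewrite -mul_conjc mulrCA [_ * D t]mulrC.
by rewrite /= mulKf // gt_eqF.
Qed.

(** The numerals are those of the moment bounds above with [exb = 5 + C8]: [6 + C8 = 1 + exb],
    [7 + C8 = 2 + exb] and [9 + C8 = 4 + exb]. *)
Definition second_moment_constant (C8 Pb b w : R) : R :=
  (1 + w * b + Pb * b ^+ 2) * (Pb * ((6 + C8) * b ^+ 2)) +
  error_constant Pb b w * (1 + 8 * (C8 + 1) + (7 + C8) * b ^+ 4 + 2 * (9 + C8)).

Lemma cmeasurable_defect (v : R) : cmeasurable (fun t => defect v (Hmat t) z).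
Proof.
have mm : cmeasurable (fun t => m t).
  apply: cmeasurableM; first exact: cmeasurable_cst.
  apply: cmeasurable_mxtrace; apply: mxmeasurable_inv => [t|].
    by apply: hermitian_shift_unit => //; exact: Hmat_herm.
  by apply: mxmeasurableD; [exact: mxmeasurable_Hmat|exact: mxmeasurable_cst].
apply: cmeasurableD; last first.
  by apply: cmeasurableM; [exact: cmeasurable_cst|exact: cmeasurableM].
apply: cmeasurableD; first exact: cmeasurable_cst.
by apply: cmeasurableM; first exact: cmeasurable_cst.
Qed.

Lemma expectation_sqr_defect : rintegrable P (fun t => normc (D t) ^+ 2) /\
  \int[P]_t (normc (D t) ^+ 2) <= second_moment_constant C8 Pb b w * r.
Proof.
have iD : rintegrable P (fun t => normc (D t) ^+ 2).
  apply: (rintegrable_le _ (rintegrable_cst P (K0 ^+ 2))) => [|t].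
    by apply: measurable_funX; apply: measurable_normc; exact: cmeasurable_defect.
  rewrite ger0_norm ?sqr_ge0 //; apply: lerXn2r; rewrite ?nnegrE ?normc_ge0 //.
  by apply: normc_defect_le => //; exact: Hmat_herm.
split=> //.
pose F1 s t := complex.Re (Num.conj (D0 s t) * (nC^-1 * \tr (Z s t *m A s t))).
pose F2 s t := complex.Re (Num.conj (D0 s t) *
    ((pC * nC)^-1 * (\tr (Z s t *m A s t *m Z s t *m A s t) - \tr (A s t) ^+ 2))).
pose x4 s t := xhat s t ^+ 4.
pose u2 s t := d%:R ^- 2 * normc (trZAA s t) ^+ 2.
pose k2 s t := (kap s t * r ^+ 3) ^+ 2.
pose Ke := error_constant Pb b w.
have Ke0 : 0 <= Ke by apply: error_constant_ge0 => //; exact: normc_ge0.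
pose L s t := F1 s t + (- 1) * F2 s t + (r * Ke) * (1 + x4 s t + u2 s t + k2 s t).
have le t : normc (D t) ^+ 2 <= p%:R^-1 * \sum_s L s t.
  rewrite sqr_defect ler_wpM2l ?invr_ge0 //; apply: ler_sum => s _.
  have kap0 : 0 <= kap s t by apply: addr_ge0 => //; exact: frob_ge0.
  apply: le_trans (leave_one_out_bound d_gt0 p_gt0 z_gt0 (Hmat_herm t)
    (Zcol_herm G s t) kap0 (@frob_ZcolM s t) Pb_ge) _.
  have uE : u2 s t = (normc (trZAA s t) / d%:R) ^+ 2 by rewrite /u2 expr_div_n mulrC.
  by rewrite /L uE mulN1r.
have iF1 s : rintegrable P (F1 s) by have [[]] := first_order s.
have iF2 s : rintegrable P (F2 s) by have [[]] := second_order s.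
have ix4 s : rintegrable P (x4 s) by have [] := frob_Zcol_moment s.
have iu2 s : rintegrable P (u2 s).
  by apply: rintegrableZ; have [] := linear_variance s.
have ik2 s : rintegrable P (k2 s) by have [] := kap_moment s.
have i1x s := rintegrableD (rintegrable_cst P 1) (ix4 s).
have i1xu s := rintegrableD (i1x s) (iu2 s).
have iE s := rintegrableD (i1xu s) (ik2 s).
have iF2' s := rintegrableZ (-1) (iF2 s).
have iF s := rintegrableD (iF1 s) (iF2' s).
have iL s : rintegrable P (L s).
  exact: rintegrableD (iF s) (rintegrableZ _ (iE s)).
have iS := rintegrable_sum (index_enum _) xpredT iL.
apply: le_trans (le_Rintegral measurableT iD (rintegrableZ p%:R^-1 iS) _) _ => //.
rewrite RintegralZl // Rintegral_sum //.
pose B := K0 * (p%:R^-1 * ((1 + exb) * b ^+ 2)) +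
  r * Ke * (1 + 8 * (C8 + 1) + (2 + exb) * b ^+ 4 + 2 * (4 + exb)).
apply: (@le_trans _ _ B).
  rewrite mulrC ler_pdivrMr // mulr_natr -[X in _ *+ X]card_ord -sumr_const.
  apply: ler_sum => s _; rewrite /L.
  rewrite (RintegralD measurableT (iF s) (rintegrableZ _ (iE s))); apply: lerD.
    rewrite (RintegralD measurableT (iF1 s) (iF2' s)) RintegralZl //; last exact: iF2.
    have [_ /(congr1 (@complex.Re R)) /= e1] := first_order s.
    have [_ /= e2] := second_order s.
    by rewrite [X in X + _]e1 add0r mulN1r.
  rewrite [leLHS](RintegralZl _ measurableT (iE s)); apply: ler_wpM2l; first by rewrite mulr_ge0 // ltW.
  rewrite (RintegralD measurableT (i1xu s) (ik2 s)); apply: lerD; last first.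
    by have [] := kap_moment s.
  rewrite (RintegralD measurableT (i1x s) (iu2 s)); apply: lerD; last first.
    have [iv Ev] := linear_variance s.
    rewrite RintegralZl // mulrC ler_pdivrMr ?exprn_gt0 //.
    by apply: le_trans Ev _; rewrite mulrA.
  rewrite (RintegralD measurableT (rintegrable_cst P 1) (ix4 s)) Rintegral_prob_cst.
  by rewrite lerD2l; have [] := frob_Zcol_moment s.
(* Deliberately crude: [1 / p] is at most of order [r ^ 4], but the third-order error already limits
   the rate to [r]. *)
have pr : p%:R^-1 <= Pb * r.
  apply: (@le_trans _ _ (Pb * n%:R^-1)).
    rewrite (_ : p%:R^-1 = c * n%:R^-1); last by field; rewrite !gt_eqF.
    by rewrite ler_wpM2r // invr_ge0.
  rewrite ler_wpM2l // natrX -exprVn -r_sqr -exprM.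
  by rewrite exprS ger_pMr // exprn_ile1 // ltW.
rewrite /B /second_moment_constant -/Ke [leRHS]mulrDl; apply: lerD; last first.
  by rewrite le_eqVlt; apply/orP; left; apply/eqP; ring.
rewrite -[leRHS]mulrA; apply: ler_pM => //.
- apply: mulr_ge0; first by rewrite invr_ge0.
  by apply: mulr_ge0; [exact: addr_ge0 ler01 exb_ge0|exact: sqr_ge0].
- by rewrite lerD2l ler_wpM2r // sqr_ge0.
- have -> : Pb * ((6 + C8) * b ^+ 2) * r = (Pb * r) * ((1 + exb) * b ^+ 2).
    by move: C8 b r => *; ring.
  apply: ler_wpM2r => //.
  by apply: mulr_ge0; [exact: addr_ge0 ler01 exb_ge0|exact: sqr_ge0].
Qed.

End defect_second_moment.

(** * The semicircle law *)

Section semicircle_primitive.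
Context (R : realType) (v : R).
Hypothesis v_gt0 : 0 < v.
Local Notation s := (2 * Num.sqrt v).
Local Notation q x := (Num.sqrt (4 * v - x ^+ 2)).

(* A primitive of the centered density; [2 * atan (x / (s + q x))] is
   [asin (x / s)], but continuous up to and beyond the edges. *)
Definition semicircle_primitive (x : R) : R :=
  (2 * pi * v)^-1 * (2^-1 * (x * q x) + 4 * v * atan (x / (s + q x))).
Local Notation F := semicircle_primitive.

Let s_gt0 : 0 < s. Proof. by rewrite mulr_gt0 // sqrtr_gt0. Qed.

Lemma sqr_semicircle_edge : s ^+ 2 = 4 * v.
Proof. by rewrite exprMn sqr_sqrtr ?(ltW v_gt0) //; ring. Qed.

Let sq_gt0 x : 0 < s + q x.
Proof. by rewrite ltr_pwDl // sqrtr_ge0. Qed.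

Lemma continuous_semicircle_root : continuous (fun x : R => q x).
Proof.
move=> x; apply: (@continuous_comp _ _ _ (fun x : R => 4 * v - x ^+ 2)); last first.
  exact: sqrt_continuous.
by apply: cvgB; [exact: cvg_cst|exact: exprn_continuous].
Qed.

Lemma continuous_semicircle_primitive : continuous F.
Proof.
move=> x; have cq : {for x, continuous (fun x : R => q x)} by exact: continuous_semicircle_root.
apply: cvgM; first exact: cvg_cst.
apply: cvgD; first by apply: cvgM; [exact: cvg_cst|apply: cvgM => //; exact: cvg_id].
apply: cvgM; first exact: cvg_cst.
apply: (@continuous_comp _ _ _ (fun x : R => x / (s + q x))); last first.
  exact: continuous_atan.
apply: cvgM; first exact: cvg_id.
apply: cvgV; first by rewrite gt_eqF.
by apply: cvgD => //; exact: cvg_cst.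
Qed.

Lemma is_derive_semicircle_primitive x : - s < x < s ->
  is_derive x 1 F ((2 * pi * v)^-1 * q x).
Proof.
move=> /andP[sx xs]; have q0 : 0 < 4 * v - x ^+ 2.
  rewrite -sqr_semicircle_edge (_ : _ - _ = (s - x) * (s + x)); last by ring.
  by rewrite mulr_gt0 // ?subr_gt0 // -ltrBlDl sub0r.
have dq : is_derive x 1 (fun x => q x) (- x / q x).
  have ds := is_derive1_sqrt q0.
  have di : is_derive x 1 (fun x => 4 * v - x ^+ 2) (- (2 * x)).
    by apply: is_derive_eq; rewrite /GRing.scale /=; ring.
  apply: (is_derive_eq (@is_derive1_comp R Num.sqrt (fun x => 4 * v - x ^+ 2) x _ _ ds di)).
  by field; rewrite gt_eqF // sqrtr_gt0.
have qq : q x ^+ 2 = 4 * v - x ^+ 2 by rewrite sqr_sqrtr // ltW.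
have qx0 : 0 < q x by rewrite sqrtr_gt0.
have sq0 := sq_gt0 x.
have du : is_derive x 1 (fun x => x / (s + q x)) (s / (q x * (s + q x))).
  have dsq : is_derive x 1 (fun x => s + q x) (- x / q x).
    by apply: (is_derive_eq (is_deriveD (is_derive_cst s x (1 : R)) dq)); rewrite add0r.
  have nz : s + q x != 0 by rewrite gt_eqF.
  have dV := @is_deriveV R (fun x => s + q x) x _ _ nz dsq.
  apply: (is_derive_eq (is_deriveM (is_derive_id x (1 : R)) dV)); rewrite /GRing.scale /=.
  have e : s ^+ 2 = q x ^+ 2 + x ^+ 2 by rewrite qq sqr_semicircle_edge; ring.
  move: e sq0 nz qx0 s_gt0; move: (q x) s => Q S e sq0 nz qx0 S0.
  apply: (@mulIf _ (Q * (S + Q) ^+ 2)).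
    by rewrite mulf_neq0 // ?expf_neq0 // gt_eqF.
  rewrite (_ : S / (Q * (S + Q)) * (Q * (S + Q) ^+ 2) = S * (S + Q)); last first.
    by field; rewrite nz gt_eqF.
  rewrite (_ : _ * (Q * (S + Q) ^+ 2) = Q * (S + Q) + x ^+ 2); last first.
    by field; rewrite nz gt_eqF.
  have -> : x ^+ 2 = S ^+ 2 - Q ^+ 2 by rewrite e; ring.
  by ring.
have da := @is_derive1_comp R (@atan R) (fun x => x / (s + q x)) x _ _
  (is_derive1_atan (x / (s + q x))) du.
have dxq : is_derive x 1 (fun x => x * q x) (q x - x ^+ 2 / q x).
  by apply: (is_derive_eq (is_deriveM (is_derive_id x (1 : R)) dq)); rewrite /GRing.scale /=; field; rewrite gt_eqF.
have dF : is_derive x 1 F ((2 * pi * v)^-1 * (2^-1 * (q x - x ^+ 2 / q x) +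
   4 * v * ((1 + (x / (s + q x)) ^+ 2)^-1 * (s / (q x * (s + q x)))))).
  by apply: is_deriveZ; apply: is_deriveD; apply: is_deriveZ.
apply: (is_derive_eq dF); congr (_ * _).
have e : s ^+ 2 = q x ^+ 2 + x ^+ 2 by rewrite qq sqr_semicircle_edge; ring.
have e4 := sqr_semicircle_edge; move: e e4 sq0 qx0 s_gt0.
move: (q x) s => Q S e e4 sq0 qx0 S0; rewrite -e4.
(* Half-angle formula: with [x = S sin t] and [Q = S cos t], [x / (S + Q)] is [tan (t / 2)]. *)
have -> : 1 + (x / (S + Q)) ^+ 2 = 2 * S / (S + Q).
  apply: (@mulIf _ ((S + Q) ^+ 2)); first by rewrite expf_neq0 // gt_eqF.
  rewrite mulrDl expr_div_n mulfVK ?expf_neq0 ?gt_eqF //.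
  rewrite (_ : 2 * S / (S + Q) * _ = 2 * S * (S + Q)); last by field; rewrite gt_eqF.
  have -> : x ^+ 2 = S ^+ 2 - Q ^+ 2 by rewrite e; ring.
  by ring.
have -> : (2 * S / (S + Q))^-1 * (S / (Q * (S + Q))) = (2 * Q)^-1.
  by field; rewrite !gt_eqF.
rewrite e; field; rewrite gt_eqF //.
Qed.

Lemma semicircle_primitive_edge : F s = 2^-1.
Proof.
rewrite /F sqr_semicircle_edge subrr sqrtr0 mulr0 mulr0 add0r addr0 divff ?gt_eqF //.
by rewrite atan1; have := pi_gt0 R; move: (pi : R) => p p0; field; rewrite !gt_eqF.
Qed.

Lemma semicircle_primitiveN x : F (- x) = - F x.
Proof. by rewrite /F sqrrN !mulNr atanN; ring. Qed.

Local Notation density x := ((2 * pi * v)^-1 * q x).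

(** Subadditivity of the square root. At the edges the density is only Hölder continuous of exponent
    [1/2], hence the square root of the step. *)
Lemma semicircle_root_modulus x y : - s <= x <= s -> - s <= y <= s -> x <= y ->
  q y <= q x + Num.sqrt (2 * s * (y - x)).
Proof.
move=> /andP[sx xs] /andP[sy ys] xy.
have q_arg u : - s <= u -> u <= s -> 0 <= 4 * v - u ^+ 2.
  move=> su us; rewrite -sqr_semicircle_edge (_ : _ - _ = (s - u) * (s + u)); last by ring.
  by rewrite mulr_ge0 // ?subr_ge0 // -lerBlDl sub0r.
apply: ler_of_sqr; first by rewrite addr_ge0 ?sqrtr_ge0.
have dxy : 0 <= 2 * s * (y - x) by rewrite mulr_ge0 ?subr_ge0 // mulr_ge0 // ltW.
rewrite sqrrD !sqr_sqrtr ?q_arg //.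
have h : 0 <= q x * Num.sqrt (2 * s * (y - x)) *+ 2.
  by rewrite mulrn_wge0 // mulr_ge0 // sqrtr_ge0.
have : x ^+ 2 - y ^+ 2 <= 2 * s * (y - x).
  rewrite (_ : x ^+ 2 - y ^+ 2 = (- x - y) * (y - x)); last by ring.
  by rewrite ler_wpM2r ?subr_ge0 //; move: sx sy; lra.
by move: h; lra.
Qed.

Lemma semicircle_primitive_step x y : - s <= x -> x < y -> y <= s ->
  F y - F x <= (y - x) * (density x + (2 * pi * v)^-1 * Num.sqrt (2 * s * (y - x))).
Proof.
move=> sx xy ys.
have [c cxy ->] : exists2 c, c \in `]x, y[%R & F y - F x = density c * (y - x).
  apply: MVT => //; last by apply: continuous_subspaceT => ?; exact: continuous_semicircle_primitive.
  move=> c; rewrite in_itv /= => /andP[xc cy].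
  apply: is_derive_semicircle_primitive.
  by rewrite (le_lt_trans sx xc) (lt_le_trans cy ys).
move: cxy; rewrite in_itv /= => /andP[xc cy].
rewrite mulrC; apply: ler_wpM2l; first by rewrite subr_ge0 ltW.
rewrite -mulrDr ler_wpM2l //.
  by rewrite invr_ge0 ltW // !mulr_gt0 // pi_gt0.
apply: le_trans (semicircle_root_modulus _ _ (ltW xc)) _.
- by rewrite sx ltW // (lt_le_trans xy).
- by rewrite (le_trans sx (ltW xc)) (le_trans (ltW cy) ys).
rewrite lerD2l; apply: ler_wsqrtr; apply: ler_wpM2l; last by rewrite lerD2r ltW.
by rewrite mulr_ge0 // ltW.
Qed.

End semicircle_primitive.

(** * Poisson kernel and lower bounds by Riemann sums *)

Section poisson_kernel.
Context (R : realType) (eta : R).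
Hypothesis eta_gt0 : 0 < eta.

Definition poisson_kernel (y : R) : R := eta / (y ^+ 2 + eta ^+ 2).
Local Notation K := poisson_kernel.

Let den_gt0 y : 0 < y ^+ 2 + eta ^+ 2.
Proof. by rewrite ltr_wpDl ?sqr_ge0 // exprn_gt0. Qed.

Lemma poisson_kernel_ge0 y : 0 <= K y.
Proof. by rewrite divr_ge0 // ltW. Qed.

Lemma poisson_kernel_far y dl : 0 < dl -> dl <= `|y| -> K y <= eta / dl ^+ 2.
Proof.
move=> dl0 dly; rewrite ler_wpM2l ?(ltW eta_gt0) // lef_pV2 ?posrE ?exprn_gt0 //.
rewrite ler_wpDr ?sqr_ge0 // -[y ^+ 2]real_normK ?num_real //.
by apply: lerXn2r; rewrite ?nnegrE // ltW.
Qed.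

(* [K x - K y = eta (y - x) (y + x) / (...)], and [eta |y| <= (y ^+ 2 + eta ^+ 2) / 2]. *)
Lemma poisson_kernel_lipschitz x y : x <= y -> K x <= K y + (y - x) / eta ^+ 2.
Proof.
move=> xy; rewrite -lerBlDl.
have -> : K x - K y = (y - x) * (eta * (y + x) / ((x ^+ 2 + eta ^+ 2) * (y ^+ 2 + eta ^+ 2))).
  by rewrite /K; field; rewrite !gt_eqF.
apply: ler_wpM2l; rewrite ?subr_ge0 //.
rewrite ler_pdivrMr ?mulr_gt0 // [leRHS]mulrC ler_pdivlMr ?exprn_gt0 //.
have e2 : 0 < eta ^+ 2 by rewrite exprn_gt0.
have h1 : 2 * (eta * x) <= x ^+ 2 + eta ^+ 2.
  by rewrite -subr_ge0 (_ : _ - _ = (x - eta) ^+ 2) ?sqr_ge0 //; ring.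
have h2 : 2 * (eta * y) <= y ^+ 2 + eta ^+ 2.
  by rewrite -subr_ge0 (_ : _ - _ = (y - eta) ^+ 2) ?sqr_ge0 //; ring.
have x2 := sqr_ge0 x; have y2 := sqr_ge0 y.
move: h1 h2 x2 y2 e2; rewrite mulrDr.
move: (x ^+ 2) (y ^+ 2) (eta ^+ 2) (eta * x) (eta * y) => X Y e a b h1 h2 X0 Y0 e0.
have hab : a + b <= e + (X + Y) / 2 by lra.
apply: (@le_trans _ _ ((e + (X + Y) / 2) * e)); first by rewrite ler_wpM2r ?(ltW e0) // addrC.
rewrite -subr_ge0 (_ : _ - _ = X * Y + (X * e + Y * e) / 2); last by field.
by rewrite addr_ge0 ?mulr_ge0 // addr_ge0 // mulr_ge0 // ltW.
Qed.

(** The sum is a Riemann sum of the derivative of [atan], whose total increase is at most [pi]; the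
    Lipschitz bound costs [h * (h / eta ^ 2)] per cell. *)
Lemma poisson_kernel_sum (a h x : R) (N : nat) : 0 < h ->
  \sum_(k < N) h * K (x - (a + k%:R * h)) <= pi + N%:R * h * (h / eta ^+ 2).
Proof.
move=> h0.
pose A y := atan ((y - x) / eta).
have dA (y : R) : is_derive y 1 A (K (y - x)).
  have du : is_derive y 1 (fun y => (y - x) / eta) eta^-1.
    by apply: is_derive_eq; rewrite /GRing.scale /=; ring.
  apply: (is_derive_eq (@is_derive1_comp R (@atan R) (fun y => (y - x) / eta) y _ _
    (is_derive1_atan ((y - x) / eta)) du)).
  rewrite /K; have := den_gt0 (y - x); move: (y - x) => Y d0; field; rewrite !gt_eqF //.
have cA : continuous A.
  by move=> y; apply/differentiable_continuous/derivable1_diffP; have [] := dA y.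
have KN y : K (- y) = K y by rewrite /K sqrrN.
have step k : h * K (x - (a + k%:R * h)) <=
    (A (a + k.+1%:R * h) - A (a + k%:R * h)) + h * (h / eta ^+ 2).
  have lt : a + k%:R * h < a + k.+1%:R * h by rewrite ltrD2l ltr_pM2r // ltr_nat.
  have hE : a + k.+1%:R * h - (a + k%:R * h) = h by rewrite -natr1; ring.
  have cA' : {within `[a + k%:R * h, a + k.+1%:R * h], continuous A}.
    exact: continuous_subspaceT.
  have [c] := @MVT R A (fun c => K (c - x)) _ _ lt (fun y _ => dA y) cA'.
  rewrite hE in_itv /= => /andP[c1 c2] ->.
  rewrite [K (c - x) * h]mulrC -mulrDr ler_wpM2l ?(ltW h0) //.
  rewrite -KN opprB; apply: le_trans (poisson_kernel_lipschitz (y := c - x) _) _.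
    by rewrite lerD2r ltW.
  rewrite lerD2l ler_wpM2r ?invr_ge0 ?sqr_ge0 //.
  by move: c2; rewrite -natr1; lra.
apply: (@le_trans _ _ (\sum_(k < N)
   ((A (a + k.+1%:R * h) - A (a + k%:R * h)) + h * (h / eta ^+ 2)))).
  by apply: ler_sum => k _; exact: step.
rewrite big_split /= sumr_const card_ord -[X in _ + X <= _]mulr_natl -mulrA lerD2r.
have -> : \sum_(k < N) (A (a + k.+1%:R * h) - A (a + k%:R * h)) =
   A (a + N%:R * h) - A (a + 0%:R * h).
  rewrite -(big_mkord xpredT (fun k => A (a + k.+1%:R * h) - A (a + k%:R * h))).
  by rewrite (telescope_sumr (fun k => A (a + k%:R * h))).
have := atan_ltpi2 ((a + N%:R * h - x) / eta).
have := atan_gtNpi2 ((a + 0%:R * h - x) / eta).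
rewrite /A; lra.
Qed.

End poisson_kernel.

(* With [w := 2 v m + z], the defect equation reads
   [w ^+ 2 = z ^+ 2 - 4 v + 4 v D]; only its real part matters. *)
Lemma stieltjes_lower_bound (R : realType) (v E eta : R) (m : R[i]) :
  0 < v -> 0 < eta -> 0 <= complex.Im m ->
  4 * v * normc (1 + (E +i* eta) * m + v%:C * m ^+ 2) <= eta ^+ 2 ->
  Num.sqrt (4 * v - E ^+ 2) <= 2 * v * complex.Im m + eta.
Proof.
move=> v0 eta0; set D := (1 + _ + _) => Im0 Db.
apply: ler_of_sqr.
  by rewrite addr_ge0 ?(ltW eta0) // mulr_ge0 // mulr_ge0 // ltW.
have [E0|E0] := ltP (4 * v - E ^+ 2) 0.
  by rewrite ltr0_sqrtr // expr0n sqr_ge0.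
rewrite sqr_sqrtr //.
have : 4 * v * complex.Re D <= eta ^+ 2.
  by apply: le_trans Db; rewrite ler_wpM2l ?Re_le_normc // mulr_ge0 // ltW.
rewrite /D !Re_add expr2 !Re_mul !Im_mul /=.
case: m Im0 {D Db} => a b /= b0 h.
(* [2 v a + E] is the real part of [w], and discarding its square is the only loss besides the bound
   on [D]. *)
have := sqr_ge0 (2 * v * a + E).
move: h; rewrite -subr_ge0 => h h2; rewrite -subr_ge0.
rewrite (_ : _ - _ = (2 * v * a + E) ^+ 2 + (eta ^+ 2 - 4 * v *
  (1 + (E * a - eta * b) + (v * (a * a - b * b) - 0 * (a * b + b * a))))); last by ring.
exact: addr_ge0.
Qed.

Lemma Im_inv_sub (R : realType) (x E eta : R) : 0 < eta ->
  complex.Im ((x%:C - (E +i* eta))^-1) = poisson_kernel eta (x - E).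
Proof.
move=> eta0; have d0 : 0 < (x - E) ^+ 2 + eta ^+ 2.
  by rewrite ltr_wpDl ?sqr_ge0 // exprn_gt0.
rewrite /GRing.inv /= /poisson_kernel; move: (x - E) d0 => y d0.
by rewrite sub0r sqrrN mulNr opprK.
Qed.

(** The imaginary part of the Stieltjes transform counts points with Poisson weights. The margin
    [dl] absorbs their spread: beyond it a point has weight at most [eta / dl ^ 2]. The grid and
    [tau] are fixed before [n] and [x], so they serve all dimensions. *)
Lemma semicircle_grid_bound (R : realType) (v a b dl e : R) :
  0 < v -> - (2 * Num.sqrt v) <= a -> a < b -> b <= 2 * Num.sqrt v -> 0 < dl -> 0 < e ->
  exists (zs : seq R[i]) (tau : R), [/\ 0 < tau, (forall z, z \in zs -> 0 < complex.Im z) &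
   forall (n : nat) (x : 'I_n -> R), (0 < n)%N ->
    (forall z, z \in zs -> let m := n%:R^-1 * \sum_i ((x i)%:C - z)^-1 in
       normc (1 + z * m + v%:C * m ^+ 2) <= tau) ->
    semicircle_primitive v b - semicircle_primitive v a - e <=
      n%:R^-1 * \sum_i \1_(`]a - dl, b + dl[%classic) (x i)].
Proof.
move=> v0; set s := 2 * Num.sqrt v => sa ab bs dl0 e0.
have s0 : 0 < s by rewrite mulr_gt0 // sqrtr_gt0.
have pi0 := pi_gt0 R.
have l0 : 0 < b - a by rewrite subr_gt0.
set l := b - a in l0.
(* The error budget: [C1 * eta = e / 2] pays for the [+ eta] in the lower bound on the imaginary
   part and for the far weights. The bound [kp] on the modulus of continuity over one cell costs
   [e / 4], and the Riemann sum of the kernel costs the last [e / 4]; [h0] is the step that ensures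
   both. *)
pose C1 := l / (2 * pi * v) + l / (pi * dl ^+ 2).
have C10 : 0 < C1 by rewrite addr_gt0 // divr_gt0 // !mulr_gt0 // exprn_gt0.
pose eta := e / 2 / C1.
have eta0 : 0 < eta by rewrite !divr_gt0.
pose kp := e / 4 * (2 * pi * v) / l.
have kp0 : 0 < kp by rewrite divr_gt0 // !mulr_gt0.
pose h0 := Num.min (e / 4 * pi * eta ^+ 2 / l) (kp ^+ 2 / (2 * s)).
have h00 : 0 < h0.
  rewrite lt_min; apply/andP; split; apply: divr_gt0 => //; last exact: mulr_gt0.
    by apply: mulr_gt0; [apply: mulr_gt0 => //; exact: divr_gt0|exact: exprn_gt0].
  exact: exprn_gt0.
(* The successor makes the step [l / N] at most [h0] and [N] positive. *)
pose N := (Num.truncn (l / h0)).+1.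
have N0 : 0 < N%:R :> R by rewrite ltr0n.
pose h := l / N%:R.
have hgt0 : 0 < h by rewrite divr_gt0.
have Nh : N%:R * h = l by rewrite mulrC divfK // gt_eqF.
have hh0 : h <= h0.
  rewrite ler_pdivrMr // mulrC -ler_pdivrMr // ltW //.
  exact: truncnS_gt.
have /andP[hh1 hh2] : (h <= e / 4 * pi * eta ^+ 2 / l) && (h <= kp ^+ 2 / (2 * s)).
  by rewrite -le_min.
pose E k : R := a + k%:R * h.
exists [seq (E k +i* eta) | k <- iota 0 N], (eta ^+ 2 / (4 * v)); split.
- by rewrite divr_gt0 ?exprn_gt0 // mulr_gt0.
- by move=> z /mapP[k _ ->].
move=> n x n0 small.
have nR : 0 < n%:R :> R by rewrite ltr0n.
pose m k : R[i] := n%:R^-1 * \sum_i ((x i)%:C - (E k +i* eta))^-1.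
have ImM k : complex.Im (m k) = n%:R^-1 * \sum_i poisson_kernel eta (x i - E k).
  rewrite /m (_ : n%:R^-1 = (n%:R^-1 : R)%:C :> R[i]); last first.
    by rewrite (fmorphV (real_complex R)) rmorph_nat.
  rewrite Im_mul /= mul0r addr0 Im_sum; congr (_ * _).
  by apply: eq_bigr => i _; rewrite Im_inv_sub.
have rootb k : (k < N)%N -> Num.sqrt (4 * v - E k ^+ 2) <= 2 * v * complex.Im (m k) + eta.
  move=> kN; apply: stieltjes_lower_bound => //.
    rewrite ImM mulr_ge0 ?invr_ge0 ?(ltW nR) //; apply: sumr_ge0 => i _.
    exact: poisson_kernel_ge0.
  have := small (E k +i* eta) (map_f _ _); rewrite mem_iota /= add0n => /(_ kN).
  by rewrite ler_pdivlMr ?mulr_gt0 // mulrC.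
have Estep k : (k < N)%N -> [/\ - s <= E k, E k < E k.+1, E k.+1 <= s & E k.+1 - E k = h].
  move=> kN; split.
  - by apply: le_trans sa _; rewrite lerDl mulr_ge0 // ltW.
  - by rewrite /E ltrD2l ltr_pM2r // ltr_nat.
  - apply: le_trans bs; rewrite /E -lerBrDl -/l -Nh ler_wpM2r ?(ltW hgt0) //.
    by rewrite ler_nat.
  - by rewrite /E -natr1; ring.
have cst0 : 0 < (2 * pi * v)^-1 by rewrite invr_gt0 !mulr_gt0.
have step k : (k < N)%N -> semicircle_primitive v (E k.+1) - semicircle_primitive v (E k) <=
    pi^-1 * (h * complex.Im (m k)) + h * ((2 * pi * v)^-1 * (eta + kp)).
  move=> kN; have [s1 s2 s3 sE] := Estep k kN.
  apply: le_trans (semicircle_primitive_step v0 s1 s2 s3) _; rewrite sE.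
  have -> : pi^-1 * (h * complex.Im (m k)) + h * ((2 * pi * v)^-1 * (eta + kp)) =
    h * ((2 * pi * v)^-1 * (2 * v * complex.Im (m k) + eta) + (2 * pi * v)^-1 * kp).
    by move: (pi : R) pi0 => p p0; field; rewrite !gt_eqF.
  rewrite ler_wpM2l ?(ltW hgt0) //; apply: lerD.
    by rewrite ler_wpM2l ?(ltW cst0) // rootb.
  rewrite ler_wpM2l ?(ltW cst0) // -[leRHS]ger0_norm ?(ltW kp0) // -sqrtr_sqr.
  apply: ler_wsqrtr; move: hh2; rewrite ler_pdivlMr; last exact: mulr_gt0.
  by rewrite mulrC.
have teleF : semicircle_primitive v b - semicircle_primitive v a <=
   \sum_(k < N) (pi^-1 * (h * complex.Im (m k)) + h * ((2 * pi * v)^-1 * (eta + kp))).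
  have -> : semicircle_primitive v b - semicircle_primitive v a = \sum_(k < N)
     (semicircle_primitive v (E k.+1) - semicircle_primitive v (E k)).
    rewrite -(big_mkord xpredT (fun k => semicircle_primitive v (E k.+1)
      - semicircle_primitive v (E k))).
    rewrite (telescope_sumr (fun k => semicircle_primitive v (E k))) //.
    have abE : a + l = b by rewrite /l addrC subrK.
    by rewrite /E mul0r addr0 Nh abE.
  by apply: ler_sum => k _; exact: step.
have sumE : \sum_(k < N) pi^-1 * (h * complex.Im (m k)) = n%:R^-1 *
   \sum_i (pi^-1 * \sum_(k < N) h * poisson_kernel eta (x i - E k)).
  under eq_bigr do rewrite ImM mulr_sumr mulr_sumr mulr_sumr.
  rewrite exchange_big mulr_sumr; apply: eq_bigr => i _ /=.
  rewrite mulr_sumr mulr_sumr; apply: eq_bigr => k _.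
  by move: (poisson_kernel _ _) (pi^-1 : R) => *; ring.
(* Up to small errors, a point in the enlarged interval has total weight at most [1] and a point
   outside has weight [0]. *)
have perx y : pi^-1 * (\sum_(k < N) h * poisson_kernel eta (y - E k)) <=
   \1_(`]a - dl, b + dl[%classic) y + (e / 4 + l / (pi * dl ^+ 2) * eta).
  rewrite indicE; case: (boolP (y \in _)) => [_|yI].
    apply: (@le_trans _ _ (pi^-1 * (pi + N%:R * h * (h / eta ^+ 2)))).
      by rewrite ler_wpM2l ?invr_ge0 ?(ltW pi0) //; exact: poisson_kernel_sum.
    rewrite mulrDr mulVf ?gt_eqF // lerD2l ler_wpDr //.
      by rewrite mulr_ge0 ?(ltW eta0) // ltW // divr_gt0 // mulr_gt0 // exprn_gt0.
    rewrite Nh mulrC ler_pdivrMr // mulrA ler_pdivrMr ?exprn_gt0 //.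
    by move: hh1; rewrite ler_pdivlMr // mulrC.
  rewrite add0r; apply: (@le_trans _ _ (pi^-1 * (\sum_(k < N) h * (eta / dl ^+ 2)))).
    rewrite ler_wpM2l ?invr_ge0 ?(ltW pi0) //; apply: ler_sum => k _.
    rewrite ler_wpM2l ?(ltW hgt0) //; apply: poisson_kernel_far => //.
    have aE : a <= E k by rewrite lerDl mulr_ge0 // ltW.
    have Eb : E k <= b.
      by rewrite /E -lerBrDl -/l -Nh ler_wpM2r ?(ltW hgt0) // ler_nat ltnW.
    rewrite leNgt; apply: contra yI => yE; rewrite inE /= in_itv /=.
    by move: yE; rewrite ltr_norml => /andP[]; move: aE Eb; lra.
  rewrite sumr_const card_ord -[_ *+ N]mulr_natl mulrA Nh ler_wpDl //.
    by rewrite divr_ge0 // ltW.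
  rewrite le_eqVlt; apply/orP; left; apply/eqP; move: (pi : R) pi0 => p p0; field.
  by rewrite !gt_eqF.
rewrite lerBlDr; apply: le_trans teleF _.
rewrite big_split /= sumE sumr_const card_ord -[_ *+ N]mulr_natl mulrA Nh.
apply: (@le_trans _ _ (n%:R^-1 * (\sum_i (\1_(`]a - dl, b + dl[%classic) (x i) +
    (e / 4 + l / (pi * dl ^+ 2) * eta))) + l * ((2 * pi * v)^-1 * (eta + kp)))).
  rewrite lerD2r ler_wpM2l ?invr_ge0 ?(ltW nR) //; apply: ler_sum => i _; exact: perx.
rewrite big_split /= mulrDr sumr_const card_ord -(mulr_natl (e / 4 + _) n) mulKf ?gt_eqF //.
rewrite -addrA lerD2l.
have kE : l * ((2 * pi * v)^-1 * kp) = e / 4.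
  by rewrite /kp; move: (pi : R) pi0 => p p0; field; rewrite !gt_eqF.
have etaE : C1 * eta = e / 2 by rewrite /eta mulrC divfK // gt_eqF.
have -> : l * ((2 * pi * v)^-1 * (eta + kp)) = l / (2 * pi * v) * eta + e / 4.
  by rewrite -kE; ring.
move: etaE; rewrite /C1 mulrDl; lra.
Qed.

(** * Masses of intervals *)

Section semicircle_mass.
Context (R : realType) (m v : R).
Hypothesis v_gt0 : 0 < v.
Local Notation s := (2 * Num.sqrt v).
Local Notation F := (semicircle_primitive v).
Local Notation f := (semicircle_pdf m v).
Local Notation mu := (@lebesgue_measure R).

Let g (x : R) : R := (2 * pi * v)^-1 * Num.sqrt (4 * v - (x - m) ^+ 2).
Let J : set R := `[m - s, m + s]%classic.

Let s_gt0 : 0 < s. Proof. by rewrite mulr_gt0 // sqrtr_gt0. Qed.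

Let fE : f = g \_ J.
Proof.
apply/funext => x; rewrite /semicircle_pdf patchE.
by have -> : (x \in J) = (x \in `[m - s, m + s]%R) by rewrite /J mem_setE.
Qed.

Let g_ge0 x : 0 <= g x.
Proof.
by rewrite mulr_ge0 ?sqrtr_ge0 // invr_ge0 ltW // !mulr_gt0 // pi_gt0.
Qed.

Let continuous_shift : continuous (fun x : R => x - m).
Proof. by move=> x; apply: cvgB; [exact: cvg_id|exact: cvg_cst]. Qed.

Let continuous_g : continuous g.
Proof.
move=> x; apply: cvgM; first exact: cvg_cst.
apply: (@continuous_comp _ _ _ (fun x : R => x - m) (fun x => Num.sqrt (4 * v - x ^+ 2))).
  exact: continuous_shift.
exact: continuous_semicircle_root.
Qed.

Let measurable_g (D : set R) : measurable_fun D g.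
Proof.
apply: (@measurable_funS _ _ _ _ setT) => //.
exact: continuous_measurable_fun.
Qed.

Lemma semicircle_pdf_ge0 x : 0 <= f x.
Proof. by rewrite fE patchE; case: ifP. Qed.

Lemma measurable_semicircle_pdf : measurable_fun setT (EFin \o f).
Proof.
apply/measurable_EFinP; rewrite (_ : f = fun x => g x * \1_J x).
  apply: measurable_funM; first exact: measurable_g.
  by apply: measurable_indic; exact: measurable_itv.
by apply/funext => x; rewrite fE patchE indicE; case: ifP; rewrite ?mulr1 ?mulr0.
Qed.

Let integral_support (I : set R) :
  (\int[mu]_(x in I) (f x)%:E = \int[mu]_(x in I `&` J) (g x)%:E)%E.
Proof.
rewrite integral_mkcondr; apply: eq_integral => x _.
by rewrite fE !patchE; case: ifP.
Qed.

Let integral_g a b : m - s <= a -> a <= b -> b <= m + s ->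
  (\int[mu]_(x in `[a, b]) (g x)%:E = (F (b - m) - F (a - m))%:E)%E.
Proof.
move=> sa; rewrite le_eqVlt => /orP[/eqP <- _|ab bs].
  by rewrite set_itv1 integral_set1 subrr.
have dF x : x \in `]a, b[%R -> is_derive x 1 (fun x => F (x - m)) (g x).
  rewrite in_itv /= => /andP[ax xb].
  have dx : is_derive x 1 (fun x : R => x - m) 1.
    by apply: is_derive_eq; rewrite subr0.
  have dF := @is_derive_semicircle_primitive R v v_gt0 (x - m) _.
  have xs : - s < x - m < s by move: sa ax xb bs; lra.
  apply: (is_derive_eq (@is_derive1_comp R F (fun x => x - m) x _ _ (dF xs) dx)).
  by rewrite mulr1.
have cF : continuous (fun x => F (x - m)).
  move=> x; apply: (@continuous_comp _ _ _ (fun x : R => x - m) F).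
    exact: continuous_shift.
  exact: continuous_semicircle_primitive.
rewrite (@continuous_FTC2 R g (fun x => F (x - m)) a b) //.
- exact: continuous_subspaceT.
- split; first by move=> x /dF[].
    by apply: cvg_at_right_filter; exact: cF.
  by apply: cvg_at_left_filter; exact: cF.
- by move=> x /dF h; rewrite derive1E derive_val.
Qed.

Lemma semicircle_setT : semicircle m v setT = 1%E.
Proof.
rewrite /semicircle integral_support setTI integral_g //; last by rewrite lerBlDr -addrA lerDl addr_ge0 // ltW.
rewrite addrAC subrr add0r addrAC subrr add0r semicircle_primitiveN.
rewrite semicircle_primitive_edge //; congr (_%:E); lra.
Qed.

Lemma semicircle_le (I : set R) a b : measurable I ->
  m - s <= a -> a <= b -> b <= m + s ->
  (forall x, I x -> m - s <= x <= m + s -> a <= x <= b) ->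
  (semicircle m v I <= (F (b - m) - F (a - m))%:E)%E.
Proof.
move=> mI sa ab bs sub; rewrite -integral_g // /semicircle integral_support.
have mJ : measurable J by exact: measurable_itv.
apply: ge0_subset_integral => //.
- exact: measurableI.
- apply/measurable_EFinP; exact: measurable_g.
- by move=> x _; rewrite lee_fin.
move=> x [Ix]; rewrite /J /= !in_itv /= => /(sub x Ix).
by [].
Qed.

Lemma semicircle_ge0 (I : set R) : (0 <= semicircle m v I)%E.
Proof. by apply: integral_ge0 => x _; rewrite lee_fin semicircle_pdf_ge0. Qed.

Lemma semicircleU (A B : set R) : measurable A -> measurable B -> [disjoint A & B] ->
  (semicircle m v (A `|` B) = semicircle m v A + semicircle m v B)%E.
Proof.
move=> mA mB AB; apply: ge0_integral_setU => //.
  by apply: measurable_funS measurable_semicircle_pdf.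
by move=> x _; rewrite lee_fin semicircle_pdf_ge0.
Qed.

Lemma semicircle_fin (I : set R) : measurable I -> semicircle m v I \is a fin_num.
Proof.
move=> mI; rewrite ge0_fin_numE ?semicircle_ge0 //.
apply: (@le_lt_trans _ _ 1%E); last exact: ltry.
rewrite -semicircle_setT; apply: ge0_subset_integral => //.
  exact: measurable_semicircle_pdf.
by move=> x _; rewrite lee_fin semicircle_pdf_ge0.
Qed.

End semicircle_mass.

Definition stieltjes_close (R : realType) (v tau : R) (zs : seq R[i]) (n : nat)
    (x : 'I_n -> R) : Prop :=
  forall z, z \in zs -> let m := n%:R^-1 * \sum_i ((x i)%:C - z)^-1 in
    normc (1 + z * m + v%:C * m ^+ 2) <= tau.

Lemma interval_mass_lower_bound (R : realType) (m v e : R) (I : set R) :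
  0 < v -> is_interval I -> 0 < e ->
  exists (zs : seq R[i]) (tau : R), [/\ 0 < tau, (forall z, z \in zs -> 0 < complex.Im z) &
   forall (n : nat) (x : 'I_n -> R), (0 < n)%N -> stieltjes_close v tau zs x ->
    fine (semicircle m v I) - e <= n%:R^-1 * \sum_i \1_I (m + x i)].
Proof.
move=> v0 intI e0; have mI := is_interval_measurable intI.
set s := 2 * Num.sqrt v.
have s0 : 0 < s by rewrite mulr_gt0 // sqrtr_gt0.
(* If the mass is zero, counts being nonnegative suffices and no grid point is needed. *)
have triv : fine (semicircle m v I) <= 0 ->
  exists (zs : seq R[i]) (tau : R), [/\ 0 < tau, (forall z, z \in zs -> 0 < complex.Im z) &
   forall (n : nat) (x : 'I_n -> R), (0 < n)%N -> stieltjes_close v tau zs x ->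
    fine (semicircle m v I) - e <= n%:R^-1 * \sum_i \1_I (m + x i)].
  move=> h; exists [::], 1; split => // n x n0 _.
  apply: (@le_trans _ _ 0); first by move: h e0; lra.
  by rewrite mulr_ge0 ?invr_ge0 // sumr_ge0.
pose S := I `&` `[m - s, m + s].
have [[x0 Sx0]|/set0P/negP/negPn/eqP S0] := pselect (S !=set0); last first.
  apply: triv; rewrite -lee_fin fineK ?semicircle_fin //.
  have ms : m - s <= m + s by move: s0; lra.
  have msm : m - s <= m - s by [].
  have := @semicircle_le R m v v0 I (m - s) (m - s) mI msm (lexx _) ms.
  rewrite subrr; apply => x Ix xJ; have : S x by split=> //=; rewrite in_itv.
  by rewrite S0.
have lbS : has_lbound S by exists (m - s) => x [_ /=]; rewrite in_itv /= => /andP[].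
have ubS : has_ubound S by exists (m + s) => x [_ /=]; rewrite in_itv /= => /andP[].
have S_ne : S !=set0 by exists x0.
pose al := inf S; pose be := sup S.
have al_ge : m - s <= al.
  by apply: lb_le_inf => // x [_ /=]; rewrite in_itv /= => /andP[].
have be_le : be <= m + s.
  by apply: ge_sup => // x [_ /=]; rewrite in_itv /= => /andP[].
have alx x : S x -> al <= x by exact: ge_inf.
have xbe x : S x -> x <= be by exact: ub_le_sup.
have ab : al <= be := le_trans (alx _ Sx0) (xbe _ Sx0).
have mass : fine (semicircle m v I) <=
    semicircle_primitive v (be - m) - semicircle_primitive v (al - m).
  rewrite -lee_fin fineK ?semicircle_fin //; apply: semicircle_le => //.
  move=> x Ix xJ; have Sx : S x by split=> //=; rewrite in_itv.
  by rewrite alx // xbe.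
move: ab; rewrite le_eqVlt => /orP[/eqP abE|ab].
  by apply: triv; rewrite (le_trans mass) // abE subrr.
have sub_I t : al < t -> t < be -> I t.
  move=> alt tbe.
  have [x [Ix _] xt] := inf_lt S_ne alt; have [y [Iy _] ty] := sup_gt S_ne tbe.
  by apply: (intI x y) => //; rewrite !ltW.
(* The grid is laid on the interval shrunk by [dl] at both ends, so that its enlargement by [dl] is
   the open interval between [al] and [be], contained in [I] whether or not the endpoints are.
   Continuity of the primitive makes the lost mass at most [e / 2]. *)
have [dl [dl0 dls Fa Fb]] : exists dl : R, [/\ 0 < dl, 4 * dl <= be - al,
   `|semicircle_primitive v (al - m) - semicircle_primitive v (al - m + dl)| <= e / 4 &
   `|semicircle_primitive v (be - m) - semicircle_primitive v (be - m - dl)| <= e / 4].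
  have e4 : 0 < e / 4 by exact: divr_gt0.
  have /cvgrPdist_le/(_ _ e4)/nbhs_ballP[d1 /= d10 h1] :=
    @continuous_semicircle_primitive R v v0 (al - m).
  have /cvgrPdist_le/(_ _ e4)/nbhs_ballP[d2 /= d20 h2] :=
    @continuous_semicircle_primitive R v v0 (be - m).
  pose dl := Num.min (Num.min (d1 / 2) (d2 / 2)) ((be - al) / 4).
  have dl0 : 0 < dl by rewrite !lt_min !divr_gt0 ?subr_gt0.
  have : dl <= dl by []. rewrite {2}/dl !le_min => /andP[/andP[l1 l2] l3].
  exists dl; split => //; first by move: l3; lra.
    apply: h1; rewrite /ball /= opprD addrA subrr add0r normrN gtr0_norm //.
    by move: l1 d10; lra.
  apply: h2; rewrite /ball /= opprB addrC subrK gtr0_norm //.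
  by move: l2 d20; lra.
have e2 : 0 < e / 2 by exact: divr_gt0.
have h1 : - (2 * Num.sqrt v) <= al - m + dl by move: al_ge dl0; rewrite -/s; lra.
have h2 : al - m + dl < be - m - dl by move: dls dl0 ab; lra.
have h3 : be - m - dl <= 2 * Num.sqrt v by move: be_le dl0; rewrite -/s; lra.
have [zs [tau [tau0 zs0 h]]] := semicircle_grid_bound v0 h1 h2 h3 dl0 e2.
exists zs, tau; split => // n x n0 close.
have := h n x n0 close; move: Fa Fb; rewrite !ler_distl => /andP[Fa _] /andP[_ Fb].
move=> hb; apply: (@le_trans _ _ (semicircle_primitive v (be - m - dl)
   - semicircle_primitive v (al - m + dl) - e / 2)).
  by move: mass Fa Fb; lra.
apply: le_trans hb _; rewrite ler_wpM2l ?invr_ge0 //; apply: ler_sum => i _.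
rewrite !indicE ler_nat; case: (boolP (x i \in _)) => //.
rewrite inE /= in_itv /= => /andP[x1 x2].
by rewrite mem_set //; apply: sub_I; move: x1 x2; lra.
Qed.

(* The upper bound follows from the lower bounds for the two components of the
   complement, since both laws have total mass [1]. *)
Lemma interval_mass_close (R : realType) (m v e : R) (I : set R) :
  0 < v -> is_interval I -> 0 < e ->
  exists (zs : seq R[i]) (tau : R), [/\ 0 < tau, (forall z, z \in zs -> 0 < complex.Im z) &
   forall (n : nat) (x : 'I_n -> R), (0 < n)%N -> stieltjes_close v tau zs x ->
    `|n%:R^-1 * \sum_i \1_I (m + x i) - fine (semicircle m v I)| <= e].
Proof.
move=> v0 intI e0.
have [[x0 Ix0]|/set0P/negP/negPn/eqP ->] := pselect (I !=set0); last first.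
  exists [::], 1; split => // n x _ _.
  rewrite /semicircle integral_set0 /= subr0 big1 ?mulr0 ?normr0 ?(ltW e0) // => i _.
  by rewrite indicE in_set0.
pose L : set R := [set x | forall y, I y -> x < y].
pose U : set R := [set x | forall y, I y -> y < x].
have intL : is_interval L.
  by move=> x y Lx Ly z /andP[_ zy] t It; apply: le_lt_trans zy (Ly t It).
have intU : is_interval U.
  by move=> x y Ux Uy z /andP[xz _] t It; apply: lt_le_trans (Ux t It) xz.
have cases x : [\/ [/\ L x, ~ I x & ~ U x], [/\ ~ L x, I x & ~ U x] | [/\ ~ L x, ~ I x & U x]].
  have [Ix|nIx] := pselect (I x).
    by constructor 2; split=> // h; have := h x Ix; rewrite ltxx.
  have [Lx|nLx] := pselect (L x).
    constructor 1; split=> // Ux.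
    by have := lt_trans (Lx _ Ix0) (Ux _ Ix0); rewrite ltxx.
  constructor 3; split=> // y Iy; rewrite ltNge; apply/negP => xy; apply: nLx => z Iz.
  rewrite ltNge; apply/negP => zx; apply: nIx; apply: (intI z y) => //.
  by rewrite zx xy.
have mL := is_interval_measurable intL; have mU := is_interval_measurable intU.
have mI := is_interval_measurable intI.
have tot : fine (semicircle m v L) + fine (semicircle m v I) + fine (semicircle m v U) = 1.
  have [fL fI fU] : [/\ semicircle m v L \is a fin_num, semicircle m v I \is a fin_num &
      semicircle m v U \is a fin_num] by split; exact: semicircle_fin.
  rewrite -(fineD fL fI) -fineD //; last by rewrite fin_numD fL.
  rewrite -!semicircleU //.
  - rewrite (_ : L `|` I `|` U = setT) ?semicircle_setT //.
    by apply/seteqP; split => // x _; case: (cases x) => -[] //=; tauto.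
  - exact: measurableU.
  - apply/eqP/seteqP; split => // x [[] h1 h2]; case: (cases x) => -[]; tauto.
  - apply/eqP/seteqP; split => // x [h1 h2]; case: (cases x) => -[]; tauto.
(* Half of [e] each, because the upper bound for [I] adds the errors made on [L] and on [U]. *)
have e2 : 0 < e / 2 by exact: divr_gt0.
have [zs1 [t1 [t10 zs10 h1]]] := interval_mass_lower_bound m v0 intL e2.
have [zs2 [t2 [t20 zs20 h2]]] := interval_mass_lower_bound m v0 intI e2.
have [zs3 [t3 [t30 zs30 h3]]] := interval_mass_lower_bound m v0 intU e2.
exists (zs1 ++ zs2 ++ zs3), (Num.min t1 (Num.min t2 t3)); split.
- by rewrite !lt_min t10 t20.
- by move=> z; rewrite !mem_cat => /or3P[/zs10|/zs20|/zs30].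
move=> n x n0 close.
have lb1 : stieltjes_close v t1 zs1 x.
  move=> z zz; have := close z; rewrite !mem_cat zz => /(_ isT) /le_trans; apply.
  by rewrite ge_min lexx.
have lb2 : stieltjes_close v t2 zs2 x.
  move=> z zz; have := close z; rewrite !mem_cat zz orbT => /(_ isT) /le_trans; apply.
  by rewrite !ge_min lexx orbT.
have lb3 : stieltjes_close v t3 zs3 x.
  move=> z zz; have := close z; rewrite !mem_cat zz !orbT => /(_ isT) /le_trans; apply.
  by rewrite !ge_min lexx !orbT.
have := h1 n x n0 lb1; have := h2 n x n0 lb2; have := h3 n x n0 lb3.
have : n%:R^-1 * (\sum_i \1_L (m + x i)) + n%:R^-1 * (\sum_i \1_I (m + x i))
    + n%:R^-1 * (\sum_i \1_U (m + x i)) = 1 :> R.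
  rewrite -!mulrDr -!big_split /= (eq_bigr (fun=> 1)).
    by rewrite sumr_const card_ord mulVf // pnatr_eq0 -lt0n.
  move=> i _; rewrite !indicE; case: (cases (m + x i)) => -[a b c].
  - by rewrite (mem_set a) (memNset b) (memNset c) !addr0.
  - by rewrite (memNset a) (mem_set b) (memNset c) addr0 add0r.
  - by rewrite (memNset a) (memNset b) (mem_set c) !add0r.
by move: tot; rewrite ler_norml; move=> *; apply/andP; split; lra.
Qed.

(** * Spectra of random Hermitian matrices *)

Section spectral_calculus.
Context (R : realType) (n : nat) (U : 'M[R[i]]_n).
Hypothesis U_unit : U \in unitmx.

Definition conj_diag (D : 'I_n -> R[i]) : 'M[R[i]]_n :=
  invmx U *m diag_mx (\row_j D j) *m U.

Lemma conj_diagM D1 D2 :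
  conj_diag D1 *m conj_diag D2 = conj_diag (fun j => D1 j * D2 j).
Proof.
have e : diag_mx (\row_j (D1 j * D2 j)) = diag_mx (\row_j D1 j) *m diag_mx (\row_j D2 j).
  by rewrite mulmx_diag; congr diag_mx; apply/rowP => j; rewrite !mxE.
by rewrite /conj_diag e !mulmxA mulmxK.
Qed.

Lemma conj_diag_cst z : conj_diag (fun=> z) = z%:M.
Proof.
rewrite /conj_diag (_ : diag_mx _ = z%:M); last first.
  by rewrite -diag_const_mx; congr diag_mx; apply/rowP => j; rewrite !mxE.
by rewrite -mulmxA mul_scalar_mx -scalemxAr mulVmx // scalemx1.
Qed.

Lemma conj_diagB D1 D2 :
  conj_diag D1 - conj_diag D2 = conj_diag (fun j => D1 j - D2 j).
Proof.
have e : diag_mx (\row_j (D1 j - D2 j)) = diag_mx (\row_j D1 j) - diag_mx (\row_j D2 j).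
  by rewrite -raddfB; congr diag_mx; apply/rowP => j; rewrite !mxE.
by rewrite /conj_diag e mulmxBr mulmxBl.
Qed.

Lemma conj_diagZ a D : a *: conj_diag D = conj_diag (fun j => a * D j).
Proof.
have e : diag_mx (\row_j (a * D j)) = a *: diag_mx (\row_j D j).
  by rewrite -linearZ; congr diag_mx; apply/rowP => j; rewrite !mxE.
by rewrite /conj_diag e -scalemxAr -scalemxAl.
Qed.

Lemma conj_diagX D k : conj_diag D ^+ k = conj_diag (fun j => D j ^+ k).
Proof.
elim: k => [|k IH]; first by rewrite expr0 -[RHS]/(conj_diag (fun=> 1)) conj_diag_cst.
by rewrite exprS IH -[LHS]/(_ *m _) conj_diagM; congr conj_diag; apply/funext => j; rewrite exprS.
Qed.

Lemma mxtrace_conj_diag D : \tr (conj_diag D) = \sum_j D j.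
Proof.
rewrite /conj_diag mxtrace_mulC mulmxA mulmxV // mul1mx mxtrace_diag.
by apply: eq_bigr => j _; rewrite mxE.
Qed.

Lemma conj_diag_mulV D z : (forall j, D j != z) ->
  (conj_diag D - z%:M) *m conj_diag (fun j => (D j - z)^-1) = 1%:M.
Proof.
move=> Dz; rewrite -!conj_diag_cst conj_diagB conj_diagM; congr conj_diag.
by apply/funext => j; rewrite mulfV // subr_eq0.
Qed.

Lemma conj_diag_shift_unit D z : (forall j, D j != z) ->
  conj_diag D - z%:M \in unitmx.
Proof. by move=> /conj_diag_mulV/mulmx1_unit[u _]; exact: u. Qed.

Lemma mxtrace_resolvent_conj_diag D z : (forall j, D j != z) ->
  \tr (resolvent (conj_diag D) z) = \sum_j (D j - z)^-1.
Proof.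
move=> Dz; rewrite /resolvent -mxtrace_conj_diag -[invmx _]mulmx1.
by rewrite -(conj_diag_mulV Dz) mulKmx //; exact: conj_diag_shift_unit.
Qed.

End spectral_calculus.

Section hermitian_spectrum.
Context (R : realType) (n : nat) (A : 'M[R[i]]_n).
Hypothesis A_herm : A ^t* = A.

Definition eigval (j : 'I_n) : R := complex.Re (spectral_diag A 0 j).

Lemma hermitian_conj_diag : A = conj_diag (spectralmx A) (fun j => (eigval j)%:C).
Proof.
have Ah : A \is hermsymmx.
  by apply/is_hermitianmxP; rewrite expr0 scale1r A_herm.
have /orthomx_spectralP := hermitian_normalmx Ah.
have -> : spectral_diag A = \row_j (eigval j)%:C; last by [].
apply/rowP => j; rewrite mxE.
have /mxOverP/(_ 0 j) := hermitian_spectral_diag_real Ah.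
rewrite /eigval; case: (spectral_diag A 0 j) => a b /=.
by rewrite complex_real => /eqP ->.
Qed.

End hermitian_spectrum.

(** Bernoulli's inequality; [kap <= 1] absorbs the shift from [k] to [k + 1]. *)
Lemma linear_le_expr (R : realType) (q kap : R) (k : nat) :
  0 < kap -> kap <= 1 -> kap <= q - 1 -> k.+1%:R * kap <= q ^+ k.
Proof.
move=> kap0 kap1 kapq; have q1 : 1 <= q by move: kap0 kapq; lra.
elim: k => [|k IH]; first by rewrite mul1r expr0.
rewrite exprS; have := exprn_ege1 k q1; move: IH; rewrite -(natr1 k.+1).
by move: (q ^+ k) (k.+1%:R) => Q K; nra.
Qed.

Section spectral_measurability.
Context (disp : measure_display) (T : measurableType disp) (R : realType) (n : nat)
  (Y : T -> 'M[R[i]]_n).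
Hypotheses (Y_meas : mxmeasurable Y) (Y_herm : forall t, (Y t) ^t* = Y t).

Let good (f : R -> R) := measurable_fun setT (fun t => \sum_j f (eigval (Y t) j)).

(** The constant may depend on [x]: each matrix has finitely many eigenvalues, so the constants add
    up and the spectral sums converge pointwise. *)
Let good_lim (h : nat -> R -> R) (f : R -> R) : (forall k, good (h k)) ->
  (forall x, exists C, forall k, `|h k x - f x| <= C * k.+1%:R^-1) -> good f.
Proof.
move=> gh hf.
apply: (@measurable_fun_cvg _ _ _ _ (fun k t => \sum_j h k (eigval (Y t) j))) => // t _.
have /choice[C hC] := fun j => hf (eigval (Y t) j).
apply/cvgrPdist_le => e e0; near=> k; rewrite distrC.
apply: (@le_trans _ _ ((\sum_j C j) * k.+1%:R^-1)).
  rewrite -sumrB mulr_suml; apply: le_trans (ler_norm_sum _ _ _) _.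
  by apply: ler_sum.
apply: le_trans (ler_norm _) _; near: k.
have /cvgrPdist_le/(_ _ e0) : (\sum_j C j) * k.+1%:R^-1 @[k --> \oo] --> (\sum_j C j) * 0.
  by apply: cvgM; [exact: cvg_cst|exact: cvg_harmonic].
by apply: filterS => k; rewrite mulr0 sub0r normrN.
Unshelve. all: by end_near. Qed.

(** Let [u] map the interval onto [[-1, 1]]. With [eta = k + 1], the function
    [eta ^ 2 / (u ^ (4 k) + eta ^ 2)] tends to [1] if [|u| <= 1] and to [0] otherwise, as the power
    then outgrows [eta ^ 2]. It is [eta] times the imaginary part of [(u ^ (2 k) - i eta)^-1], so
    its spectral sum is read off from a resolvent trace. Letting [eta] grow gives the limit [1] at
    the endpoints too, where a fixed [eta] would not. *)
Let good_closed c r : 0 < r -> good \1_(`[c - r, c + r]%classic).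
Proof.
move=> r0; pose u x := r^-1 * (x - c).
pose eta (k : nat) : R := k.+1%:R.
apply: (@good_lim (fun k x => eta k * poisson_kernel (eta k) (u x ^+ (2 * k) - 0))).
  move=> k; have eta0 : 0 < eta k by rewrite ltr0n.
  pose B t := ((r^-1)%:C *: (Y t - (c%:C)%:M)) ^+ (2 * k).
  have BE t : B t = conj_diag (spectralmx (Y t)) (fun j => (u (eigval (Y t) j) ^+ (2 * k))%:C).
    rewrite /B {1}(hermitian_conj_diag (Y_herm t)).
    rewrite -(conj_diag_cst (spectral_unit (Y t))) conj_diagB conj_diagZ.
    rewrite (conj_diagX (spectral_unit (Y t))); congr conj_diag; apply/funext => j.
    by rewrite /u -rmorphB -rmorphM -rmorphXn.
  have nz t j : (u (eigval (Y t) j) ^+ (2 * k))%:C != 0 +i* eta k.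
    by rewrite eq_complex /= negb_and (lt_eqF eta0) orbT.
  have mB : mxmeasurable B.
    have mS : mxmeasurable (fun t => (r^-1)%:C *: (Y t - (c%:C)%:M)).
      by apply: mxmeasurableZ; apply: mxmeasurableD => //; exact: mxmeasurable_cst.
    rewrite /B; elim: (2 * k)%N => [|l IH].
      by under eq_fun do rewrite expr0; exact: mxmeasurable_cst.
    under eq_fun do rewrite exprS.
    exact: mxmeasurableM.
  have mtr : cmeasurable (fun t => \tr (resolvent (B t) (0 +i* eta k))).
    apply: cmeasurable_mxtrace; apply: mxmeasurable_inv => [t|].
      by rewrite BE; apply: conj_diag_shift_unit => //; exact: spectral_unit.
    by apply: mxmeasurableD => //; exact: mxmeasurable_cst.
  rewrite /good (_ : (fun t => _) = (fun t => eta k *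
      complex.Im (\tr (resolvent (B t) (0 +i* eta k))))).
    by apply: measurable_funM => //; have [] := mtr.
  apply/funext => t; rewrite BE mxtrace_resolvent_conj_diag //; last exact: spectral_unit.
  by rewrite Im_sum mulr_sumr; apply: eq_bigr => j _; rewrite Im_inv_sub.
move=> x.
have phiE k : eta k * poisson_kernel (eta k) (u x ^+ (2 * k) - 0) =
    eta k ^+ 2 / (`|u x| ^+ k ^+ 4 + eta k ^+ 2).
  rewrite /poisson_kernel subr0 mulrA -expr2; congr (_ / (_ + _)).
  rewrite -!exprM -[in RHS](_ : (2 * k * 2)%N = (k * 4)%N); last by rewrite mulnC mulnA mulnC.
  by rewrite -normrX ger0_norm // exprM sqr_ge0.
have e0 k : 0 < eta k by rewrite ltr0n.
have e1 k : 1 <= eta k by rewrite ler1n.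
have xI : (x \in `[c - r, c + r]%classic) = (`|u x| <= 1).
  rewrite /u normrM gtr0_norm ?invr_gt0 // mulrC ler_pdivrMr // mul1r.
  by rewrite ler_distl; apply/idP/idP; rewrite inE /= in_itv.
rewrite indicE xI; have [u1|u1] := leP `|u x| 1.
  exists 1 => k; rewrite phiE mul1r /=.
  have q1 : `|u x| ^+ k ^+ 4 <= 1 by rewrite !exprn_ile1 // exprn_ge0.
  have q0 : 0 <= `|u x| ^+ k ^+ 4 by rewrite !exprn_ge0.
  move: q0 q1 (e0 k) (e1 k); rewrite -/(eta k); move: (`|u x| ^+ k ^+ 4) (eta k) => q E q0 q1 E0 E1.
  have d0 : 0 < q + E ^+ 2 by rewrite ltr_wpDl // exprn_gt0.
  rewrite distrC (_ : 1 - _ = q / (q + E ^+ 2)); last by field; rewrite gt_eqF.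
  rewrite ger0_norm ?divr_ge0 ?(ltW d0) // ler_pdivrMr // mulrC ler_pdivlMr //.
  by nra.
pose kap := Num.min 1 (`|u x| - 1).
have kap0 : 0 < kap by rewrite lt_min ltr01 subr_gt0.
have k1 : kap <= 1 by rewrite ge_min lexx.
have k2 : kap <= `|u x| - 1 by rewrite ge_min lexx orbT.
exists (kap ^- 4) => k; rewrite phiE subr0 -/(eta k).
have := linear_le_expr k kap0 k1 k2; rewrite -/(eta k).
move: (`|u x| ^+ k) (eta k) (e0 k) (e1 k) => q E E0 E1 qE.
have q0 : 0 < q by apply: lt_le_trans qE; rewrite mulr_gt0.
have E2 : 0 < E ^+ 2 by rewrite exprn_gt0.
have d0 : 0 < q ^+ 4 + E ^+ 2 by rewrite addr_gt0 // exprn_gt0.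
rewrite ger0_norm ?divr_ge0 ?(ltW d0) ?(ltW E2) //.
have q4 : (E * kap) ^+ 4 <= q ^+ 4.
  by apply: lerXn2r => //; rewrite nnegrE ltW // mulr_gt0.
rewrite -invfM ler_pdivrMr // mulrC ler_pdivlMr ?mulr_gt0 ?exprn_gt0 //.
apply: (@le_trans _ _ ((E * kap) ^+ 4)); last by rewrite (le_trans q4) // lerDl ltW.
rewrite exprMn mulrA (_ : E ^+ 2 * kap ^+ 4 * E = kap ^+ 4 * E ^+ 3); last by ring.
rewrite mulrC ler_wpM2r ?exprn_ge0 ?(ltW kap0) //.
by rewrite ler_weXn2l.
Qed.

Let good_ray a : good \1_(`[a, +oo[%classic).
Proof.
apply: (@good_lim (fun k => \1_(`[a + k.+1%:R - k.+1%:R, a + k.+1%:R + k.+1%:R]%classic))).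
  by move=> k; apply: good_closed; rewrite ltr0n.
(* The indicators differ only if [x] lies beyond [a + 2 (k + 1)], and then [|x - a| / (k + 1)]
   exceeds [1]. *)
move=> x; exists `|x - a| => k.
have K0 : 0 < k.+1%:R :> R by rewrite ltr0n.
rewrite !indicE addrK; case: (boolP (x \in `[a, +oo[%classic)); last first.
  move=> h; rewrite (_ : _ \in _ = false) ?subrr ?normr0; last first.
    apply/negbTE; apply: contra h; rewrite !inE /= !in_itv /= => /andP[-> _].
    by [].
  by rewrite mulr_ge0 // invr_ge0 ltW.
rewrite inE /= in_itv /= andbT => ax.
case: (boolP (x \in _)) => [_|]; first by rewrite subrr normr0 mulr_ge0 // invr_ge0 ltW.
rewrite sub0r normrN normr1 notin_setE /= in_itv /= ax /= => /negP; rewrite -ltNge => h.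
rewrite ler_pdivlMr // mul1r ger0_norm ?subr_ge0 //.
by move: h K0; lra.
Qed.

(** No measurable ordering of the eigenvalues is at hand, so only sums over the whole spectrum are
    considered. The sets whose count is measurable form a Dynkin system containing the closed
    rays. *)
Lemma measurable_spectral_count (A : set R) : measurable A ->
  measurable_fun setT (fun t => \sum_j \1_A (eigval (Y t) j) : R).
Proof.
move=> mA; pose Q (A : set R) := good \1_A; rewrite -/(good _) -/(Q A).
have ind := @dynkin_induction _ R (@RGenCInfty.G R) Q.
have mE : @measurable _ R = <<s @RGenCInfty.G R >> := RGenCInfty.measurableE R.
have {}mA : <<s @RGenCInfty.G R >> A by rewrite -mE.
apply: (ind mE) mA.
- move=> _ _ [a ->] [b ->]; exists (Num.max a b).
  apply/seteqP; split => x /=; rewrite !in_itv /= !andbT ge_max.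
    by move=> [-> ->].
  by move=> /andP[].
- rewrite /Q /good (_ : (fun t => _) = (fun=> n%:R)); first exact: measurable_cst.
  apply/funext => t; rewrite -[n in RHS]card_ord -sumr_const.
  by apply: eq_bigr => j _; rewrite indicT.
- by move=> _ [a ->]; exact: good_ray.
- move=> S mS gS; rewrite /Q /good.
  rewrite (_ : (fun t => _) = (fun t => n%:R - \sum_j \1_S (eigval (Y t) j))).
    by apply: measurable_funB.
  apply/funext => t; rewrite -[n in n%:R]card_ord -sumr_const -sumrB.
  by apply: eq_bigr => j _; rewrite !indicE in_setC; case: (_ \in S); rewrite ?subrr ?subr0.
- move=> F mF tF gF.
  apply: (@good_lim (fun k x => \sum_(i < k) \1_(F i) x)).
    move=> k; rewrite /good; under eq_fun do rewrite exchange_big /=.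
    by apply: measurable_sum => i; exact: gF.
  move=> x; have [[i _ Fix]|nF] := pselect ((\bigcup_k F k) x); last first.
    exists 0 => k; rewrite mul0r indicE memNset // big1 ?subrr ?normr0 // => i _.
    by rewrite indicE memNset // => h; apply: nF; exists (i : nat).
  (* The partial sum is exact as soon as [k > i]; for [k <= i] the error is [1], at most
     [(i + 1) / (k + 1)]. *)
  exists i.+1%:R => k; rewrite [\1_(\bigcup_k _) x]indicE mem_set; last by exists i.
  have [ki|ik] := leqP k i.
    rewrite big1 => [|j _]; last first.
      rewrite indicE memNset // => Fjx.
      have ji := tF _ _ I I (ex_intro _ x (conj Fjx Fix)).
      by have := leq_trans (ltn_ord j) ki; rewrite ji ltnn.
    rewrite sub0r normrN normr1 ler_pdivlMr ?ltr0n // mul1r ler_nat.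
    by rewrite ltnS.
  rewrite (bigD1 (Ordinal ik)) //= big1 => [|j ji]; last first.
    rewrite indicE memNset // => Fjx.
    have e := tF _ _ I I (ex_intro _ x (conj Fjx Fix)).
    by move/negP: ji; apply; apply/eqP/val_inj.
  by rewrite indicE mem_set // addr0 subrr normr0 mulr_ge0.
Qed.

Lemma measurable_empirical_spectral_measure (A : set R) : measurable A ->
  measurable_fun setT (fun t => empirical_spectral_measure (Y t) A).
Proof.
by move=> mA; apply: measurable_funM => //; exact: measurable_spectral_count.
Qed.

End spectral_measurability.

(** * Convergence *)

Lemma probability_le_Rintegral (disp : measure_display) (T : measurableType disp)
    (R : realType) (P : probability T R) (A : set T) (X : T -> R) :
  measurable A -> rintegrable P X -> (forall t, 0 <= X t) ->
  (forall t, A t -> 1 <= X t) -> (P A <= (\int[P]_t X t)%:E)%E.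
Proof.
move=> mA iX X0 X1; rewrite -[A in P A]setIT -(integral_indic P measurableT mA) fineK; last first.
  exact: integrable_fin_num.
apply: ge0_le_integral => //.
- by apply/measurable_EFinP; exact: measurable_indic.
- by have /integrableP[] := iX.
move=> t _; rewrite lee_fin indicE; case: (boolP (t \in A)) => // tA.
exact: X1 (set_mem tA).
Qed.

Lemma stieltjes_eigval (R : realType) (n : nat) (A : 'M[R[i]]_n) (c : R) (z : R[i]) :
  A ^t* = A -> complex.Im z != 0 ->
  stieltjes (A - c%:C%:M) z = n%:R^-1 * \sum_j ((eigval A j - c)%:C - z)^-1.
Proof.
move=> hA z0; rewrite /stieltjes {1}(hermitian_conj_diag hA).
rewrite -(conj_diag_cst (spectral_unit A)) conj_diagB.
rewrite (mxtrace_resolvent_conj_diag (spectral_unit A)) => [|j].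
  by congr (_ * _); apply: eq_bigr => j _; rewrite -rmorphB.
rewrite -rmorphB; apply: contra z0 => /eqP <-.
by rewrite eqxx.
Qed.

(** The moment bound concerns the variance [n / p], the limit law the variance [1 / alpha]; since
    [|m| <= 1 / Im z], passing from one to the other is a deterministic error. *)
Lemma normc_defect_change (R : realType) (d : nat) (u v : R) (H : 'M[R[i]]_(d ^ 2)) (z : R[i]) :
  (0 < d)%N -> 0 < complex.Im z -> H ^t* = H ->
  normc (defect v H z) <= normc (defect u H z) + `|v - u| * (complex.Im z)^-1 ^+ 2.
Proof.
move=> d0 z0 hH; have mb := normc_stieltjes_le d0 z0 hH.
rewrite (_ : defect v H z = defect u H z + (v - u)%:C * stieltjes H z ^+ 2); last first.
  by rewrite /defect rmorphB; ring.
apply: le_trans (normcD_le _ _) _; rewrite lerD2l normcM normc_real ler_wpM2l //.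
by rewrite !expr2 normcM ler_pM ?normc_ge0.
Qed.

(** Chebyshev's inequality and the union bound are combined in the single variable [X], which is at
    least [1] as soon as one defect for [n / p] reaches [tau / 2]. The other half of [tau] pays for
    replacing [n / p] by [v]. *)
Lemma wishart_event_bound (disp : measure_display) (T : measurableType disp)
    (R : realType) (P : probability T R) (kind : entry_kind) (d p : nat)
    (W : T -> 'M[R[i]]_(d ^ 2)) (v Pb tau eps mass : R) (zs : seq R[i]) (I : set R) :
  is_wishart P kind p W -> (0 < d)%N -> (0 < p)%N -> measurable I -> 0 < tau ->
  (d ^ 2)%:R / p%:R <= Pb -> (forall z, z \in zs -> 0 < complex.Im z) ->
  (forall z, z \in zs -> `|v - (d ^ 2)%:R / p%:R| * (complex.Im z)^-1 ^+ 2 <= tau / 2) ->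
  (forall x : 'I_(d ^ 2) -> R, stieltjes_close v tau zs x ->
    `|(d ^ 2)%:R^-1 * \sum_i \1_I (1 + x i) - mass| <= eps) ->
  (P [set t | (eps < `| empirical_spectral_measure (partial_transpose (W t)) I - mass |)%R ] <=
   (\sum_(z <- zs) (tau / 2) ^- 2 *
     second_moment_constant (eighth_moment_bound R kind) Pb (complex.Im z)^-1 (normc z) *
     (Num.sqrt d%:R)^-1)%R%:E)%E.
Proof.
move=> [G gG WE] d0 p0 mI tau0 cP zs0 cv close.
have pC0 : p%:R != 0 :> R[i] by rewrite pnatr_eq0 -lt0n.
pose Y t := partial_transpose (W t).
have YE t : Y t = Hmat G t + 1%:M.
  rewrite /Y WE partial_transpose_gram /Hmat /Zcol sumrB sumr_const card_ord scalerBr.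
  by rewrite -(scaler_nat p (1%:M : 'M[R[i]]_(d ^ 2))) scalerA mulVf // scale1r subrK.
have Hh t : (Hmat G t) ^t* = Hmat G t := Hmat_herm G t.
have Yh t : (Y t) ^t* = Y t.
  rewrite YE raddfD /= map_mxD Hh; congr (_ + _).
  by rewrite tr_scalar_mx map_scalar_mx /= rmorph1.
have YH t : Y t - (1 : R)%:C%:M = Hmat G t by rewrite YE rmorph1 addrK.
have mY : mxmeasurable Y.
  rewrite (funext YE); apply: mxmeasurableD; last exact: mxmeasurable_cst.
  exact: (mxmeasurable_Hmat gG).
pose D z t := normc (defect ((d ^ 2)%:R / p%:R) (Hmat G t) z) ^+ 2.
pose X t := \sum_(z <- zs) (tau / 2) ^- 2 * D z t.
have tau2 : 0 < tau / 2 by exact: divr_gt0.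
have iD z : z \in zs -> rintegrable P (D z).
  by move=> zz; have [] := expectation_sqr_defect gG d0 p0 (zs0 z zz) cP.
(* Integrability is known only for [z] in [zs], where [Im z > 0]; the default value [0] elsewhere
   makes the summand integrable for every [z]. *)
have XE t : X t = \sum_(z <- zs) (if z \in zs then (tau / 2) ^- 2 * D z t else 0).
  by rewrite /X big_seq [RHS]big_seq; apply: eq_bigr => z ->.
have iZ z : rintegrable P (fun t => if z \in zs then (tau / 2) ^- 2 * D z t else 0).
  case: (boolP (z \in zs)) => [zz|_]; last exact: rintegrable_cst.
  exact/rintegrableZ/iD.
have iX : rintegrable P X by rewrite (funext XE); exact: rintegrable_sum.
have D0 z t : 0 <= (tau / 2) ^- 2 * D z t.
  by rewrite mulr_ge0 // ?sqr_ge0 // invr_ge0 sqr_ge0.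
apply: (@le_trans _ _ (\int[P]_t X t)%:E).
  apply: probability_le_Rintegral => //.
  - have mN := measurable_empirical_spectral_measure mY Yh mI.
    have mf : measurable_fun setT (fun t => `|empirical_spectral_measure (Y t) I - mass|).
      by apply: measurableT_comp => //; exact: measurable_funB.
    have := mf measurableT _ (measurable_itv `]eps, +oo[); rewrite setTI.
    congr (measurable _); apply/seteqP; split => t /=.
      by rewrite in_itv /= andbT.
    by rewrite in_itv /= andbT.
  - by move=> t; rewrite sumr_ge0.
  move=> t /= far.
  have [[z zz taz]|no] := pselect (exists2 z, z \in zs & tau < normc (defect v (Hmat G t) z)).
    have : tau / 2 <= normc (defect ((d ^ 2)%:R / p%:R) (Hmat G t) z).
      have h1 := normc_defect_change ((d ^ 2)%:R / p%:R) v d0 (zs0 z zz) (Hh t).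
      have := lt_le_trans taz (le_trans h1 (lerD (lexx _) (cv z zz))).
      by move: (normc _) => x; lra.
    move=> h; rewrite /X (big_rem z zz) /= ler_wpDr ?sumr_ge0 //.
    rewrite mulrC ler_pdivlMr ?exprn_gt0 // mul1r.
    by apply: lerXn2r; rewrite ?nnegrE ?normc_ge0 // ltW.
  exfalso; move: far; rewrite ltNge => /negP; apply.
  have cl : stieltjes_close v tau zs (fun j => eigval (Y t) j - 1).
    move=> z zz /=; rewrite leNgt; apply/negP => taz; apply: no; exists z => //.
    by rewrite /defect -YH stieltjes_eigval // gt_eqF // zs0.
  have := close _ cl; congr (`|_ * _ - _| <= _).
  by apply: eq_bigr => j _; rewrite addrC subrK.
rewrite lee_fin.
have -> : \int[P]_t X t = \sum_(z <- zs)
    \int[P]_t (if z \in zs then (tau / 2) ^- 2 * D z t else 0).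
  by rewrite -Rintegral_sum //; apply: eq_Rintegral => t _; exact: XE.
rewrite big_seq [leRHS]big_seq; apply: ler_sum => z zz.
under eq_Rintegral do rewrite zz.
have [iDz ED] := expectation_sqr_defect gG d0 p0 (zs0 z zz) cP.
rewrite (RintegralZl _ measurableT iDz) -mulrA ler_wpM2l //.
by rewrite invr_ge0 sqr_ge0.
Qed.

Lemma cvg_inv_sqrt (R : realType) (C : R) :
  C * (Num.sqrt d%:R)^-1 @[d --> \oo] --> (0 : R).
Proof.
apply/cvgrPdist_le => e e0; near=> d.
have dC : (`|C| / e) ^+ 2 + 1 <= d%:R by near: d; exact: nbhs_infty_ger.
have sd : `|C| / e <= Num.sqrt d%:R.
  rewrite -[leLHS]ger0_norm ?divr_ge0 ?(ltW e0) // -sqrtr_sqr; apply: ler_wsqrtr.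
  by apply: le_trans dC; rewrite lerDl.
have d0 : 0 < Num.sqrt d%:R :> R.
  by rewrite sqrtr_gt0; apply: lt_le_trans dC; rewrite ltr_wpDl // sqr_ge0.
rewrite sub0r normrN normrM normfV (gtr0_norm d0) ler_pdivrMr //.
by move: sd; rewrite ler_pdivrMr // mulrC.
Unshelve. all: by end_near. Qed.

(** The floor loses less than [1], so the difference is at most [1 / (alpha p)]. The threshold on
    [d] gives [alpha d ^ 2 >= alpha d >= 1 + 1 / (alpha kap)], hence [p >= 1 / (alpha kap)]. *)
Lemma ratio_truncn (R : realType) (alpha kap : R) (d : nat) : 0 < alpha -> 0 < kap ->
  kap <= alpha^-1 -> (1 + (alpha * kap)^-1) / alpha <= d%:R ->
  let p := Num.truncn (alpha * d%:R ^+ 2) in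
  [/\ (0 < d)%N, (0 < p)%N & `|alpha^-1 - (d ^ 2)%:R / p%:R| <= kap].
Proof.
move=> a0 k0 ka dl p.
have ak0 : 0 < alpha * kap by rewrite mulr_gt0.
have ak1 : 1 <= (alpha * kap)^-1.
  by rewrite invf_ge1 // -(mulfV (lt0r_neq0 a0)) ler_wpM2l // ltW.
have d0 : (0 < d)%N.
  rewrite -(ltr0n R); apply: lt_le_trans dl; apply: divr_gt0 => //.
  by move: ak1; lra.
have d1 : 1 <= d%:R :> R by rewrite ler1n.
have dR : 0 < d%:R :> R by rewrite ltr0n.
have N0 : 0 <= alpha * d%:R ^+ 2 by rewrite mulr_ge0 ?exprn_ge0 // ltW.
have /andP[pN Np] := truncn_itv N0.
rewrite -/p -natr1 in pN Np.
have pge : (alpha * kap)^-1 <= p%:R.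
  have : alpha * d%:R <= alpha * d%:R ^+ 2.
    by rewrite ler_wpM2l ?(ltW a0) // ler_eXnr.
  by move: dl; rewrite ler_pdivrMr // mulrC; move: Np; lra.
have p0 : (0 < p)%N by rewrite -(ltr0n R); apply: lt_le_trans pge; rewrite invr_gt0.
have pR : 0 < p%:R :> R by rewrite ltr0n.
split=> //.
have -> : alpha^-1 - (d ^ 2)%:R / p%:R = - ((alpha * d%:R ^+ 2 - p%:R) / (alpha * p%:R)).
  by rewrite natrX; field; rewrite !gt_eqF.
have ap : 0 < alpha * p%:R by rewrite mulr_gt0.
rewrite normrN ger0_norm; last by rewrite divr_ge0 ?subr_ge0 // ltW.
rewrite ler_pdivrMr //; apply: (@le_trans _ _ 1); first by move: Np; lra.
rewrite -[leLHS](mulfV (lt0r_neq0 ak0)) (_ : kap * (alpha * p%:R) = alpha * kap * p%:R).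
  by rewrite ler_pM2l.
by ring.
Qed.
Theorem theorem1 (R : realType) (alpha : R) (alpha_gt0 : 0 < alpha)
  (kind : entry_kind)
  (disp : nat -> measure_display)
  (T : forall d : nat, measurableType (disp d))
  (P : forall d : nat, probability (T d) R)
  (W : forall d : nat, T d -> 'M[R[i]]_(d ^ 2))
  (W_wishart : forall d : nat, (0 < d)%N ->
     (1 <= Num.truncn (alpha * d%:R ^+ 2))%N ->
     is_wishart (P d) kind (Num.truncn (alpha * d%:R ^+ 2)) (W d))
  (I : set R) (I_interval : is_interval I)
  (eps : R) (eps_gt0 : 0 < eps) :
  P d [set t | eps < `| empirical_spectral_measure (partial_transpose (W d t)) I
                        - fine (semicircle 1 alpha^-1 I) | ]
    @[d --> \oo] --> 0%E.
Proof.
have v0 : 0 < alpha^-1 by rewrite invr_gt0.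
have [zs [tau [tau0 zs0 close]]] := interval_mass_close 1 v0 I_interval eps_gt0.
(* [bm] dominates [(Im z)^-2] for every grid point at once, and the [1 +] in [kap] avoids a division
   by zero when the grid is empty. The second bound on [kap] ensures [n / p <= 2 / alpha], the value
   used in [C]. *)
pose bm := \sum_(z <- zs) (complex.Im z)^-1 ^+ 2.
have bm0 : 0 <= bm by rewrite sumr_ge0 // => z _; rewrite sqr_ge0.
pose kap := Num.min (tau / 2 / (1 + bm)) alpha^-1.
have bm1 : 0 < 1 + bm by rewrite ltr_pwDl.
have kap0 : 0 < kap by rewrite lt_min v0 andbT !divr_gt0.
have kapv : kap <= alpha^-1 by rewrite ge_min lexx orbT.
have kapt : kap * (1 + bm) <= tau / 2 by rewrite -ler_pdivlMr // ge_min lexx.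
pose C := \sum_(z <- zs) (tau / 2) ^- 2 * second_moment_constant
  (eighth_moment_bound R kind) (2 * alpha^-1) (complex.Im z)^-1 (normc z).
apply: (@squeeze_cvge _ _ _ _ (fun=> 0%E) _ (fun d => (C * (Num.sqrt d%:R)^-1)%:E)).
- near=> d; rewrite measure_ge0 /=.
  have dl : (1 + (alpha * kap)^-1) / alpha <= d%:R by near: d; exact: nbhs_infty_ger.
  have [d0 p0 cv] := ratio_truncn alpha_gt0 kap0 kapv dl.
  rewrite /C mulr_suml; apply: (wishart_event_bound (v := alpha^-1) (W_wishart d d0 p0)) => //.
  + exact: is_interval_measurable.
  + by move: cv kapv; rewrite ler_distl => /andP[+ _]; lra.
  + move=> z zz; apply: le_trans kapt; apply: ler_pM => //; first exact: sqr_ge0.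
    apply: (@le_trans _ _ bm); last by rewrite lerDr.
    by rewrite /bm (big_rem z zz) /= lerDl sumr_ge0 // => w _; rewrite sqr_ge0.
  + by move=> x; apply: close; rewrite expn_gt0 d0.
- exact: cvg_cst.
- by apply: cvg_EFin; [exact: nearW|exact: cvg_inv_sqrt].
Unshelve. all: by end_near. Qed.
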